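(* Let $k\ge 1$ and let $\{(X_n,Y_n);\,n\ge -k+1\}$ be a (time-homogeneous) Markov chain of memory length $k$ on the finite alphabet $A\times B$, with an arbitrary initial distribution for $(X_{-k+1}^0,Y_{-k+1}^0)$ and with an all-positive transition matrix $Q$, that is, $Q(a_k,b_k\mid a_0^{k-1},b_0^{k-1})>0$ for all $a_0^k\in A^{k+1}$, $b_0^k\in B^{k+1}$. Let $m=|A|$, $\ell=|B|$, let $\{(\bar X_n,\bar Y_n)\}$ be the stationary version of the chain, and let $\hat I_n^{(k)}(\boldsymbol X\to\boldsymbol Y)$ be the plug-in estimator. (i) If $I(\bar Y_0;\bar X_{-k}^0\mid\bar Y_{-k}^{-1})$ is nonzero, then, as $n\to\infty$, $$\sqrt n\,\big[\hat I_n^{(k)}(\boldsymbol X\to\boldsymbol Y)-I(\bar Y_0;\bar X_{-k}^0\mid\bar Y_{-k}^{-1})\big]\ \xrightarrow{\ \mathcal D\ }\ N(0,\sigma^2),$$ where $\sigma^2$ is given by the following limit, which exists and is finite: $$\sigma^2=\lim_{n\to\infty}\frac1n\,\mathrm{Var}\left\{\log\left[\prod_{i=1}^n\frac{P_{\bar X_{-k}^0\bar Y_0|\bar Y_{-k}^{-1}}(X_{i-k}^i,Y_i\mid Y_{i-k}^{i-1})}{P_{\bar Y_0|\bar Y_{-k}^{-1}}(Y_i\mid Y_{i-k}^{i-1})\,P_{\bar X_{-k}^0|\bar Y_{-k}^{-1}}(X_{i-k}^i\mid Y_{i-k}^{i-1})}\right]\right\}.$$ (ii) If, on the other hand, $I(\bar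 Y_0;\bar X_{-k}^0\mid\bar Y_{-k}^{-1})=0$, then, as $n\to\infty$, $$2n\,\hat I_n^{(k)}(\boldsymbol X\to\boldsymbol Y)\ \xrightarrow{\ \mathcal D\ }\ \chi^2\big(\ell^k(m^{k+1}-1)(\ell-1)\big).$$
   Context: Notation: $\log$ is the natural logarithm; $x_i^j=(x_i,\dots,x_j)$; $I(\cdot;\cdot|\cdot)$ is the conditional (Shannon) mutual information of finite-valued random variables; $P_{U|V}$ denotes the conditional probability mass function of $U$ given $V$. $\xrightarrow{\mathcal D}$ denotes convergence in distribution, $N(0,\sigma^2)$ the centered normal law with variance $\sigma^2$ (point mass at $0$ if $\sigma^2=0$), and $\chi^2(s)$ the chi-squared law with $s$ degrees of freedom (point mass at $0$ if $s=0$). Markov chain of memory length $k$: the conditional distribution of the next pair given the whole past depends only on the last $k$ pairs (so the true order may be smaller than $k$), with $Q(a_k,b_k\mid a_0^{k-1},b_0^{k-1})=\Pr\{X_n=a_k,Y_n=b_k\mid X_{n-k}^{n-1}=a_0^{k-1},Y_{n-k}^{n-1}=b_0^{k-1}\}$. Stationary version: $\{(\bar X_n,\bar Y_n)\}$ is the stationary process (extended to all $n\in\mathbb Z$) with the same transition matrix, where $(\bar X_{-k+1}^0,\bar Y_{-k+1}^0)$ has the unique invariant distribution. Plug-in estimator: from the sample $(X_{-k+1}^n,Y_{-k+1}^n)$ form the empirical distribution on $A^{k+1}\times B^{k+1}$, $$\hat P_{X_{-k}^0Y_{-k}^0,n}(a_0^k,b_0^k)=\frac1n\sum_{i=1}^n\mathbb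 I_{\{X_{i-k}^i=a_0^k,\;Y_{i-k}^i=b_0^k\}},$$ and set $\hat I_n^{(k)}(\boldsymbol X\to\boldsymbol Y)=I(\hat Y_0;\hat X_{-k}^0\mid\hat Y_{-k}^{-1})$ where $(\hat X_{-k}^0,\hat Y_{-k}^0)\sim\hat P_{X_{-k}^0Y_{-k}^0,n}$. *)

(* Defs.v *)
From HB Require Import structures.
From mathcomp Require Import all_boot all_order all_algebra.
From mathcomp Require Import all_classical all_reals all_analysis.
From mathcomp Require Import measurable_realfun.
Set Implicit Arguments.
Unset Strict Implicit.
Unset Printing Implicit Defensive.
Import Order.TTheory GRing.Theory Num.Theory.
Import numFieldNormedType.Exports.
Local Open Scope classical_set_scope.
Local Open Scope ring_scope.

(* Time conventions.  A one-sided process (X_t, Y_t), t >= -k+1, is encoded by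
   functions on nat: [X j] stands for X_{j-k+1}.  Hence the window X_{i-k}^i,
   for i = 1, ..., n, is [block X (i-1) (k+1)], and the sample X_{-k+1}^n is
   [X 0], ..., [X (n+k-1)].  A two-sided process is indexed by [int], with the
   true time. *)

Definition block (T : Type) (x : nat -> T) (t r : nat) : r.-tuple T :=
  [tuple x (t + i)%N | i < r].

Definition shifted (T : Type) (X : int -> T) (s : int) (j : nat) : T :=
  X (s + j%:Z).

Section finite_valued_processes.
Context (R : realType) (d : measure_display) (Omega : measurableType d)
  (P : probability Omega R) (A B : finType).

(* A finite alphabet carries the discrete sigma-algebra. *)
Definition finite_rv (T : finType) (X : Omega -> T) : Prop :=
  forall a : T, measurable (X @^-1` [set a]).

Definition cond_prob (E F : set Omega) : R :=
  fine (P (E `&` F)) / fine (P F).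

Definition block_event (X : nat -> Omega -> A) (Y : nat -> Omega -> B)
    (t r : nat) (a : r.-tuple A) (b : r.-tuple B) : set Omega :=
  [set w | block (X ^~ w) t r = a /\ block (Y ^~ w) t r = b].

Definition block_law (X : nat -> Omega -> A) (Y : nat -> Omega -> B)
    (t r : nat) (a : r.-tuple A) (b : r.-tuple B) : R :=
  fine (P (block_event X Y t a b)).

(* [Q a b a' b'] is Q(a', b' | a, b): the pasts a, b of length k come first. *)
Definition transition_matrix (k : nat)
    (Q : k.-tuple A -> k.-tuple B -> A -> B -> R) : Prop :=
  (forall a b a' b', 0 <= Q a b a' b') /\
  (forall a b, \sum_(a' : A) \sum_(b' : B) Q a b a' b' = 1).

(* The values x_0, ..., x_{t+k} and y_0, ..., y_{t+k} of a trajectory are read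
   off functions [x] and [y] on nat; the whole past is the block of length
   t + k starting at the initial time. *)
Definition markov_chain (k : nat)
    (Q : k.-tuple A -> k.-tuple B -> A -> B -> R)
    (X : nat -> Omega -> A) (Y : nat -> Omega -> B) : Prop :=
  [/\ forall j, finite_rv (X j),
      forall j, finite_rv (Y j) &
      forall (t : nat) (x : nat -> A) (y : nat -> B),
        let past := block_event X Y 0 (block x 0 (t + k)) (block y 0 (t + k)) in
        P past != 0%E ->
        cond_prob [set w | X (t + k)%N w = x (t + k)%N /\
                           Y (t + k)%N w = y (t + k)%N] past =
        Q (block x t k) (block y t k) (x (t + k)%N) (y (t + k)%N)].

Definition stationary (X : int -> Omega -> A) (Y : int -> Omega -> B) : Prop :=
  forall (s : int) (r : nat) (a : r.-tuple A) (b : r.-tuple B),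
    block_law (shifted X s) (shifted Y s) 0 a b =
    block_law (shifted X 0) (shifted Y 0) 0 a b.

(* In the sum, [belast_tuple a0 a] is (a0, a_1, ..., a_{k-1}) when a is
   (a_1, ..., a_k), and [last a0 a] is a_k since k >= 1. *)
Definition invariant_law (k : nat)
    (Q : k.-tuple A -> k.-tuple B -> A -> B -> R)
    (pi : k.-tuple A -> k.-tuple B -> R) : Prop :=
  forall (a : k.-tuple A) (b : k.-tuple B),
    pi a b =
    \sum_(a0 : A) \sum_(b0 : B)
      pi (belast_tuple a0 a) (belast_tuple b0 b) *
      Q (belast_tuple a0 a) (belast_tuple b0 b) (last a0 a) (last b0 b).

Definition stationary_version (k : nat)
    (Q : k.-tuple A -> k.-tuple B -> A -> B -> R)
    (X : int -> Omega -> A) (Y : int -> Omega -> B) : Prop :=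
  [/\ forall s : int, markov_chain Q (shifted X s) (shifted Y s),
      stationary X Y &
      invariant_law Q (@block_law (shifted X (1 - k%:Z)) (shifted Y (1 - k%:Z))
                                  0 k)].

End finite_valued_processes.

Arguments block_law {R d Omega} P {A B} X Y t r.
Arguments cond_prob {R d Omega} P E F.
Arguments markov_chain {R d Omega} P {A B k} Q X Y.
Arguments stationary {R d Omega} P {A B} X Y.
Arguments stationary_version {R d Omega} P {A B k} Q X Y.

Section conditional_mutual_information.
Context (R : realType).

(* [p u v w] is the joint probability mass function of a triple (U, V, W). *)
Section triple.
Context (U V W : finType) (p : U -> V -> W -> R).

Definition pmf_W (w : W) : R := \sum_(u : U) \sum_(v : V) p u v w.
Definition cond_pmf_UV (u : U) (v : V) (w : W) : R := p u v w / pmf_W w.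
Definition cond_pmf_U (u : U) (w : W) : R := (\sum_(v : V) p u v w) / pmf_W w.
Definition cond_pmf_V (v : V) (w : W) : R := (\sum_(u : U) p u v w) / pmf_W w.

Definition likelihood_ratio (u : U) (v : V) (w : W) : R :=
  cond_pmf_UV u v w / (cond_pmf_U u w * cond_pmf_V v w).

(* I(U; V | W); the terms with p u v w = 0 vanish. *)
Definition cond_mutual_info : R :=
  \sum_(u : U) \sum_(v : V) \sum_(w : W)
    p u v w * ln (likelihood_ratio u v w).

End triple.

(* From the law q of (X_{-k}^0, Y_{-k}^0) to that of
   (Y_0, X_{-k}^0, Y_{-k}^{-1}). *)
Definition directed_triple (A B : finType) (k : nat)
    (q : k.+1.-tuple A -> k.+1.-tuple B -> R) :
    B -> k.+1.-tuple A -> k.-tuple B -> R :=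
  fun y0 x yp => q x (rcons_tuple yp y0).

Definition directed_info (A B : finType) (k : nat)
    (q : k.+1.-tuple A -> k.+1.-tuple B -> R) : R :=
  cond_mutual_info (directed_triple q).

End conditional_mutual_information.

Section estimation.
Context (R : realType) (d : measure_display) (Omega : measurableType d)
  (A B : finType) (k : nat) (X : nat -> Omega -> A) (Y : nat -> Omega -> B).

Definition empirical_law (n : nat) (w : Omega)
    (a : k.+1.-tuple A) (b : k.+1.-tuple B) : R :=
  n%:R^-1 * \sum_(i < n) ((block (X ^~ w) i k.+1 == a) &&
                          (block (Y ^~ w) i k.+1 == b))%:R.

Definition plugin_estimator (n : nat) (w : Omega) : R :=
  directed_info (empirical_law n w).

(* Here q is the law of (X_{-k}^0, Y_{-k}^0) for the stationary version; the
   ratio is evaluated along the chain (X, Y) itself. *)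
Definition log_likelihood_ratio
    (q : k.+1.-tuple A -> k.+1.-tuple B -> R) (n : nat) (w : Omega) : R :=
  ln (\prod_(i < n)
        likelihood_ratio (directed_triple q)
          (Y (i + k)%N w) (block (X ^~ w) i k.+1) (block (Y ^~ w) i k)).

End estimation.

Arguments plugin_estimator R {d Omega A B} k X Y n w.
Arguments log_likelihood_ratio {R d Omega A B k} X Y q n w.

Section limit_laws.
Context (R : realType).

(* [normal_prob 0 0] is not a point mass in the library. *)
Definition normal_law (v : R) : probability (measurableTypeR R) R :=
  if v == 0 then (dirac (0 : measurableTypeR R) : probability _ R)
  else (normal_prob 0 (Num.sqrt v) : probability _ R).

Definition add_sqr (z : measurableTypeR R * measurableTypeR R) :
    measurableTypeR R := (z.1 : R) + (z.2 : R) ^+ 2.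

Lemma measurable_add_sqr : measurable_fun setT add_sqr.
Proof.
apply: measurable_funD; first exact: measurable_fst.
by apply: measurable_funX; exact: measurable_snd.
Qed.

HB.instance Definition _ := isMeasurableFun.Build _ _ _ _ add_sqr
  measurable_add_sqr.

(* The law of a sum of s squares of independent standard normal variables. *)
Fixpoint chi_squared (s : nat) : probability (measurableTypeR R) R :=
  if s is s'.+1 then
    distribution (chi_squared s' \x normal_prob (0 : R) 1)%E add_sqr
  else dirac (0 : measurableTypeR R).

Definition cvg_in_distribution (d : measure_display) (Omega : measurableType d)
    (P : probability Omega R) (T : nat -> Omega -> R)
    (mu : probability (measurableTypeR R) R) : Prop :=
  (forall n, measurable_fun [set: Omega] (T n)) /\
  (forall x : R, {for x, continuous (fun y : R => mu `]-oo, y]%classic)} ->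
     P [set w | T n w <= x] @[n --> \oo] --> mu `]-oo, x]%classic).

End limit_laws.

(* Main.v *)
(* The blocks of k consecutive pairs form a finite Markov chain which, all
   letters having positive probability, mixes uniformly.  Solving the Poisson
   equation turns every additive functional of the chain into a martingale up to
   a bounded error.  Lindeberg's replacement argument compares such a martingale
   first with independent Rademacher steps of the same covariance, then with
   Gaussian steps; only logistic test functions are needed, since they already
   determine convergence of distribution functions, and they are smooth also when
   composed with c + |x|^2, which gives chi-squared limits.

   Let p be the stationary law of the triple (Y_0, X_{-k}^0, Y_{-k}^{-1}) and p_n
   its empirical version, at mean square distance O(1/n) from p.  The
   information of p_n differs from the p_n-mean of the log-likelihood ratio of p
   by a signed sum of relative entropies of the marginals of p_n and p, of order
   |p_n - p|^2: this gives (i).  When the information vanishes, that log-ratio is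
   identically 0 and the relative entropies are, to second order, the chi-square
   statistic of conditional independence.  Householder reflections write it as a
   sum of l^k (m^(k+1) - 1) (l - 1) squares of orthonormal scores, which are
   martingales along the chain: this gives (ii). *)

From HB Require Import structures.
Require Import Defs.
From mathcomp Require Import all_boot all_order all_algebra.
From mathcomp Require Import all_classical all_reals all_analysis.
From mathcomp Require Import measurable_realfun.
From mathcomp Require Import ring lra.
Set Implicit Arguments.
Unset Strict Implicit.
Unset Printing Implicit Defensive.
Import Order.TTheory GRing.Theory Num.Theory.
Import numFieldNormedType.Exports.
Local Open Scope classical_set_scope.
Local Open Scope ring_scope.

(** * Finite Markov chains: mixing and the Poisson equation *)

(** Along the chain everything is finite algebra: [expect] averages over words of letters by
    recursion, and the probability space enters only when the law of an observed path is computed. A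
    step is a state together with the emitted letter, because the triple entering the information
    depends on both. Rademacher steps stand between the martingale and the Gaussian because averages
    of coordinatewise shifts preserve a class of smooth functions with the same constant and commute
    across coordinates, so that Gaussian integrals are only taken on the line. The obstacle in the
    comparison is that the conditional covariance of a step depends on the current state; only its
    stationary mean is prescribed, and mixing over finitely many steps replaces the one by the
    other. In the degenerate case the scores have mean 0 already given X_{-k}^0 and Y_{-k}^{-1},
    hence given the state: they are martingale increments without any Poisson correction, and their
    covariance is computed under the one-step stationary law. This is why dependence along the chain
    leaves the chi-squared limit of independent samples unchanged. *)

Section markov_operator.
Context (R : realType) (S C : finType) (Q : S -> C -> R) (nxt : S -> C -> S).

(** A transition is driven by a letter c, drawn from [Q s], which moves the state deterministically
    by [nxt]. Keeping the letter lets increments depend on the pair (s, c), and paths become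
    words. *)
Definition markov_op (g : S -> R) : S -> R := fun s => \sum_c Q s c * g (nxt s c).

Hypothesis Q_ge0 : forall s c, 0 <= Q s c.
Hypothesis Q_sum1 : forall s, \sum_c Q s c = 1.

Lemma markov_opD g g' : markov_op (fun s => g s + g' s) =
  fun s => markov_op g s + markov_op g' s.
Proof.
apply/funext => s; rewrite /markov_op -big_split /=.
by apply: eq_bigr => c _; rewrite mulrDr.
Qed.

Lemma markov_opZ a g : markov_op (fun s => a * g s) = fun s => a * markov_op g s.
Proof.
apply/funext => s; rewrite /markov_op mulr_sumr.
by apply: eq_bigr => c _; rewrite mulrCA.
Qed.

Lemma markov_op_cst a : markov_op (fun=> a) = fun=> a.
Proof. by apply/funext => s; rewrite /markov_op -mulr_suml Q_sum1 mul1r. Qed.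

Lemma markov_op_le g g' : (forall s, g s <= g' s) ->
  forall s, markov_op g s <= markov_op g' s.
Proof. by move=> gg' s; apply: ler_sum => c _; exact: ler_wpM2l. Qed.

Lemma iter_markov_op_le n g g' : (forall s, g s <= g' s) ->
  forall s, iter n markov_op g s <= iter n markov_op g' s.
Proof. by move=> gg'; elim: n => //= n IH; exact: markov_op_le. Qed.

Lemma iter_markov_op_affine n a b g :
  iter n markov_op (fun s => a + b * g s) = fun s => a + b * iter n markov_op g s.
Proof.
elim: n => //= n ->.
by rewrite (markov_opD (fun=> a)) markov_op_cst markov_opZ.
Qed.

Lemma iter_markov_op_cst n a : iter n markov_op (fun=> a) = fun=> a.
Proof. by elim: n => //= n ->; rewrite markov_op_cst. Qed.

Section mixing.
Context (pi : S -> R) (k : nat) (q0 : R).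
Hypothesis pi_ge0 : forall s, 0 <= pi s.
Hypothesis pi_sum1 : \sum_s pi s = 1.
Hypothesis pi_inv : forall g, \sum_s pi s * markov_op g s = \sum_s pi s * g s.
Hypothesis q0_gt0 : 0 < q0.
Hypothesis Q_ge : forall s c, q0 <= Q s c.
Hypothesis reach : forall s t, exists2 cs, size cs = k & foldl nxt s cs = t.

(** Among all words of this length a single one is kept; each of its letters has probability at
    least [q0], and the other terms are nonnegative. *)
Lemma iter_markov_op_ge_path g s cs : (forall t, 0 <= g t) ->
  q0 ^+ size cs * g (foldl nxt s cs) <= iter (size cs) markov_op g s.
Proof.
move=> g0; elim: cs s => [s|c cs IH s] /=; first by rewrite expr0 mul1r.
rewrite /markov_op (bigD1 c)//= -[leLHS]addr0 lerD//.
  rewrite exprS -mulrA ler_pM//; first exact: ltW.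
  by rewrite mulr_ge0// exprn_ge0// ltW.
apply: sumr_ge0 => c' _; apply: mulr_ge0 => //.
have := @iter_markov_op_le (size cs) (fun=> 0) g g0 (nxt s c').
by rewrite iter_markov_op_cst.
Qed.

(** Doeblin's argument: in [k] steps the chain sits at a minimiser of [g] with probability at least
    [q0 ^+ k], wherever it starts, and that mass lowers the upper end of the range of the k-step
    mean. *)
Lemma markov_op_contraction g a : (forall s t, g s - g t <= a) ->
  forall s t, iter k markov_op g s - iter k markov_op g t <= (1 - q0 ^+ k) * a.
Proof.
move=> ga s t.
pose M := [arg max_(i > s) g i]%O; pose m := [arg min_(i < s) g i]%O.
have gM u : g u <= g M by rewrite /M; case: arg_maxP => // i _; exact.
have gm u : g m <= g u by rewrite /m; case: arg_minP => // i _; exact.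
have q0k : 0 <= q0 ^+ k by rewrite exprn_ge0// ltW.
have q1 : q0 ^+ k <= 1.
  have [cs <- _] := reach s s.
  have := @iter_markov_op_ge_path (fun=> 1) s cs (fun=> ler01).
  by rewrite iter_markov_op_cst mulr1.
have [cs szcs cm] := reach s m.
have h1 : q0 ^+ k * (g M - g m) <= g M - iter k markov_op g s.
  have := @iter_markov_op_ge_path (fun u => g M + -1 * g u) s cs.
  rewrite szcs cm iter_markov_op_affine !mulN1r; apply => u.
  by rewrite ?mulN1r subr_ge0.
have h2 : g m <= iter k markov_op g t.
  have := @iter_markov_op_le k (fun=> g m) g gm t.
  by rewrite iter_markov_op_cst.
have := ga M m; nra.
Qed.

Lemma pi_iter_markov_op n g :
  \sum_s pi s * iter n markov_op g s = \sum_s pi s * g s.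
Proof. by elim: n => //= n IH; rewrite pi_inv. Qed.

(** The oscillation shrinks geometrically along multiples of [k], and the [pi]-mean is preserved, so
    the distance to that mean is at most the oscillation. *)
Lemma markov_op_mixing g e : 0 < e ->
  exists n, forall s, `|iter n markov_op g s - \sum_t pi t * g t| <= e.
Proof.
move=> e0.
pose a := \sum_s \sum_t `|g s - g t|.
have ga s t : g s - g t <= a.
  apply: le_trans (ler_norm _) _; rewrite /a (bigD1 s)//= (bigD1 t)//=.
  by rewrite -addrA lerDl addr_ge0// sumr_ge0// => i _; rewrite sumr_ge0.
have osc j s t : iter (j * k) markov_op g s - iter (j * k) markov_op g t <=
    (1 - q0 ^+ k) ^+ j * a.
  elim: j s t => [|j IH] s t; first by rewrite mul0n /= expr0 mul1r.
  by rewrite mulSn iterD exprS -mulrA; exact: markov_op_contraction.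
have [j hj] : exists j, (1 - q0 ^+ k) ^+ j * a <= e.
  have a0 : 0 <= a by apply: sumr_ge0 => s _; exact: sumr_ge0.
  (* The rate may be 0, for instance with a single letter and [q0] equal to 1; one block of [k]
     steps then suffices. *)
  have [] := leP (1 - q0 ^+ k) 0 => h.
    exists 1%N; rewrite expr1; apply: le_trans (ltW e0).
    by rewrite mulr_le0_ge0.
  have /cvgrPdist_le/(_ (e / (a + 1)))[] : (1 - q0 ^+ k) ^+ n @[n --> \oo] --> (0 : R).
    by apply: cvg_expr; rewrite gtr0_norm// gtrBl exprn_gt0.
    by rewrite divr_gt0// ltr_wpDl.
  move=> n _ /(_ n (leqnn n)); rewrite sub0r normrN => /(le_trans (ler_norm _)) hn.
  exists n; apply: le_trans (ler_wpM2r a0 hn) _.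
  by rewrite -mulrA ler_piMr ?(ltW e0)// mulrC ler_pdivrMr ?ltr_wpDl// mul1r lerDl.
exists (j * k)%N => s; rewrite -(pi_iter_markov_op (j * k)).
set G := iter _ _ _.
rewrite (_ : G s = \sum_t pi t * G s); last by rewrite -mulr_suml pi_sum1 mul1r.
rewrite -sumrB; apply: le_trans (ler_norm_sum _ _ _) _.
rewrite -[leRHS]mul1r -pi_sum1 mulr_suml; apply: ler_sum => t _.
rewrite -mulrBr normrM ger0_norm//; apply: ler_wpM2l => //.
by rewrite ler_norml lerNl opprB !(le_trans (osc j _ _) hj).
Qed.

(* By mixing, a fixed point of [markov_op] of mean 0 vanishes; hence
   phi - markov_op phi + pi(phi) is injective in phi, thus onto. *)
Lemma poisson_equation g : exists phi : S -> R,
  forall s, phi s - markov_op phi s = g s - \sum_t pi t * g t.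
Proof.
(* Seen as a module over itself, [R^o] makes the functions on S a finite-dimensional space, where an
   endomorphism with trivial kernel is invertible. *)
pose V := {ffun S -> R^o}.
pose L (f : V) : V := [ffun s => f s - markov_op f s + \sum_t pi t * f t].
have Llin : linear L.
  move=> a f f'; apply/ffunP => s; rewrite !ffunE.
  have -> : \sum_t pi t * (a *: f + f') t =
      a * (\sum_t pi t * f t) + \sum_t pi t * f' t.
    rewrite mulr_sumr -big_split /=; apply: eq_bigr => t _.
    by rewrite !ffunE -[a *: _]/(a * _) mulrDr mulrCA.
  have -> : markov_op (a *: f + f') s = a * markov_op f s + markov_op f' s.
    rewrite /markov_op mulr_sumr -big_split /=; apply: eq_bigr => c _.
    by rewrite !ffunE -[a *: _]/(a * _) mulrDr mulrCA.
  by rewrite -![a *: _]/(a * _); ring.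
pose Lm := GRing.isLinear.Build _ _ _ _ L Llin.
pose LL : {linear V -> V} := HB.pack L Lm.
have kerL f : L f = 0 -> f = 0.
  move=> /ffunP Lf0.
  have E s : f s - markov_op f s + \sum_t pi t * f t = 0.
    by have := Lf0 s; rewrite !ffunE.
  have pf0 : \sum_t pi t * f t = 0.
    have : \sum_s pi s * (f s - markov_op f s + \sum_t pi t * f t) = 0.
      by apply: big1 => s _; rewrite E mulr0.
    under eq_bigr do rewrite mulrDr mulrBr.
    by rewrite big_split /= sumrB pi_inv subrr add0r -mulr_suml pi_sum1 mul1r.
  have fix1 : markov_op f = f.
    by apply/funext => s; have := E s; rewrite pf0 addr0 => /eqP; rewrite subr_eq0 => /eqP.
  have fixn n : iter n markov_op f = f by elim: n => //= n ->.
  apply/ffunP => s; rewrite !ffunE; apply/eqP; rewrite -normr_eq0 eq_le normr_ge0 andbT.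
  apply/ler_addgt0Pl => e e0; rewrite addr0.
  by have [n /(_ s)] := markov_op_mixing f e0; rewrite fixn pf0 subr0.
have ker0 : lker (linfun LL) == 0%VS.
  rewrite -subv0; apply/subvP => f; rewrite memv_ker lfunE /= => /eqP /kerL ->.
  exact: mem0v.
pose G : V := [ffun s => g s - \sum_t pi t * g t].
pose phi := (linfun LL)^-1%VF G.
have Lphi : L phi = G.
  by have := lker0_lfunVK ker0 G; rewrite lfunE.
have E s : phi s - markov_op phi s + \sum_t pi t * phi t = g s - \sum_t pi t * g t.
  by have /ffunP/(_ s) := Lphi; rewrite !ffunE.
(* Integrating the equation against [pi] shows that the added mean is itself 0. *)
have pf0 : \sum_t pi t * phi t = 0.
  have : \sum_s pi s * (phi s - markov_op phi s + \sum_t pi t * phi t) =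
         \sum_s pi s * (g s - \sum_t pi t * g t).
    by apply: eq_bigr => s _; rewrite E.
  under eq_bigr do rewrite mulrDr mulrBr.
  rewrite big_split /= sumrB pi_inv subrr add0r -mulr_suml pi_sum1 mul1r => ->.
  under eq_bigr do rewrite mulrBr.
  by rewrite sumrB -mulr_suml pi_sum1 mul1r subrr.
by exists phi => s; rewrite -E pf0 addr0.
Qed.

End mixing.
End markov_operator.

(** * Lindeberg comparison of a chain martingale with Rademacher steps *)

Section second_order_class.
Context (R : realType) (J : finType).
Local Notation V := {ffun J -> R}.

Definition norm1 (v : V) : R := \sum_j `|v j|.

(* [F1] and [F2] stand for the first and second derivatives of [F]; nothing but
   this quantitative Taylor formula is ever asked of them. *)
Definition taylor2 (K : R) (F : V -> R) (F1 : J -> V -> R) (F2 : J -> J -> V -> R) :=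
  [/\ forall x v, `|F (x + v) - F x - \sum_j F1 j x * v j
                    - 2^-1 * \sum_j \sum_l F2 j l x * (v j * v l)| <= K * norm1 v ^+ 3,
      forall j l x, `|F2 j l x| <= K &
      forall j l x v, `|F2 j l (x + v) - F2 j l x| <= K * norm1 v].

Definition coord (j : J) (a : R) : V := [ffun i => if i == j then a else 0].

Lemma coordE j a : coord j a j = a. Proof. by rewrite ffunE eqxx. Qed.

Definition rademacher (a : R) (j : J) (F : V -> R) : V -> R :=
  fun x => (F (x + coord j a) + F (x - coord j a)) / 2.

Definition rademachers (a : R) (l : seq J) (F : V -> R) : V -> R :=
  foldr (rademacher a) F l.

Lemma norm1_ge0 v : 0 <= norm1 v. Proof. exact: sumr_ge0. Qed.

Lemma norm1N v : norm1 (- v) = norm1 v.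
Proof. by apply: eq_bigr => j _; rewrite ffunE normrN. Qed.

Lemma norm1_coord j a : norm1 (coord j a) = `|a|.
Proof.
rewrite /norm1 (bigD1 j)//= ffunE eqxx big1 ?addr0// => i ij.
by rewrite ffunE (negbTE ij) normr0.
Qed.

(** Averages of shifts keep the constant [K]: this is what allows n successive replacements without
    growth of the error. *)
Lemma taylor2_rademacher (K : R) F F1 F2 (a : R) j : taylor2 K F F1 F2 ->
  taylor2 K (rademacher a j F) (fun i => rademacher a j (F1 i))
    (fun i l => rademacher a j (F2 i l)).
Proof.
case=> t b lip; split=> [x v|i l x|i l x v]; rewrite /rademacher.
- pose c := coord j a; have := t (x + c) v; have := t (x - c) v.
  rewrite -/c ![_ + _ + v]addrAC => h1 h2.
  rewrite (_ : \sum_i (F1 i (x + c) + F1 i (x - c)) / 2 * v i =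
      (\sum_i F1 i (x + c) * v i + \sum_i F1 i (x - c) * v i) / 2); last first.
    by rewrite -big_split /= mulr_suml; apply: eq_bigr => i _; ring.
  rewrite (_ : \sum_i \sum_l (F2 i l (x + c) + F2 i l (x - c)) / 2 * (v i * v l) =
      (\sum_i \sum_l F2 i l (x + c) * (v i * v l) +
       \sum_i \sum_l F2 i l (x - c) * (v i * v l)) / 2); last first.
    rewrite -big_split /= mulr_suml; apply: eq_bigr => i _.
    by rewrite -big_split /= mulr_suml; apply: eq_bigr => l _; ring.
  move: h1 h2; rewrite !ler_norml => /andP[? ?] /andP[? ?].
  by apply/andP; split; lra.
- have := b i l (x + coord j a); have := b i l (x - coord j a).
  rewrite !ler_norml => /andP[? ?] /andP[? ?].
  by apply/andP; split; lra.
- have := lip i l (x + coord j a) v; have := lip i l (x - coord j a) v.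
  rewrite ![_ + _ + v]addrAC !ler_norml => /andP[? ?] /andP[? ?].
  by apply/andP; split; lra.
Qed.

Lemma taylor2_rademachers (K : R) F F1 F2 (a : R) l : taylor2 K F F1 F2 ->
  taylor2 K (rademachers a l F) (fun i => rademachers a l (F1 i))
    (fun i m => rademachers a l (F2 i m)).
Proof. by move=> t; elim: l => //= j l; exact: taylor2_rademacher. Qed.

(** Opposite steps cancel the first-order term, and off-diagonal second derivatives do not appear
    because a step moves one coordinate. *)
Lemma rademacher_expansion (K : R) F F1 F2 (a : R) j x : 0 <= a -> taylor2 K F F1 F2 ->
  `|rademacher a j F x - F x - a ^+ 2 / 2 * F2 j j x| <= K * a ^+ 3.
Proof.
move=> a0 [t _ _].
have s1 (b : R) : \sum_i F1 i x * coord j b i = F1 j x * b.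
  rewrite (bigD1 j)//= big1 ?addr0 ?coordE?expr2// => i /negbTE ij.
  by rewrite ffunE ij mulr0.
have s2 (b : R) : \sum_i \sum_l F2 i l x * (coord j b i * coord j b l) = F2 j j x * b ^+ 2.
  rewrite (bigD1 j)//= [X in _ + X]big1 ?addr0; last first.
    by move=> i /negbTE ij; apply: big1 => l _; rewrite ffunE ij mul0r mulr0.
  rewrite (bigD1 j)//= big1 ?addr0 ?coordE?expr2// => i /negbTE ij.
  by rewrite [coord j b i]ffunE ij !mulr0.
have cN : - coord j a = coord j (- a).
  by apply/ffunP => i; rewrite !ffunE; case: eqP => // _; rewrite oppr0.
have := t x (coord j a); have := t x (coord j (- a)).
rewrite !s1 !s2 !norm1_coord normrN (ger0_norm a0) /rademacher cN sqrrN.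
rewrite !ler_norml => /andP[? ?] /andP[? ?].
by apply/andP; split; lra.
Qed.

Lemma rademachers_lip (K : R) (G : V -> R) (a : R) l x : 0 <= a ->
  (forall x v : V, `|G (x + v) - G x| <= K * norm1 v) ->
  `|rademachers a l G x - G x| <= K * (size l)%:R * a.
Proof.
move=> a0 lip; elim: l x => [|j l IH] x /=; first by rewrite subrr normr0 mulr0 mul0r.
have := IH (x + coord j a); have := IH (x - coord j a).
have := lip x (coord j a); have := lip x (- coord j a).
rewrite norm1N norm1_coord (ger0_norm a0) /rademacher.
have -> : K * (size l).+1%:R * a = K * (size l)%:R * a + K * a by rewrite -natr1; ring.
rewrite !ler_norml; move: ((size l)%:R : R) => m.
move=> /andP[h1 h2] /andP[h3 h4] /andP[h5 h6] /andP[h7 h8].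
by apply/andP; split; lra.
Qed.

(** The second derivative along the coordinate j is seen through the averages over the other
    coordinates of the list; undoing them costs one Lipschitz bound, hence the quadratic dependence
    on the number of coordinates. *)
Lemma rademachers_expansion (K : R) F F1 F2 (a : R) l x : 0 <= a -> 0 <= K -> taylor2 K F F1 F2 ->
  `|rademachers a l F x - F x - a ^+ 2 / 2 * \sum_(j <- l) F2 j j x|
    <= K * (size l)%:R * (size l).+1%:R * a ^+ 3.
Proof.
move=> a0 K0 t; elim: l x => [|j l IH] x /=.
  by rewrite big_nil !mulr0 subr0 subrr normr0 !mul0r.
rewrite big_cons.
have /= := rademacher_expansion j x a0 (taylor2_rademachers a l t).
have [_ _ lip] := t.
have := rademachers_lip l x a0 (lip j j).
have := IH x.
move: (rademacher a j (rademachers a l F) x) (rademachers a l F x).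
move: (rademachers a l (F2 j j) x) => D A B; rewrite -(natr1 (size l).+1) -(natr1 (size l)).
set m := (size l)%:R : R.
have m0 : 0 <= m by exact: ler0n.
have K1 : 0 <= K * a ^+ 3 by rewrite mulr_ge0// exprn_ge0.
have K2 : 0 <= K * a ^+ 3 * m by rewrite mulr_ge0.
move=> h1 h2 h3.
have h2' : `|a ^+ 2 / 2 * (D - F2 j j x)| <= a ^+ 2 / 2 * (K * m * a).
  have a2 : 0 <= a ^+ 2 / 2 by rewrite divr_ge0// exprn_ge0.
  by rewrite normrM (ger0_norm a2) ler_wpM2l.
move: h1 h2' h3; rewrite !ler_norml => /andP[? ?] /andP[? ?] /andP[? ?].
by apply/andP; split; lra.
Qed.

End second_order_class.

Section lindeberg.
Context (R : realType) (J S C : finType) (Q : S -> C -> R) (nxt : S -> C -> S).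
Context (D : S -> C -> J -> R).
Local Notation V := {ffun J -> R}.
Local Notation q := (markov_op Q nxt).

(** The backward operator of the joint chain made of the state and of the walk with increments [D]
    scaled by [h]; later [h] is the inverse square root of n. *)
Definition walk_op (h : R) (G : S -> V -> R) : S -> V -> R := fun s x =>
  \sum_c Q s c * G (nxt s c) (x + [ffun j => h * D s c j]).

Hypothesis Q_ge0 : forall s c, 0 <= Q s c.
Hypothesis Q_sum1 : forall s, \sum_c Q s c = 1.

Lemma sumQ_mul s (b : R) : \sum_c Q s c * b = b.
Proof. by rewrite -mulr_suml Q_sum1 mul1r. Qed.

Lemma iter_walk_opD h n G G' : iter n (walk_op h) (fun s x => G s x + G' s x) =
  fun s x => iter n (walk_op h) G s x + iter n (walk_op h) G' s x.
Proof.
elim: n => //= n ->; apply/funext => s; apply/funext => x.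
by rewrite /walk_op -big_split /=; apply: eq_bigr => c _; rewrite mulrDr.
Qed.

Lemma iter_walk_opZ h n (a : R) G : iter n (walk_op h) (fun s x => a * G s x) =
  fun s x => a * iter n (walk_op h) G s x.
Proof.
elim: n => //= n ->; apply/funext => s; apply/funext => x.
by rewrite /walk_op mulr_sumr /=; apply: eq_bigr => c _; rewrite mulrCA.
Qed.

Lemma iter_walk_op_sum h n (I : Type) (r : seq I) (G : I -> S -> V -> R) :
  iter n (walk_op h) (fun s x => \sum_(i <- r) G i s x) =
  fun s x => \sum_(i <- r) iter n (walk_op h) (G i) s x.
Proof.
elim: n => //= n ->; apply/funext => s; apply/funext => x.
rewrite /walk_op exchange_big /=; apply: eq_bigr => c _.
by rewrite mulr_sumr.
Qed.

Lemma walk_op_bound h n G (b : R) : (forall s x, `|G s x| <= b) ->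
  forall s x, `|iter n (walk_op h) G s x| <= b.
Proof.
move=> Gb; elim: n => //= n IH s x; apply: le_trans (ler_norm_sum _ _ _) _.
rewrite -[leRHS](sumQ_mul s); apply: ler_sum => c _.
by rewrite normrM ger0_norm//; apply: ler_wpM2l.
Qed.

(** Within n steps the walk moves by at most n d h, so the factor [H] is nearly frozen while the
    chain averages [g]. One step costs at most [g0 * K * d * h], and walking does not amplify the
    errors already made. *)
Lemma iter_walk_op_slow (h : R) n (g : S -> R) (H : V -> R) (g0 K d : R) s x :
  (forall s, `|g s| <= g0) -> (forall x v, `|H (x + v) - H x| <= K * norm1 v) ->
  0 <= K -> 0 <= h -> (forall s c, \sum_j `|D s c j| <= d) ->
  `|iter n (walk_op h) (fun s x => g s * H x) s x - iter n q g s * H x|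
    <= n%:R * (g0 * K * d * h).
Proof.
move=> gb lip K0 h0 db; elim: n s x => [|n IH] s x /=.
  by rewrite subrr normr0 mul0r.
rewrite /walk_op {2}/markov_op mulr_suml -sumrB.
apply: le_trans (ler_norm_sum _ _ _) _.
rewrite -[leRHS](sumQ_mul s); apply: ler_sum => c _.
rewrite -mulrA -mulrBr normrM ger0_norm//; apply: ler_wpM2l => //.
set v := [ffun j => _].
have nv : norm1 v <= d * h.
  rewrite /norm1; under eq_bigr do rewrite ffunE normrM (ger0_norm h0).
  by rewrite -mulr_sumr mulrC ler_wpM2r.
have qg : `|iter n q g (nxt s c)| <= g0.
  rewrite ler_norml; apply/andP; split.
    have := @iter_markov_op_le _ _ _ _ nxt Q_ge0 n (fun=> - g0) g.
    rewrite iter_markov_op_cst//; apply => t.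
    by have := gb t; rewrite ler_norml => /andP[].
  have := @iter_markov_op_le _ _ _ _ nxt Q_ge0 n g (fun=> g0).
  rewrite iter_markov_op_cst//; apply => t.
  by have := gb t; rewrite ler_norml => /andP[].
rewrite -natr1 mulrDl mul1r.
apply: le_trans (lerD (IH (nxt s c) (x + v)) (_ : `|iter n q g (nxt s c) * (H (x + v) - H x)| <= _)).
  apply: le_trans (ler_normD _ _); rewrite le_eqVlt; apply/orP; left; apply/eqP.
  by congr (`|_|); ring.
rewrite normrM -mulrA -mulrA; apply: ler_pM => //.
by apply: le_trans (lip _ _) _; rewrite ler_wpM2l.
Qed.

End lindeberg.

Section lindeberg.
Context (R : realType) (J S C : finType) (Q : S -> C -> R) (nxt : S -> C -> S).
Context (D : S -> C -> J -> R) (pi : S -> R) (kap : R).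
Local Notation V := {ffun J -> R}.
Local Notation q := (markov_op Q nxt).
Local Notation walk := (walk_op Q nxt D).

Hypothesis Q_ge0 : forall s c, 0 <= Q s c.
Hypothesis Q_sum1 : forall s, \sum_c Q s c = 1.
Hypothesis pi_sum1 : \sum_s pi s = 1.
Hypothesis mixing : forall g e, 0 < e ->
  exists n, forall s, `|iter n q g s - \sum_t pi t * g t| <= e.
Hypothesis D_mart : forall s j, \sum_c Q s c * D s c j = 0.
Hypothesis kap_ge0 : 0 <= kap.
Hypothesis D_cov : forall j l,
  \sum_s pi s * (\sum_c Q s c * (D s c j * D s c l)) = kap ^+ 2 * (j == l)%:R.

(* [gam] is the defect of the conditional covariance of the increments from its
   stationary value; it has mean 0, so that [r] steps of the chain average it out
   up to [e], during which a walk of step [h] moves by O(h) only. *)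
Let gam j l s : R := \sum_c Q s c * (D s c j * D s c l) - kap ^+ 2 * (j == l)%:R.
Let d : R := \sum_s \sum_c \sum_j `|D s c j|.

Let D_le s c : \sum_j `|D s c j| <= d.
Proof.
rewrite /d (bigD1 s)//= (bigD1 c)//= -addrA lerDl addr_ge0//.
  by apply: sumr_ge0 => i _; exact: sumr_ge0.
by apply: sumr_ge0 => i _; apply: sumr_ge0 => l _; exact: sumr_ge0.
Qed.

Let d_ge0 : 0 <= d.
Proof. by apply: sumr_ge0 => s _; apply: sumr_ge0 => c _; exact: sumr_ge0. Qed.

Let g0 : R := \sum_j \sum_l \sum_s `|gam j l s|.

Let gam_le j l s : `|gam j l s| <= g0.
Proof.
rewrite /g0 (bigD1 j)//= (bigD1 l)//= (bigD1 s)//= -!addrA lerDl !addr_ge0//.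
- exact: sumr_ge0.
- by apply: sumr_ge0 => i _; exact: sumr_ge0.
- by apply: sumr_ge0 => i _; apply: sumr_ge0 => m _; exact: sumr_ge0.
Qed.

Let g0_ge0 : 0 <= g0.
Proof. by apply: sumr_ge0 => s _; apply: sumr_ge0 => c _; exact: sumr_ge0. Qed.

(** Third-order remainders of the two kinds of step: a step of the walk has [norm1] at most [d * h],
    a Rademacher step has size [kap * h] in each coordinate. *)
Let K1 : R := d ^+ 3 + (size (enum J))%:R * (size (enum J)).+1%:R * kap ^+ 3.

Let K1_ge0 : 0 <= K1.
Proof. by rewrite addr_ge0 ?exprn_ge0// !mulr_ge0// exprn_ge0. Qed.

(** Zeroth orders agree, the martingale property removes the first order, and the second orders
    differ by the covariance defect [gam]; the rest is of order [h ^+ 3]. *)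
Let walk_expansion (h K : R) F F1 F2 s x : 0 <= h -> 0 <= K -> taylor2 K F F1 F2 ->
  `|walk h (fun=> F) s x - rademachers (kap * h) (enum J) F x
    - \sum_j \sum_l h ^+ 2 / 2 * (gam j l s * F2 j l x)| <= K * K1 * h ^+ 3.
Proof.
move=> h0 K0 t; pose v c : V := [ffun j => h * D s c j].
have [tay _ _] := t.
have nv c : norm1 (v c) <= d * h.
  rewrite /norm1; under eq_bigr do rewrite ffunE normrM (ger0_norm h0).
  by rewrite -mulr_sumr mulrC ler_wpM2r.
have E1 : `|walk h (fun=> F) s x - F x
    - h ^+ 2 / 2 * \sum_j \sum_l F2 j l x * (\sum_c Q s c * (D s c j * D s c l))|
    <= K * d ^+ 3 * h ^+ 3.
  have -> : walk h (fun=> F) s x - F x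
    - h ^+ 2 / 2 * \sum_j \sum_l F2 j l x * (\sum_c Q s c * (D s c j * D s c l)) =
    \sum_c Q s c * (F (x + v c) - F x - \sum_j F1 j x * v c j
                    - 2^-1 * \sum_j \sum_l F2 j l x * (v c j * v c l)).
    under [RHS]eq_bigr do rewrite !mulrBr.
    rewrite !sumrB -mulr_suml Q_sum1 mul1r.
    congr (_ - _).
      rewrite -[LHS]subr0; congr (_ - _).
      under eq_bigr do rewrite mulr_sumr.
      rewrite exchange_big /= big1 // => j _.
      under eq_bigr do rewrite ffunE mulrCA [h * _]mulrC mulrA mulrCA mulrA.
      rewrite -mulr_suml -[X in X * _](_ : \sum_c F1 j x * (Q s c * D s c j) = _); last first.
        by apply: eq_bigr => c _; ring.
      by rewrite -mulr_sumr D_mart mulr0 mul0r.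
    rewrite mulr_sumr.
    under [RHS]eq_bigr => c _.
      rewrite 2!mulr_sumr; under eq_bigr do rewrite 2!mulr_sumr.
      over.
    rewrite [RHS]exchange_big /=; apply: eq_bigr => j _.
    rewrite mulr_sumr [RHS]exchange_big /=; apply: eq_bigr => l _.
    rewrite 2!mulr_sumr; apply: eq_bigr => c _.
    by rewrite !ffunE; field.
  apply: le_trans (ler_norm_sum _ _ _) _.
  rewrite -[leRHS](sumQ_mul Q_sum1 s); apply: ler_sum => c _.
  rewrite normrM ger0_norm//; apply: ler_wpM2l => //.
  apply: le_trans (tay x (v c)) _; rewrite -mulrA -exprMn; apply: ler_wpM2l => //.
  by apply: lerXn2r; rewrite ?nnegrE ?norm1_ge0 ?mulr_ge0.
have E2 := rademachers_expansion (enum J) x (mulr_ge0 kap_ge0 h0) K0 t.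
have E3 : \sum_j \sum_l h ^+ 2 / 2 * (gam j l s * F2 j l x) =
   h ^+ 2 / 2 * (\sum_j \sum_l F2 j l x * (\sum_c Q s c * (D s c j * D s c l)))
   - (kap * h) ^+ 2 / 2 * \sum_(j <- enum J) F2 j j x.
  rewrite big_enum /= !mulr_sumr -sumrB; apply: eq_bigr => j _.
  rewrite (_ : F2 j j x = \sum_l (j == l)%:R * F2 j l x); last first.
    rewrite (bigD1 j)//= eqxx mul1r big1 ?addr0// => l /negbTE.
    by rewrite eq_sym => ->; rewrite mul0r.
  rewrite !mulr_sumr -sumrB; apply: eq_bigr => l _.
  by rewrite /gam; ring.
rewrite E3; move: E1 E2; rewrite !ler_norml /K1.
move: ((size (enum J))%:R : R) ((size (enum J)).+1%:R : R) => n n'.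
move=> /andP[h1 h2] /andP[h3 h4].
by apply/andP; split; lra.
Qed.

(** Walking contracts the sup norm, so a remainder incurred after i steps is no larger when seen
    from the start. Only the covariance defect profits from the i steps, through the bound b. *)
Let iter_walk_error (i : nat) (h K b : R) F F1 F2 s x :
  0 <= h -> 0 <= K -> taylor2 K F F1 F2 ->
  (forall j l, `|iter i (walk h) (fun s x => gam j l s * F2 j l x) s x| <= b) ->
  `|iter i (walk h) (fun s x => walk h (fun=> F) s x
     - rademachers (kap * h) (enum J) F x) s x| <=
  h ^+ 2 * (#|J|%:R ^+ 2 * b) + K * K1 * h ^+ 3.
Proof.
move=> h0 K0 t bb.
pose E s x := walk h (fun=> F) s x - rademachers (kap * h) (enum J) F x
    - \sum_j \sum_l h ^+ 2 / 2 * (gam j l s * F2 j l x).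
rewrite (_ : (fun s x => _) = fun s x => E s x + \sum_j \sum_l h ^+ 2 / 2 * (gam j l s * F2 j l x)); last first.
  by apply/funext => s'; apply/funext => x'; rewrite /E subrK.
rewrite iter_walk_opD addrC; apply: le_trans (ler_normD _ _) _; apply: lerD.
  rewrite iter_walk_op_sum; apply: le_trans (ler_norm_sum _ _ _) _.
  apply: (@le_trans _ _ (\sum_(j : J) h ^+ 2 * (#|J|%:R * b))); last first.
    by rewrite sumr_const -mulr_natl le_eqVlt; apply/orP; left; apply/eqP; ring.
  apply: ler_sum => j _.
  rewrite iter_walk_op_sum; apply: le_trans (ler_norm_sum _ _ _) _.
  apply: (@le_trans _ _ (\sum_(l : J) h ^+ 2 * b)); last first.
    by rewrite sumr_const -mulr_natl le_eqVlt; apply/orP; left; apply/eqP; ring.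
  apply: ler_sum => l _; rewrite iter_walk_opZ normrM.
  have b0 : 0 <= b by apply: le_trans (bb j l).
  have h2 : 0 <= h ^+ 2 by rewrite exprn_ge0.
  apply: ler_pM => //.
  by rewrite ger0_norm ?divr_ge0// ler_pdivrMr// ler_peMr// (@ler_nat _ 1 2).
apply: walk_op_bound => // s' x'.
exact: (walk_expansion s' x' h0 K0 t).
Qed.

(** Steps are replaced one at a time, the last in time first, so that m steps of the walk precede
    the one replaced. If m is at least the averaging time r, they reduce the covariance defect to
    about e; the at most r other replacements get a crude bound, of total order [h ^+ 2]. *)
Lemma lindeberg_comparison (e : R) : 0 < e -> exists2 L : R, 0 <= L &
  forall (n : nat) (h K : R) F F1 F2 s x, 0 <= h -> 0 <= K -> taylor2 K F F1 F2 ->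
  `|iter n (walk h) (fun=> F) s x - iter n (rademachers (kap * h) (enum J)) F x|
    <= K * (n%:R * (h ^+ 2 * (e + L * h)) + L * h ^+ 2 * (1 + h)).
Proof.
move=> e0.
pose N2 : R := #|J|%:R ^+ 2.
have N2_ge0 : 0 <= N2 by rewrite exprn_ge0.
(* The matrix [gam] has N2 entries; averaging each one down to e' keeps their total below e. *)
pose e' := e / (N2 + 1).
have e'0 : 0 < e' by rewrite divr_gt0// ltr_wpDl.
have gam_mean j l : \sum_t pi t * gam j l t = 0.
  rewrite /gam; under eq_bigr do rewrite mulrBr.
  by rewrite sumrB D_cov -mulr_suml pi_sum1 mul1r subrr.
have [r hr] : exists r, forall j l s, `|iter r q (gam j l) s| <= e'.
  have /choice[f hf] : forall jl : J * J, exists n, forall s, `|iter n q (gam jl.1 jl.2) s| <= e'.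
    move=> [j l] /=; have [n hn] := mixing (gam j l) e'0.
    by exists n => s; have := hn s; rewrite gam_mean subr0.
  (* A common averaging time: steps beyond [f (j, l)] preserve a uniform bound, by monotonicity of
     the Markov operator. *)
  exists (\sum_jl f jl)%N => j l s.
  rewrite (bigD1 (j, l))//= addnC iterD.
  have := @iter_markov_op_le _ _ _ _ nxt Q_ge0.
  set m := (\sum_(i | _) _)%N => mon.
  have hf' t : - e' <= iter (f (j, l)) q (gam j l) t <= e' by rewrite -ler_norml; exact: hf (j, l) t.
  have := mon m (fun=> - e') _ (fun t => proj1 (andP (hf' t))) s.
  have := mon m _ (fun=> e') (fun t => proj2 (andP (hf' t))) s.
  by rewrite !iter_markov_op_cst// ler_norml => -> ->.
pose L := K1 + N2 * (r%:R * (g0 * d)) + r%:R * (N2 * g0 + K1).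
have r0 : 0 <= r%:R :> R by [].
have L_1 : 0 <= N2 * (r%:R * (g0 * d)) by rewrite !mulr_ge0.
have L_2 : 0 <= r%:R * (N2 * g0 + K1) by rewrite !mulr_ge0// addr_ge0// mulr_ge0.
have L0 : 0 <= L by apply: addr_ge0 => //; apply: addr_ge0.
exists L => // n h K F F1 F2 s x h0 K0 t.
have a1 i F' F1' F2' s' x' : taylor2 K F' F1' F2' ->
    `|iter i (walk h) (fun s x => walk h (fun=> F') s x
     - rademachers (kap * h) (enum J) F' x) s' x'| <=
    K * (h ^+ 2 * (N2 * g0) + K1 * h ^+ 3).
  move=> t'; apply: le_trans (@iter_walk_error i h K (K * g0) _ _ _ s' x' h0 K0 t' _) _.
    move=> j l; apply: walk_op_bound => // s'' x''.
    by have [_ b _] := t'; rewrite normrM mulrC ler_pM.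
  by rewrite le_eqVlt; apply/orP; left; apply/eqP; rewrite -/N2; ring.
have a2 i F' F1' F2' s' x' : (r <= i)%N -> taylor2 K F' F1' F2' ->
    `|iter i (walk h) (fun s x => walk h (fun=> F') s x
     - rademachers (kap * h) (enum J) F' x) s' x'| <=
    K * (h ^+ 2 * (e + L * h)).
  move=> ri t'.
  apply: le_trans (@iter_walk_error i h K (K * (e' + r%:R * (g0 * d * h))) _ _ _ s' x' h0 K0 t' _) _.
    move=> j l; rewrite -(subnK ri) iterD; apply: walk_op_bound => // s'' x''.
    have [_ b lip] := t'.
    have := @iter_walk_op_slow _ _ _ _ _ nxt _ Q_ge0 Q_sum1 h r _ _ _ _ _ s'' x''
      (gam_le j l) (lip j l) K0 h0 D_le.
    move: (iter r (walk h) _ _ _) => W.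
    have := ler_pM (normr_ge0 _) (normr_ge0 _) (hr j l s'') (b j l x'').
    rewrite -normrM; move: (_ * F2' j l x'') => Z; rewrite !ler_norml => /andP[h1 h2] /andP[h3 h4].
    by apply/andP; split; lra.
  have N2e : N2 * e' <= e.
    by rewrite /e' mulrCA ler_piMr ?(ltW e0)// ler_pdivrMr ?mul1r ?lerDl// ltr_wpDl.
  have h2 : 0 <= K * h ^+ 2 by rewrite mulr_ge0// exprn_ge0.
  have h3 : 0 <= K * h ^+ 2 * h by rewrite mulr_ge0.
  have := ler_wpM2l h2 N2e; have := mulr_ge0 h3 L_2.
  rewrite /L -/N2; lra.
have A0 : 0 <= K * (h ^+ 2 * (N2 * g0) + K1 * h ^+ 3).
  by rewrite mulr_ge0// addr_ge0// mulr_ge0 ?mulr_ge0// exprn_ge0.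
have B0 : 0 <= K * (h ^+ 2 * (e + L * h)).
  apply: mulr_ge0 => //; apply: mulr_ge0; first exact: exprn_ge0.
  by apply: addr_ge0; [exact: ltW|exact: mulr_ge0].
(* The test function is generalised, since each replacement turns F' into its Rademacher average,
   which is of the same class. *)
have main m F' F1' F2' : taylor2 K F' F1' F2' ->
  `|iter m (walk h) (fun=> F') s x - iter m (rademachers (kap * h) (enum J)) F' x|
    <= m%:R * (K * (h ^+ 2 * (e + L * h)))
       + (minn m r)%:R * (K * (h ^+ 2 * (N2 * g0) + K1 * h ^+ 3)).
  elim: m F' F1' F2' => [|m IH] F' F1' F2' t'.
    by rewrite /= subrr normr0 min0n !mul0r addr0.
  have := IH _ _ _ (taylor2_rademachers (kap * h) (enum J) t').
  rewrite !iterSr.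
  pose E s x := walk h (fun=> F') s x - rademachers (kap * h) (enum J) F' x.
  have -> : iter m (walk h) (walk h (fun=> F')) s x =
      iter m (walk h) E s x + iter m (walk h) (fun=> rademachers (kap * h) (enum J) F') s x.
    rewrite -[RHS]/((fun s x => iter m (walk h) E s x +
      iter m (walk h) (fun=> rademachers (kap * h) (enum J) F') s x) s x) -iter_walk_opD.
    by congr (iter _ _ _ _ _); apply/funext => s'; apply/funext => x'; rewrite /E subrK.
  have := a1 m _ _ _ s x t'; have := fun rm => a2 m _ _ _ s x rm t'; rewrite -/E.
  move: (iter m (walk h) E s x) (iter m (walk h) (fun=> rademachers _ _ _) s x) => U W.
  move: (iter m _ (rademachers _ _ _) x) => Z.
  move: (K * (h ^+ 2 * (e + L * h))) B0 => B B0.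
  move: (K * (h ^+ 2 * (N2 * g0) + K1 * h ^+ 3)) A0 => A A0.
  have [rm a2' _ IHm|mr _ h1 IHm] := leqP r m.
    rewrite (minn_idPr (leqW rm)) -natr1.
    move: (a2' isT) IHm; rewrite !ler_norml.
    move: (m%:R : R) (r%:R : R) => m' r' {a2'}.
    move=> /andP[h1 h2] /andP[h3 h4].
    by apply/andP; split; lra.
  rewrite (minn_idPl mr) -natr1.
  move: h1 IHm; rewrite !ler_norml.
  move: (m%:R : R) => m'.
  move=> /andP[h1 h2] /andP[h3 h4].
  by apply/andP; split; lra.
apply: le_trans (main n _ _ _ t) _.
have minr : (minn n r)%:R <= r%:R :> R by rewrite ler_nat geq_minr.
have := ler_wpM2r A0 minr.
have h2 : 0 <= K * h ^+ 2 by rewrite mulr_ge0// exprn_ge0.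
have h3 : 0 <= K * h ^+ 2 * h by rewrite mulr_ge0.
have rN : 0 <= r%:R * (N2 * g0) by rewrite !mulr_ge0.
have rK : 0 <= r%:R * K1 by rewrite !mulr_ge0.
have := mulr_ge0 h3 K1_ge0; have := mulr_ge0 h2 K1_ge0.
have := mulr_ge0 h3 L_1; have := mulr_ge0 h2 L_1.
have := mulr_ge0 h3 rN; have := mulr_ge0 h2 rN.
have := mulr_ge0 h3 rK; have := mulr_ge0 h2 rK.
rewrite /L; lra.
Qed.

End lindeberg.

(** * Gaussian means and the limit of Rademacher sums *)

Section gaussian.
Context (R : realType).
Local Notation mu := (@lebesgue_measure R).

Lemma normal_pdf_expR (m s z : R) : s != 0 ->
  normal_pdf m s z = normal_peak s * expR (- (z - m) ^+ 2 / (s ^+ 2 *+ 2)).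
Proof. by move=> s0; rewrite normal_pdfE. Qed.

(* Comparing z with exponentials of z - m and (z - m)^2, whose Gaussian means are
   given by the next two identities, yields the first two moments. *)
Lemma normal_pdf_tilt (m s th z : R) : s != 0 ->
  normal_pdf m s z * expR (th * (z - m)) =
  expR (th ^+ 2 * s ^+ 2 / 2) * normal_pdf (m + th * s ^+ 2) s z.
Proof.
move=> s0; rewrite !normal_pdf_expR// mulrCA -!mulrA -!expRD.
congr (_ * expR _); field.
by rewrite s0.
Qed.

Lemma normal_pdf_scale (m s r z : R) : 0 < s -> 0 < r ->
  normal_pdf m s z * expR ((z - m) ^+ 2 * (1 - r ^- 2) / (2 * s ^+ 2)) =
  r * normal_pdf m (r * s) z.
Proof.
move=> s0 r0.
rewrite !normal_pdf_expR ?gt_eqF// ?mulr_gt0//. rewrite -[LHS]mulrA -expRD [RHS]mulrA.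
congr (_ * expR _).
  have E : (r * s) ^+ 2 * trigo.pi *+ 2 = r ^+ 2 * (s ^+ 2 * trigo.pi *+ 2) :> R by ring.
  rewrite /normal_peak E sqrtrM ?sqr_ge0//. rewrite sqrtr_sqr gtr0_norm//.
  by rewrite invfM mulrA divff ?gt_eqF// mul1r.
by field; rewrite !gt_eqF.
Qed.

(** The joint density of a Gaussian y and of z, which is y plus independent noise, factored in the
    other order: the marginal of z times the conditional law of y given z, whose mean and deviation
    come from completing the square. *)
Lemma normal_pdf_convolution (s a r y z : R) : 0 < s -> 0 < a -> 0 < r ->
  r ^+ 2 = s ^+ 2 + a ^+ 2 ->
  normal_pdf 0 s y * normal_pdf y a z =
  normal_pdf 0 r z * normal_pdf (s ^+ 2 / r ^+ 2 * z) (s * a / r) y.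
Proof.
move=> s0 a0 r0 rE.
have r20 : r ^+ 2 != 0 by rewrite gt_eqF// exprn_gt0.
rewrite !normal_pdf_expR ?gt_eqF// ?divr_gt0 ?mulr_gt0//.
rewrite mulrACA [RHS]mulrACA -!expRD; congr (_ * expR _).
  rewrite /normal_peak -!invfM -!sqrtrM ?mulrn_wge0 ?mulr_ge0 ?sqr_ge0 ?pi_ge0//.
  - by congr (Num.sqrt _)^-1; field; rewrite gt_eqF.
  - exact: ltW.
  - exact: ltW.
  - exact: ltW.
  - exact: ltW.
have a2 : s ^+ 2 = r ^+ 2 - a ^+ 2 by rewrite rE addrK.
have r2a : r ^+ 2 - a ^+ 2 != 0 by rewrite -a2 gt_eqF// exprn_gt0.
have -> : (s * a * r^-1) ^+ 2 = (r ^+ 2 - a ^+ 2) * a ^+ 2 / r ^+ 2 by rewrite !exprMn exprVn a2.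
rewrite a2; field.
by rewrite r2a !gt_eqF.
Qed.

Lemma le0_of_le_mulr (x c : R) : 0 <= c -> (forall e, 0 < e < 1 -> x <= c * e) -> x <= 0.
Proof.
move=> c0 h; rewrite leNgt; apply/negP => x0.
have c1 : 0 < c + x by rewrite ltr_wpDl.
have := h (x / (2 * (c + x))).
have c2 : 0 < 2 * (c + x) by rewrite mulr_gt0.
rewrite divr_gt0// ltr_pdivrMr// mul1r mulrA ler_pdivlMr// => H.
have /H : true && (x < 2 * (c + x)) by rewrite /=; lra.
nra.
Qed.

Local Notation integrable f := (mu.-integrable [set: R] (EFin \o f)).

Lemma integrable_dominated (f g : R -> R) : measurable_fun setT f ->
  (forall x, `|f x| <= g x) -> integrable g -> integrable f.
Proof.
move=> mf fg; apply: le_integrable => //; first exact/measurable_EFinP.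
move=> x _ /=; rewrite lee_fin; apply: le_trans (fg x) _; exact: ler_norm.
Qed.

Lemma integrable_normal_pdfZ (c m s : R) : integrable (fun z => c * normal_pdf m s z).
Proof. exact: (integrableZl measurableT c (integrable_normal_pdf m s)). Qed.

Lemma Rintegral_normal_pdf (m s : R) : \int[mu]_z normal_pdf m s z = 1.
Proof. by rewrite /Rintegral integral_normal_pdf. Qed.

Definition gauss_mean (m s : R) (g : R -> R) : R := \int[mu]_z (g z * normal_pdf m s z).

(** Quartic growth in units of the deviation covers the cubic Taylor remainders below and keeps the
    constants independent of m and s. *)
Definition tame (m s : R) (g : R -> R) := measurable_fun setT g /\
  exists C, forall z, `|g z| <= C * (1 + ((z - m) / s) ^+ 4).

(** The exponent 3/8 is (1 - 1/4) / 2, the price in [normal_pdf_scale] of doubling the deviation; 29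
    dominates (16/3)^2. *)
Lemma quartic_le_expR (t : R) : 1 + t ^+ 4 <= 29 * expR (t ^+ 2 * (3 / 8)).
Proof.
pose x := t ^+ 2 * (3 / 8) / 2.
have x0 : 0 <= x by rewrite /x; have := sqr_ge0 t; lra.
have -> : t ^+ 2 * (3 / 8) = x + x by rewrite /x; field.
rewrite expRD; have h := expR_ge1Dx x.
have h2 : (1 + x) ^+ 2 <= expR x * expR x by rewrite expr2 ler_pM// addr_ge0.
have : t ^+ 4 = (16 / 3 * x) ^+ 2 by rewrite /x; field.
move=> ->; nra.
Qed.

(** Quartic growth is absorbed by doubling the deviation; the factor 2 of [normal_pdf_scale] turns
    29 into 58. *)
Lemma gauss_quartic_dominated (m s C : R) (g : R -> R) : 0 < s -> 0 <= C ->
  (forall z, `|g z| <= C * (1 + ((z - m) / s) ^+ 4)) ->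
  forall z, `|g z * normal_pdf m s z| <= 58 * C * normal_pdf m (2 * s) z.
Proof.
move=> s0 C0 gC z; rewrite normrM (ger0_norm (normal_pdf_ge0 _ _ _)).
have two0 : 0 < 2 :> R by [].
have := normal_pdf_scale m z s0 two0.
have -> : (z - m) ^+ 2 * (1 - 2 ^- 2) / (2 * s ^+ 2) = ((z - m) / s) ^+ 2 * (3 / 8).
  by field; rewrite gt_eqF.
move=> E; have := quartic_le_expR ((z - m) / s) => Q.
have H : `|g z| <= C * (29 * expR (((z - m) / s) ^+ 2 * (3 / 8))).
  by apply: le_trans (gC z) _; apply: ler_wpM2l.
apply: le_trans (ler_wpM2r (normal_pdf_ge0 m s z) H) _.
rewrite le_eqVlt; apply/orP; left; apply/eqP.
rewrite [LHS](_ : _ = 29 * C * (normal_pdf m s z * expR (((z - m) / s) ^+ 2 * (3 / 8)))); last by ring.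
by rewrite E; ring.
Qed.

Lemma tame_integrable (m s : R) (g : R -> R) : 0 < s -> tame m s g ->
  integrable (fun z => g z * normal_pdf m s z).
Proof.
move=> s0 [mg [C gC]].
have C0 : 0 <= C by have := gC m; rewrite subrr mul0r expr0n addr0 mulr1; exact: le_trans.
apply: (integrable_dominated _ (gauss_quartic_dominated s0 C0 gC)).
  by apply: measurable_funM => //; exact: measurable_normal_pdf.
exact: integrable_normal_pdfZ.
Qed.

Lemma gauss_mean_bound (m s C : R) (g : R -> R) : 0 < s -> measurable_fun setT g ->
  (forall z, `|g z| <= C * (1 + ((z - m) / s) ^+ 4)) ->
  `|gauss_mean m s g| <= 58 * C.
Proof.
move=> s0 mg gC.
have C0 : 0 <= C by have := gC m; rewrite subrr mul0r expr0n addr0 mulr1; exact: le_trans.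
have ig : integrable (fun z => g z * normal_pdf m s z).
  by apply: tame_integrable => //; split => //; exists C.
apply: le_trans (le_normr_Rintegral measurableT ig) _.
have -> : 58 * C = \int[mu]_z (58 * C * normal_pdf m (2 * s) z).
  rewrite RintegralZl//; last exact: integrable_normal_pdf.
  by rewrite Rintegral_normal_pdf mulr1.
have dom := gauss_quartic_dominated s0 C0 gC.
have i2 : integrable (fun z => 58 * C * normal_pdf m (2 * s) z).
  exact: integrable_normal_pdfZ.
have i1 : integrable (fun z => `|g z * normal_pdf m s z|).
  apply: (integrable_dominated _ _ i2) => [|z]; last by rewrite normr_id.
  by apply: measurableT_comp => //; apply: measurable_funM => //; exact: measurable_normal_pdf.
exact: (le_Rintegral measurableT i1 i2 (fun z _ => dom z)).
Qed.

Lemma tameD (m s : R) (f g : R -> R) : tame m s f -> tame m s g ->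
  tame m s (fun z => f z + g z).
Proof.
move=> [mf [C fC]] [mg [C' gC]]; split; first exact: measurable_funD.
by exists (C + C') => z; rewrite mulrDl; apply: le_trans (ler_normD _ _) (lerD _ _).
Qed.

Lemma tameZ (m s c : R) (f : R -> R) : tame m s f -> tame m s (fun z => c * f z).
Proof.
move=> [mf [C fC]]; split; first exact: measurable_funM.
by exists (`|c| * C) => z; rewrite normrM -mulrA; apply: ler_wpM2l.
Qed.

Lemma gauss_meanD (m s : R) (f g : R -> R) : 0 < s -> tame m s f -> tame m s g ->
  gauss_mean m s (fun z => f z + g z) = gauss_mean m s f + gauss_mean m s g.
Proof.
move=> s0 tf tg; rewrite /gauss_mean -RintegralD//; try exact: tame_integrable.
by congr Rintegral; apply/funext => z; rewrite mulrDl.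
Qed.

Lemma gauss_meanZ (m s c : R) (f : R -> R) : 0 < s -> tame m s f ->
  gauss_mean m s (fun z => c * f z) = c * gauss_mean m s f.
Proof.
move=> s0 tf; rewrite /gauss_mean -RintegralZl//; last exact: tame_integrable.
by congr Rintegral; apply/funext => z; rewrite mulrA.
Qed.

Lemma gauss_mean_cst (m s c : R) : gauss_mean m s (fun=> c) = c.
Proof.
rewrite /gauss_mean RintegralZl//; last exact: integrable_normal_pdf.
by rewrite Rintegral_normal_pdf mulr1.
Qed.

Lemma tame_cst (m s c : R) : tame m s (fun=> c).
Proof.
split; first exact: measurable_cst.
by exists `|c| => z; rewrite ler_peMr// lerDl exprn_even_ge0.
Qed.

Lemma tame_center (m s : R) : 0 < s -> tame m s (fun z => z - m).
Proof.
move=> s0; split; first exact: measurable_funB.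
exists s => z; have -> : `|z - m| = s * `|(z - m) / s|.
  by rewrite normrM normfV (gtr0_norm s0) mulrCA divff ?mulr1// gt_eqF.
rewrite ler_pM2l// ler_norml; set t := (z - m) / s.
have := sqr_ge0 (t ^+ 2 - 1 / 2); have := sqr_ge0 (t - 1 / 2); have := sqr_ge0 (t + 1 / 2).
have -> : t ^+ 4 = (t ^+ 2) ^+ 2 by ring.
by move=> ? ? ?; apply/andP; split; nra.
Qed.

Lemma tame_center_sqr (m s : R) : 0 < s -> tame m s (fun z => (z - m) ^+ 2).
Proof.
move=> s0; split; first by apply: measurable_funX; exact: measurable_funB.
exists (s ^+ 2) => z; have -> : (z - m) ^+ 2 = s ^+ 2 * ((z - m) / s) ^+ 2.
  by field; rewrite gt_eqF.
rewrite normrM !ger0_norm ?sqr_ge0//; set t := (z - m) / s.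
apply: ler_wpM2l; first exact: sqr_ge0.
have := sqr_ge0 (t ^+ 2 - 1 / 2).
have -> : t ^+ 4 = (t ^+ 2) ^+ 2 by ring.
nra.
Qed.

Lemma gauss_mean_center (m s : R) : 0 < s -> gauss_mean m s (fun z => z - m) = 0.
Proof.
move=> s0; set M := gauss_mean _ _ _.
have H th : 1 + th * M <= expR (th ^+ 2 * s ^+ 2 / 2).
  have tc := tameZ th (tame_center m s0).
  have -> : 1 + th * M = gauss_mean m s (fun z => 1 + th * (z - m)).
    rewrite (gauss_meanD s0 (tame_cst m s 1) tc) gauss_mean_cst gauss_meanZ//.
    exact: tame_center.
  have -> : expR (th ^+ 2 * s ^+ 2 / 2) =
      \int[mu]_z (expR (th ^+ 2 * s ^+ 2 / 2) * normal_pdf (m + th * s ^+ 2) s z).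
    rewrite RintegralZl//; last exact: integrable_normal_pdf.
    by rewrite Rintegral_normal_pdf mulr1.
  have i1 := tame_integrable s0 (tameD (tame_cst m s 1) tc).
  apply: (le_Rintegral measurableT i1 (integrable_normal_pdfZ _ _ _)) => z _.
  rewrite -normal_pdf_tilt ?gt_eqF// mulrC; apply: ler_wpM2l; first exact: normal_pdf_ge0.
  exact: expR_ge1Dx.
have M0 : `|M| <= 0.
  apply: (@le0_of_le_mulr _ s); first exact: ltW.
  (* Tilts by e / s of both signs bound M from above and from below by s e, since expR (e^2 / 2) is
     at most 1 + e^2. *)
  move=> e /andP[e0 e1]; have := H (e / s); have := H (- e / s).
  have -> : (- e / s) ^+ 2 * s ^+ 2 / 2 = e ^+ 2 / 2 by field; rewrite gt_eqF.
  have -> : (e / s) ^+ 2 * s ^+ 2 / 2 = e ^+ 2 / 2 by field; rewrite gt_eqF.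
  have hx : expR (e ^+ 2 / 2) <= 1 + e ^+ 2.
    have := expR_ge1Dx (- (e ^+ 2 / 2)); rewrite expRN => h1.
    have p := expR_gt0 (e ^+ 2 / 2).
    have : (1 - e ^+ 2 / 2) * expR (e ^+ 2 / 2) <= 1 by rewrite -ler_pdivlMr// mul1r.
    have e2 : 0 <= e ^+ 2 <= 1 by rewrite sqr_ge0 expr2; nra.
    have c0 : 0 < 1 - e ^+ 2 / 2 by move: e2 => /andP[_ ?]; lra.
    move=> h2; rewrite -(ler_pM2l c0); apply: le_trans h2 _.
    by move: (e ^+ 2) e2 => E /andP[? ?]; nra.
  move=> h1 h2; rewrite ler_norml.
  have p : e / s * M <= e ^+ 2 by lra.
  have q : - e / s * M <= e ^+ 2 by lra.
  have E1 : e * (M * e^-1) = M by rewrite mulrCA divff ?mulr1// gt_eqF.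
  have se : 0 < s / e by rewrite divr_gt0.
  have := ler_wpM2l (ltW se) p; have := ler_wpM2l (ltW se) q.
  have -> : s / e * (- e / s * M) = - M by field; rewrite !gt_eqF.
  have -> : s / e * (e / s * M) = M by field; rewrite !gt_eqF.
  have -> : s / e * e ^+ 2 = s * e by field; rewrite gt_eqF.
  by move=> ? ?; apply/andP; split; lra.
by apply/eqP; rewrite -normr_eq0 eq_le M0 normr_ge0.
Qed.

Lemma gauss_mean_center_sqr (m s : R) : 0 < s ->
  gauss_mean m s (fun z => (z - m) ^+ 2) = s ^+ 2.
Proof.
move=> s0; set M := gauss_mean _ _ _.
(* The inequality 1 + x <= expR x is used with x proportional to (z - m)^2; values of r slightly
   above and below 1 give the two bounds on M. *)
have H r : 0 < r -> 1 + (1 - r ^- 2) / (2 * s ^+ 2) * M <= r.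
  move=> r0; have tc := tameZ ((1 - r ^- 2) / (2 * s ^+ 2)) (tame_center_sqr m s0).
  have -> : 1 + (1 - r ^- 2) / (2 * s ^+ 2) * M =
      gauss_mean m s (fun z => 1 + (1 - r ^- 2) / (2 * s ^+ 2) * (z - m) ^+ 2).
    rewrite (gauss_meanD s0 (tame_cst m s 1) tc) gauss_mean_cst gauss_meanZ//.
    exact: tame_center_sqr.
  rewrite [leRHS](_ : r = \int[mu]_z (r * normal_pdf m (r * s) z)); last first.
    rewrite RintegralZl//; last exact: integrable_normal_pdf.
    by rewrite Rintegral_normal_pdf mulr1.
  have i1 := tame_integrable s0 (tameD (tame_cst m s 1) tc).
  apply: (le_Rintegral measurableT i1 (integrable_normal_pdfZ _ _ _)) => z _.
  rewrite -normal_pdf_scale// mulrC; apply: ler_wpM2l; first exact: normal_pdf_ge0.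
  by rewrite -[X in expR X]mulrA [X in expR X]mulrC; exact: expR_ge1Dx.
have H2 r : 0 < r -> (r ^+ 2 - 1) * M <= 2 * s ^+ 2 * r ^+ 2 * (r - 1).
  move=> r0; have rs : 0 < 2 * s ^+ 2 * r ^+ 2 by rewrite !mulr_gt0// exprn_gt0.
  have := ler_wpM2l (ltW rs) (H r r0).
  have -> : 2 * s ^+ 2 * r ^+ 2 * (1 + (1 - r ^- 2) / (2 * s ^+ 2) * M) =
    2 * s ^+ 2 * r ^+ 2 + (r ^+ 2 - 1) * M by field; rewrite !gt_eqF.
  lra.
have s20 : 0 < s ^+ 2 by rewrite exprn_gt0.
apply/eqP; rewrite eq_le -subr_le0 -[s ^+ 2 <= M]subr_le0; apply/andP; split.
  apply: (@le0_of_le_mulr _ (3 * s ^+ 2)); first by lra.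
  move=> e /andP[e0 e1]; have := H2 (1 + e) (ltr_wpDl ler01 e0).
  have -> : ((1 + e) ^+ 2 - 1) * M = e * ((2 + e) * M) by ring.
  have -> : 2 * s ^+ 2 * (1 + e) ^+ 2 * (1 + e - 1) = e * (2 * s ^+ 2 * (1 + e) ^+ 2) by ring.
  rewrite ler_pM2l// => h.
  nra.
apply: (@le0_of_le_mulr _ (2 * s ^+ 2)); first by lra.
move=> e /andP[e0 e1]; have re : 0 < 1 - e by lra.
have := H2 (1 - e) re.
have -> : ((1 - e) ^+ 2 - 1) * M = - (e * ((2 - e) * M)) by ring.
have -> : 2 * s ^+ 2 * (1 - e) ^+ 2 * (1 - e - 1) = - (e * (2 * s ^+ 2 * (1 - e) ^+ 2)) by ring.
rewrite lerN2 ler_pM2l// => h.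
nra.
Qed.
End gaussian.

Section gaussian_clt.
Context (R : realType).
Local Notation mu := (@lebesgue_measure R).

(** Values in [0, 1] provide at once nonnegativity for Tonelli's theorem and integrability against
    every Gaussian. *)
Definition unit_valued (g : R -> R) := measurable_fun setT g /\ forall z, 0 <= g z <= 1.

Lemma unit_valued_tame (m s : R) g : 0 < s -> unit_valued g -> tame m s g.
Proof.
move=> s0 [mg g01]; split => //; exists 1 => z; have /andP[g0 g1] := g01 z.
by rewrite mul1r ger0_norm// (le_trans g1)// lerDl exprn_even_ge0.
Qed.

Lemma gauss_meanE (m s : R) g : 0 < s -> unit_valued g ->
  (gauss_mean m s g)%:E = (\int[mu]_z (g z * normal_pdf m s z)%:E)%E.
Proof.
move=> s0 ug; rewrite /gauss_mean /Rintegral fineK//.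
by apply: integrable_fin_num => //; apply: tame_integrable => //; exact: unit_valued_tame.
Qed.

Lemma le_gauss_mean (m s : R) (f g : R -> R) : 0 < s -> tame m s f -> tame m s g ->
  (forall z, f z <= g z) -> gauss_mean m s f <= gauss_mean m s g.
Proof.
move=> s0 tf tg fg.
apply: (le_Rintegral measurableT (tame_integrable s0 tf) (tame_integrable s0 tg)) => z _.
by rewrite ler_wpM2r// normal_pdf_ge0.
Qed.

Lemma gauss_mean_unit (m s : R) (g : R -> R) : 0 < s -> unit_valued g -> 0 <= gauss_mean m s g <= 1.
Proof.
move=> s0 ug; have tg := unit_valued_tame m s0 ug; case: ug => _ g01.
have h0 : forall z, 0 <= g z by move=> z; have /andP[] := g01 z.
have h1 : forall z, g z <= 1 by move=> z; have /andP[] := g01 z.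
have := le_gauss_mean s0 (tame_cst m s 0) tg h0; rewrite gauss_mean_cst => ->.
by have := le_gauss_mean s0 tg (tame_cst m s 1) h1; rewrite gauss_mean_cst => ->.
Qed.

Lemma gauss_mean_dist (m s : R) (f g : R -> R) (e : R) : 0 < s -> tame m s f -> tame m s g ->
  (forall z, `|f z - g z| <= e) -> `|gauss_mean m s f - gauss_mean m s g| <= e.
Proof.
move=> s0 tf tg fg.
have te := tame_cst m s e.
have h1 : gauss_mean m s f <= gauss_mean m s g + e.
  rewrite -[X in _ + X](gauss_mean_cst m s e) -gauss_meanD//; apply: le_gauss_mean => //.
    exact: tameD.
  by move=> z; have := fg z; rewrite ler_norml => /andP[? ?]; lra.
have h2 : gauss_mean m s g <= gauss_mean m s f + e.
  rewrite -[X in _ + X](gauss_mean_cst m s e) -gauss_meanD//; apply: le_gauss_mean => //.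
    exact: tameD.
  by move=> z; have := fg z; rewrite ler_norml => /andP[? ?]; lra.
by rewrite ler_norml; apply/andP; split; lra.
Qed.

Definition taylor1 (K : R) (g g1 g2 : R -> R) := forall x v,
  `|g (x + v) - g x - g1 x * v - g2 x / 2 * v ^+ 2| <= K * `|v| ^+ 3.

Definition smooth (K : R) (g : R -> R) :=
  unit_valued g /\ exists g1 g2, taylor1 K g g1 g2.

Definition rademacher1 (a : R) (g : R -> R) : R -> R := fun y => (g (y + a) + g (y - a)) / 2.

Lemma measurable_shift (g : R -> R) (a : R) : measurable_fun setT g ->
  measurable_fun setT (fun y : R => g (y + a)).
Proof. by move=> mg; apply: measurableT_comp => //; exact: measurable_funD. Qed.

Lemma unit_valued_rademacher1 (a : R) g : unit_valued g -> unit_valued (rademacher1 a g).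
Proof.
move=> [mg g01]; split => [|z].
  apply: measurable_funM => //; apply: measurable_funD; exact: measurable_shift.
rewrite /rademacher1; have := g01 (z + a); have := g01 (z - a).
by move=> /andP[? ?] /andP[? ?]; apply/andP; split; lra.
Qed.

Lemma smooth_rademacher1 (K a : R) g : smooth K g -> smooth K (rademacher1 a g).
Proof.
move=> [ug [g1 [g2 t]]]; split; first exact: unit_valued_rademacher1.
exists (rademacher1 a g1), (rademacher1 a g2) => x v; rewrite /rademacher1.
have := t (x + a) v; have := t (x - a) v; rewrite ![_ + _ + v]addrAC !ler_norml.
by move=> /andP[? ?] /andP[? ?]; apply/andP; split; lra.
Qed.

(** The first two Gaussian moments integrate the Taylor polynomial exactly; the cubic remainder is
    below [K * a ^+ 3] times 1 + u^4, where u is the normalised variable. *)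
Lemma gauss_mean_taylor (K : R) g g1 g2 (a y : R) : 0 < a -> 0 <= K -> unit_valued g ->
  taylor1 K g g1 g2 -> `|gauss_mean y a g - g y - g2 y / 2 * a ^+ 2| <= 58 * K * a ^+ 3.
Proof.
move=> a0 K0 ug t; have tg := unit_valued_tame y a0 ug.
have mg : measurable_fun setT g by case: ug.
pose p z := g y + (g1 y * (z - y) + g2 y / 2 * (z - y) ^+ 2).
have t1 := tameZ (g1 y) (tame_center y a0).
have t2 := tameZ (g2 y / 2) (tame_center_sqr y a0).
have tp : tame y a p by apply: tameD; [exact: tame_cst|exact: tameD].
have pE : gauss_mean y a p = g y + g2 y / 2 * a ^+ 2.
  rewrite (gauss_meanD a0 (tame_cst y a (g y)) (tameD t1 t2)) gauss_mean_cst gauss_meanD//.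
  rewrite !gauss_meanZ//; try by [exact: tame_center|exact: tame_center_sqr].
  by rewrite gauss_mean_center// gauss_mean_center_sqr// mulr0 add0r.
have te : tame y a (fun z => g z + -1 * p z) by apply: tameD => //; exact: tameZ.
have eE : gauss_mean y a g - g y - g2 y / 2 * a ^+ 2 = gauss_mean y a (fun z => g z + -1 * p z).
  rewrite gauss_meanD//; last exact: tameZ.
  by rewrite gauss_meanZ// pE; ring.
rewrite eE -mulrA; apply: gauss_mean_bound => //; first by case: te.
move=> z; have := t y (z - y); rewrite subrKC => h.
apply: le_trans (_ : K * `|z - y| ^+ 3 <= _).
  by apply: le_trans h; rewrite /p le_eqVlt; apply/orP; left; apply/eqP; congr (`|_|); ring.
rewrite -mulrA ler_wpM2l//; set u := (z - y) / a.
have -> : `|z - y| = a * `|u|.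
  by rewrite normrM normfV (gtr0_norm a0) mulrCA divff ?mulr1// gt_eqF.
rewrite exprMn ler_wpM2l ?exprn_ge0 ?ltW//.
have -> : u ^+ 4 = `|u| ^+ 4.
  by rewrite -[4%N]/(2 * 2)%N !exprM real_normK ?num_real.
move: (`|u| : R) => v.
have := sqr_ge0 (v ^+ 2 - v); have := sqr_ge0 (v ^+ 2 - 1); have := sqr_ge0 (v ^+ 2).
nra.
Qed.

Lemma rademacher1_taylor (K : R) g g1 g2 (a y : R) : 0 < a ->
  taylor1 K g g1 g2 -> `|rademacher1 a g y - g y - g2 y / 2 * a ^+ 2| <= K * a ^+ 3.
Proof.
move=> a0 t; have := t y a; have := t y (- a).
rewrite normrN (gtr0_norm a0) sqrrN /rademacher1 !ler_norml.
by move=> /andP[? ?] /andP[? ?]; apply/andP; split; lra.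
Qed.

Lemma measurable_normal_pdf2 (a : R) : 0 < a ->
  measurable_fun setT (fun yz : R * R => normal_pdf yz.1 a yz.2).
Proof.
move=> a0; rewrite (_ : (fun yz => _) = fun yz : R * R => normal_peak a *
    expR (- (yz.2 - yz.1) ^+ 2 / (a ^+ 2 *+ 2))); last first.
  by apply/funext => yz; rewrite normal_pdf_expR ?gt_eqF.
apply: measurable_funM => //; apply: measurableT_comp => //.
apply: measurable_funM => //; apply: measurableT_comp => //.
by apply: measurable_funX; apply: measurable_funB.
Qed.

(** One statement covers two uses: a moving mean with a fixed function, and a fixed mean with a
    function depending on the parameter. *)
Lemma measurable_gauss_mean (a : R) (m : R -> R) (G : R * R -> R) : 0 < a ->
  measurable_fun setT m -> measurable_fun setT G -> (forall yz, 0 <= G yz <= 1) ->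
  measurable_fun setT (fun y : R => gauss_mean (m y) a (fun z => G (y, z))).
Proof.
move=> a0 mm mG G01.
have mf : measurable_fun setT (fun yz : R * R => (G yz * normal_pdf (m yz.1) a yz.2)%:E).
  apply/measurable_EFinP; apply: measurable_funM => //.
  apply: (@measurableT_comp _ _ _ _ _ _ (fun yz : R * R => normal_pdf yz.1 a yz.2)
     _ (fun yz : R * R => (m yz.1, yz.2))); first exact: measurable_normal_pdf2.
  apply: measurable_fun_pair => //; exact: measurableT_comp.
have f0 (yz : R * R) : (0 <= (G yz * normal_pdf (m yz.1) a yz.2)%:E)%E.
  by rewrite lee_fin mulr_ge0 ?normal_pdf_ge0//; have /andP[] := G01 yz.
have := @measurable_fun_fubini_tonelli_F _ _ _ _ _ mu _ mf f0.
by move=> /(measurableT_comp (fine_measurable measurableT)); exact.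
Qed.

(* This is Fubini's theorem after completing the square in the exponent. *)
Lemma gauss_mean_semigroup (s a r : R) g : 0 < s -> 0 < a -> 0 < r ->
  r ^+ 2 = s ^+ 2 + a ^+ 2 -> unit_valued g ->
  gauss_mean 0 s (fun y => gauss_mean y a g) = gauss_mean 0 r g.
Proof.
move=> s0 a0 r0 rE ug; have [mg g01] := ug.
have uu : unit_valued (fun y : R => gauss_mean y a g).
  split=> [|y]; last exact: gauss_mean_unit.
  apply: (@measurable_gauss_mean a id (fun yz => g yz.2)) => //.
  exact: measurableT_comp.
apply: EFin_inj; rewrite (gauss_meanE _ s0 uu) (gauss_meanE _ r0 ug).
under eq_integral do rewrite mulrC EFinM (gauss_meanE _ a0 ug).
pose f (yz : R * R) := (normal_pdf 0 s yz.1 * (g yz.2 * normal_pdf yz.1 a yz.2))%:E.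
have mf : measurable_fun setT f.
  apply/measurable_EFinP; apply: measurable_funM.
    by apply: measurableT_comp => //; exact: measurable_normal_pdf.
  by apply: measurable_funM; [exact: measurableT_comp|exact: measurable_normal_pdf2].
have f0 yz : (0 <= f yz)%E.
  by rewrite lee_fin !mulr_ge0 ?normal_pdf_ge0//; have /andP[] := g01 yz.2.
transitivity (\int[mu]_y \int[mu]_z f (y, z))%E.
  apply: eq_integral => y _; rewrite -ge0_integralZl//.
  - by apply/measurable_EFinP; apply: measurable_funM => //; exact: measurable_normal_pdf.
  - by move=> z _; rewrite lee_fin mulr_ge0 ?normal_pdf_ge0//; have /andP[] := g01 z.
  - by rewrite lee_fin normal_pdf_ge0.
rewrite (@fubini_tonelli _ _ _ _ _ mu mu f mf f0); apply: eq_integral => z _.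
have gp : (0 <= (g z * normal_pdf 0 r z)%:E)%E.
  by rewrite lee_fin mulr_ge0 ?normal_pdf_ge0//; have /andP[] := g01 z.
transitivity ((g z * normal_pdf 0 r z)%:E * \int[mu]_y
   (normal_pdf (s ^+ 2 / r ^+ 2 * z) (s * a / r) y)%:E)%E; last first.
  by rewrite integral_normal_pdf mule1.
rewrite -ge0_integralZl//.
- apply: eq_integral => y _; rewrite /f /= -EFinM; congr (_%:E).
  by rewrite mulrCA (normal_pdf_convolution y z s0 a0 r0 rE) mulrA.
- by apply/measurable_EFinP; exact: measurable_normal_pdf.
- by move=> y _; rewrite lee_fin normal_pdf_ge0.
Qed.

(** A Rademacher and a Gaussian step of deviation a share their first two moments, so they differ by
    at most (1 + 58) K a^3. The innermost step is replaced, and the semigroup identity merges the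
    new Gaussian step with the others. *)
Lemma gaussian_clt (K a : R) (n : nat) g : 0 < a -> 0 <= K -> smooth K g ->
  `|iter n.+1 (rademacher1 a) g 0 - gauss_mean 0 (a * Num.sqrt n.+1%:R) g|
   <= n.+1%:R * (59 * K * a ^+ 3).
Proof.
move=> a0 K0.
have step g' y : smooth K g' -> `|rademacher1 a g' y - gauss_mean y a g'| <= 59 * K * a ^+ 3.
  move=> [ug [g1 [g2 t]]].
  have := rademacher1_taylor y a0 t; have := gauss_mean_taylor y a0 K0 ug t.
  rewrite !ler_norml => /andP[? ?] /andP[? ?]; apply/andP; split; lra.
elim: n g => [|n IH] g sg.
  by rewrite mul1r sqrtr1 mulr1; exact: step.
rewrite iterSr.
have := IH _ (smooth_rademacher1 a sg).
have n0 : 0 < a * Num.sqrt n.+1%:R by rewrite mulr_gt0// sqrtr_gt0.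
have n1 : 0 < a * Num.sqrt n.+2%:R by rewrite mulr_gt0// sqrtr_gt0.
have E : (a * Num.sqrt n.+2%:R) ^+ 2 = (a * Num.sqrt n.+1%:R) ^+ 2 + a ^+ 2.
  by rewrite !exprMn !sqr_sqrtr// -(natr1 n.+1) mulrDr mulr1.
have ug : unit_valued g by case: sg.
rewrite -(gauss_mean_semigroup n0 a0 n1 E ug).
have uu : unit_valued (fun y : R => gauss_mean y a g).
  split=> [|y]; last exact: gauss_mean_unit.
  apply: (@measurable_gauss_mean a id (fun yz => g yz.2)) => //.
    by apply: measurableT_comp => //; case: ug.
  by move=> yz; case: ug => _; exact.
have := gauss_mean_dist n0 (unit_valued_tame 0 n0 (unit_valued_rademacher1 a ug))
  (unit_valued_tame 0 n0 uu) (fun y => step g y sg).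
rewrite -[in X in _ -> _ -> X](natr1 n.+1) !ler_norml.
move: (n.+1%:R : R) (iter n.+1 _ _ _) => N I /andP[? ?] /andP[? ?].
by apply/andP; split; lra.
Qed.

End gaussian_clt.

(** * Radial test functions and chi-squared limits *)

Section chi_squared_limit.
Context (R : realType).
Local Notation mu := (@lebesgue_measure R).

(** The coordinates of a radial function are averaged one by one; [c] accumulates the squares of the
    earlier ones, which keeps the computation one-dimensional. *)
Fixpoint rademacher_chi (n : nat) (a : R) (s : nat) (f : R -> R) (c : R) : R :=
  if s is s'.+1 then
    iter n (rademacher1 a) (fun y => rademacher_chi n a s' f (c + y ^+ 2)) 0
  else f c.

Fixpoint gauss_chi (s : nat) (f : R -> R) (c : R) : R :=
  if s is s'.+1 then gauss_mean 0 1 (fun y => gauss_chi s' f (c + y ^+ 2)) else f c.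

Lemma smooth_avg (K : R) g g' : smooth K g -> smooth K g' ->
  smooth K (fun y => (g y + g' y) / 2).
Proof.
move=> [[mg g01] [g1 [g2 t]]] [[mg' g'01] [g'1 [g'2 t']]]; split; first split.
- by apply: measurable_funM => //; exact: measurable_funD.
- by move=> z; have := g01 z; have := g'01 z => /andP[? ?] /andP[? ?]; apply/andP; split; lra.
exists (fun y => (g1 y + g'1 y) / 2), (fun y => (g2 y + g'2 y) / 2) => x v.
have := t x v; have := t' x v; rewrite !ler_norml.
by move=> /andP[? ?] /andP[? ?]; apply/andP; split; lra.
Qed.

Lemma smooth_iter_rademacher1 (K a : R) n (G : R -> R -> R) :
  (forall z, smooth K (G z)) ->
  forall z, smooth K (fun y => iter n (rademacher1 a) (fun z => G z y) z).
Proof. by move=> sG; elim: n => //= n IH z; exact: smooth_avg. Qed.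

Definition radially_smooth (K : R) (f : R -> R) :=
  unit_valued f /\ forall c, 0 <= c -> smooth K (fun y => f (c + y ^+ 2)).

(** Offsets commute: the square y^2 can be passed under the remaining averages, where it acts
    through f alone, and f is smooth uniformly in the offset. *)
Lemma smooth_rademacher_chi (K a : R) n s f c : radially_smooth K f -> 0 <= c ->
  smooth K (fun y => rademacher_chi n a s f (c + y ^+ 2)).
Proof.
move=> [uf sf]; elim: s c => [|s IH] c c0 /=; first exact: sf.
apply: (@smooth_iter_rademacher1 K a n (fun z y => rademacher_chi n a s f (c + y ^+ 2 + z ^+ 2))) => z.
rewrite (_ : (fun y => _) = fun y => rademacher_chi n a s f (c + z ^+ 2 + y ^+ 2)).
  by apply: IH; rewrite addr_ge0// sqr_ge0.
by apply/funext => y; rewrite addrAC.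
Qed.

Lemma unit_valued_gauss_chi s f : unit_valued f -> unit_valued (gauss_chi s f).
Proof.
move=> uf; elim: s => //= s [mG G01]; split=> [|c].
  apply: (@measurable_gauss_mean R 1 (fun=> 0) (fun cy => gauss_chi s f (cy.1 + cy.2 ^+ 2))) => //.
  apply: measurableT_comp => //; apply: measurable_funD => //.
  by apply: measurable_funX.
apply: gauss_mean_unit => //; split => //.
by apply: measurableT_comp => //; apply: measurable_funD => //; exact: measurable_funX.
Qed.

Lemma unit_valued_gauss_chi_sqr s f c : unit_valued f ->
  unit_valued (fun y => gauss_chi s f (c + y ^+ 2)).
Proof.
move=> /(unit_valued_gauss_chi s)[mG G01]; split=> //.
by apply: measurableT_comp => //; apply: measurable_funD => //; exact: measurable_funX.
Qed.

(** With a the inverse square root of the number N of steps, a coordinate costs N times 59 K a^3,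
    that is 59 K a. The bounds add up over the s coordinates because averaging against a probability
    law does not expand distances. *)
Lemma rademacher_chi_gauss_chi (K : R) n s f c : 0 <= K -> radially_smooth K f -> 0 <= c ->
  `|rademacher_chi n.+1 (Num.sqrt n.+1%:R)^-1 s f c - gauss_chi s f c| <=
  s%:R * (59 * K * (Num.sqrt n.+1%:R)^-1).
Proof.
move=> K0 rf; have uf : unit_valued f by case: rf.
set a := (Num.sqrt _)^-1.
have n0 : 0 < n.+1%:R :> R by [].
have sn0 : 0 < Num.sqrt n.+1%:R :> R by rewrite sqrtr_gt0.
have a0 : 0 < a by rewrite invr_gt0.
have an : a * Num.sqrt n.+1%:R = 1 by rewrite /a mulVf// gt_eqF.
have na : n.+1%:R * a ^+ 2 = 1.
  by rewrite -[X in X * _](sqr_sqrtr (ltW n0)) -exprMn mulrC an expr1n.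
elim: s c => [|s IH] c c0; first by rewrite /= subrr normr0 mul0r.
rewrite -[rademacher_chi _ _ _ _ _]/(iter n.+1 (rademacher1 a)
  (fun y => rademacher_chi n.+1 a s f (c + y ^+ 2)) 0).
rewrite -[gauss_chi _ _ _]/(gauss_mean 0 1 (fun y => gauss_chi s f (c + y ^+ 2))).
have sm := smooth_rademacher_chi a n.+1 s rf c0.
have h1 := gaussian_clt n a0 K0 sm; rewrite an in h1.
have us : unit_valued (fun y => rademacher_chi n.+1 a s f (c + y ^+ 2)) by case: sm.
have h2 := gauss_mean_dist ltr01 (unit_valued_tame 0 ltr01 us)
   (unit_valued_tame 0 ltr01 (unit_valued_gauss_chi_sqr s c uf))
   (fun y => IH (c + y ^+ 2) (addr_ge0 c0 (sqr_ge0 y))).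
have E : n.+1%:R * (59 * K * a ^+ 3) = 59 * K * a.
  transitivity (59 * K * a * (n.+1%:R * a ^+ 2)); last by rewrite na mulr1.
  by move: (n.+1%:R : R) => N; ring.
rewrite E in h1; rewrite -(natr1 s).
move: h1 h2; rewrite !ler_norml; move: (s%:R : R) => S /andP[? ?] /andP[? ?].
by apply/andP; split; lra.
Qed.

(** The Radon-Nikodym derivative of [normal_prob] and [normal_pdf] have equal integrals over
    measurable sets, hence agree almost everywhere. *)
Lemma integral_normal_prob (m s : R) g : 0 < s -> unit_valued g ->
  (\int[normal_prob m s]_z (g z)%:E = (gauss_mean m s g)%:E)%E.
Proof.
move=> s0 ug; have [mg g01] := ug; rewrite gauss_meanE//.
have mf : measurable_fun [set: measurableTypeR R] (fun z => (g z)%:E).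
  exact/measurable_EFinP.
have f0 z : (0 <= (g z)%:E)%E by rewrite lee_fin; have /andP[] := g01 z.
have dom := normal_prob_dominates m s.
rewrite -(Radon_Nikodym_SigmaFinite.change_of_variables dom f0 measurableT mf).
have iF := Radon_Nikodym_SigmaFinite.f_integrable dom.
have mF := measurable_int _ iF.
apply: ae_eq_integral => //.
- exact: emeasurable_funM.
- apply/measurable_EFinP; apply: measurable_funM => //; exact: measurable_normal_pdf.
under [X in ae_eq _ _ _ X]eq_fun do rewrite EFinM.
apply: ae_eqe_mul2l.
apply: integral_ae_eq => //.
  by apply/measurable_EFinP; exact: measurable_normal_pdf.
by move=> E _ mE; rewrite -(Radon_Nikodym_SigmaFinite.f_integral dom).
Qed.

Lemma integral_chi_squared s f c : unit_valued f ->
  (\int[chi_squared R s]_u (f (c + u))%:E = (gauss_chi s f c)%:E)%E.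
Proof.
move=> uf; have [mf f01] := uf.
have mfc b : measurable_fun [set: measurableTypeR R] (fun u : R => (f (b + u))%:E).
  by apply/measurable_EFinP; apply: measurableT_comp => //; exact: measurable_funD.
elim: s c => [|s IH] c.
  rewrite /= (integral_dirac _ measurableT (mfc c)).
  by rewrite diracT mul1e addr0.
have f0 (x : R) : (0 <= (f x)%:E)%E by rewrite lee_fin; have /andP[] := f01 x.
rewrite [chi_squared _ _]/= ge0_integral_distribution//.
rewrite [gauss_chi _ _ _]/= -integral_normal_prob//; last exact: unit_valued_gauss_chi_sqr.
under [RHS]eq_integral do rewrite -IH.
pose F (uy : measurableTypeR R * measurableTypeR R) : \bar R := (f (c + (uy.1 + uy.2 ^+ 2)))%:E.
have mF : measurable_fun setT F.
  exact: (measurableT_comp (mfc c) (@measurable_add_sqr R)).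
have F0 x : (0 <= F x)%E by exact: f0.
rewrite -[LHS]/(\int[_]_x F x)%E.
rewrite (@fubini_tonelli1 _ _ _ _ _ (chi_squared R s) (normal_prob (0 : R) 1) F mF F0).
rewrite (@fubini_tonelli _ _ _ _ _ (chi_squared R s) (normal_prob (0 : R) 1) F mF F0).
apply: eq_integral => y _; apply: eq_integral => u _.
by rewrite /F /=; congr (f _)%:E; ring.
Qed.

End chi_squared_limit.

Section radial_rademachers.
Context (R : realType) (J : finType).
Local Notation V := {ffun J -> R}.

Lemma rademacherC (a b : R) i j (F : V -> R) :
  rademacher a i (rademacher b j F) = rademacher b j (rademacher a i F).
Proof.
apply/funext => x; rewrite /rademacher.
rewrite ![x + coord i a + _]addrAC ![x - coord i a + _]addrAC.
by field.
Qed.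

Lemma rademachersC (a b : R) i l (F : V -> R) :
  rademacher a i (rademachers b l F) = rademachers b l (rademacher a i F).
Proof. by elim: l => //= j l <-; rewrite rademacherC. Qed.

(** Shifts along different coordinates commute, so n rounds through all coordinates may be regrouped
    as n steps along each one. *)
Lemma iter_rademachers_cons (a : R) j l n (F : V -> R) :
  iter n (rademachers a (j :: l)) F =
  iter n (rademacher a j) (iter n (rademachers a l) F).
Proof.
have comm m G : iter m (rademachers a l) (rademacher a j G) =
    rademacher a j (iter m (rademachers a l) G).
  by elim: m => //= m ->; rewrite rademachersC.
by elim: n F => // n IH F; rewrite !iterSr IH /= comm.
Qed.

Lemma iter_rademacher_coord (a : R) j n (F : V -> R) x y :
  iter n (rademacher a j) F (x + coord j y) =
  iter n (rademacher1 a) (fun y => F (x + coord j y)) y.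
Proof.
have cD b c : coord j (b + c) = coord j b + coord j c :> V.
  by apply/ffunP => i; rewrite !ffunE; case: eqP => // _; rewrite addr0.
have cN b : coord j (- b) = - coord j b :> V.
  by apply/ffunP => i; rewrite !ffunE; case: eqP => // _; rewrite oppr0.
elim: n y => //= n IH y.
by rewrite /rademacher /rademacher1 -!IH !cD cN !addrA.
Qed.

(** As x vanishes on the coordinates in l, each of them starts its own walk at 0 and then adds its
    square to the offset. *)
Lemma iter_rademachers_radial (a : R) l n f c (x : V) : uniq l ->
  (forall j, j \in l -> x j = 0) ->
  iter n (rademachers a l) (fun x => f (c + \sum_j x j ^+ 2)) x =
  rademacher_chi n a (size l) f (c + \sum_j x j ^+ 2).
Proof.
elim: l x => [|j l IH] x; first by elim: n => //= n ->.
move=> /= /andP[jl ul] x0; rewrite iter_rademachers_cons.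
have -> : x = x + coord j 0.
  by apply/ffunP => i; rewrite !ffunE if_same addr0.
rewrite iter_rademacher_coord; congr (iter n _ _ 0).
apply/funext => y; rewrite IH//.
  congr rademacher_chi; rewrite -addrA; congr (_ + _).
  rewrite (bigD1 j)//= [in RHS](bigD1 j)//= !ffunE eqxx x0 ?mem_head// !add0r !expr0n /= add0r addrC.
  congr (_ + _); apply: eq_bigr => i /negbTE ij; by rewrite !ffunE ij.
move=> i il; rewrite !ffunE x0 ?inE ?il ?orbT//.
by case: eqP => [ij|]; [move: jl; rewrite -ij il|rewrite addr0].
Qed.

End radial_rademachers.

(** * Logistic test functions *)

Section derivatives.
Context (R : realType).
Implicit Types f g : R -> R.

Lemma is_derive1D f g (x df dg : R) : is_derive x 1 f df -> is_derive x 1 g dg ->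
  is_derive x 1 (fun y => f y + g y) (df + dg).
Proof. by move=> hf hg; exact: (is_deriveD hf hg). Qed.

Lemma is_derive1M f g (x df dg : R) : is_derive x 1 f df -> is_derive x 1 g dg ->
  is_derive x 1 (fun y => f y * g y) (df * g x + f x * dg).
Proof.
move=> hf hg; apply: (is_derive_eq (is_deriveM hf hg)).
by rewrite -![_ *: _]/(_ * _); ring.
Qed.

Lemma is_derive1_cst (c x : R) : is_derive x 1 (fun=> c) 0.
Proof. exact: is_derive_cst. Qed.

Lemma mean_value_bound_on f f' (M : R) :
  (forall x : R, 0 <= x <= 1 -> is_derive x 1 f (f' x)) ->
  (forall x, 0 <= x <= 1 -> `|f' x| <= M) ->
  forall t, 0 <= t <= 1 -> `|f t - f 0| <= M.
Proof.
move=> df fM t /andP[t0 t1].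
have in01 x : x \in `[0, t] -> 0 <= x <= 1.
  by rewrite in_itv/= => /andP[-> /le_trans]; exact.
have [x||c] := @MVT_segment _ f f' 0 t t0.
- by move=> /subset_itv_oo_cc /in01; exact: df.
- by apply: derivable_within_continuous => x /in01 /df [].
move=> /[dup] /in01 c01; rewrite in_itv/= subr0 => /andP[c0 ct] ->.
rewrite normrM (ger0_norm t0); apply: le_trans (fM c c01).
by rewrite ler_piMr.
Qed.

Lemma mean_value_bound f f' (M : R) : (forall x : R, is_derive x 1 f (f' x)) ->
  (forall x, 0 <= x <= 1 -> `|f' x| <= M) ->
  forall t, 0 <= t <= 1 -> `|f t - f 0| <= M.
Proof. by move=> df; apply: mean_value_bound_on => x _. Qed.

(** Three applications of the mean value bound on [0, 1]; the factor 1/6 of Taylor's formula is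
    given up. *)
Lemma taylor_third_order f f1 f2 f3 (M : R) :
  (forall x : R, is_derive x 1 f (f1 x)) -> (forall x : R, is_derive x 1 f1 (f2 x)) ->
  (forall x : R, is_derive x 1 f2 (f3 x)) -> (forall x, `|f3 x| <= M) ->
  `|f 1 - f 0 - f1 0 - 2^-1 * f2 0| <= M.
Proof.
move=> d1 d2 d3 b.
have h2 t : 0 <= t <= 1 -> `|f2 t - f2 0| <= M by apply: (mean_value_bound d3).
have h1 t : 0 <= t <= 1 -> `|f1 t - f1 0 - t * f2 0| <= M.
  move=> t01.
  have D (x : R) : is_derive x 1 (fun t => f1 t + - f2 0 * t) (f2 x + - f2 0).
    apply: is_derive1D => //.
    by apply: is_derive_eq (is_derive1M (is_derive1_cst _ _) (is_derive_id _ _)) _; ring.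
  have := mean_value_bound D h2 t01.
  by congr (`|_| <= _); ring.
have D (x : R) : is_derive x 1 (fun t => f t + (- f1 0 * t + - (2^-1 * f2 0) * (t * t)))
    (f1 x - f1 0 - x * f2 0).
  have idx := is_derive_id x (1 : R).
  apply: is_derive_eq (is_derive1D (d1 x) (is_derive1D (is_derive1M (is_derive1_cst _ _) idx)
    (is_derive1M (is_derive1_cst _ _) (is_derive1M idx idx)))) _.
  by rewrite /=; field.
have h0 : 0 <= (1 : R) <= 1 by rewrite ler01 lexx.
have := mean_value_bound D h1 h0.
by congr (`|_| <= _); ring.
Qed.

End derivatives.

Section logistic.
Context (R : realType) (lam b : R).
Hypothesis lam_gt0 : 0 < lam.

(** A decreasing smooth step at b, which sharpens to the indicator of y <= b as lam grows. Its
    derivative is lam (f^2 - f), so each derivative is a polynomial in f carrying the factor f (1 -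
    f), named [logistic_var] below. *)
Definition logistic (y : R) : R := (1 + expR (lam * (y - b)))^-1.
Local Notation f := logistic.
Definition logistic1 (y : R) : R := lam * (f y * f y - f y).
Definition logistic2 (y : R) : R := lam * (2 * f y * logistic1 y - logistic1 y).
Definition logistic3 (y : R) : R :=
  lam * (2 * logistic1 y * logistic1 y + 2 * f y * logistic2 y - logistic2 y).

Lemma logistic_gt0 y : 0 < f y.
Proof. by rewrite invr_gt0 addr_gt0// expR_gt0. Qed.

Lemma logistic_lt1 y : f y < 1.
Proof. by rewrite invf_lt1 ?addr_gt0 ?expR_gt0// ltrDl expR_gt0. Qed.

Lemma is_derive_logistic (y : R) : is_derive y 1 f (logistic1 y).
Proof.
have E0 : 1 + expR (lam * (y - b)) != 0 by rewrite gt_eqF// addr_gt0// expR_gt0.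
have D : is_derive y 1 (fun y : R => 1 + expR (lam * (y - b))) (lam * expR (lam * (y - b))).
  have d1 : is_derive y 1 (fun y : R => lam * (y + - b)) lam.
    apply: is_derive_eq (is_derive1M (is_derive1_cst _ _)
      (is_derive1D (is_derive_id _ _) (is_derive1_cst _ _))) _; ring.
  have := @is_derive1_comp R expR (fun y => lam * (y - b)) y _ _ (is_derive_expR _) d1.
  move=> d2; apply: is_derive_eq (is_derive1D (is_derive1_cst 1 y) d2) _.
  by rewrite add0r mulrC.
have DV := @is_deriveV R (fun y => 1 + expR (lam * (y - b))) y _ _ E0 D.
apply: is_derive_eq DV _.
rewrite -[_ *: _]/(_ * _) /logistic1 /f.
by field.
Qed.

Lemma measurable_logistic : measurable_fun setT f.
Proof.
apply: continuous_measurable_fun => y; apply: differentiable_continuous.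
by apply/derivable1_diffP; have [] := is_derive_logistic y.
Qed.

Lemma is_derive_logistic1 (y : R) : is_derive y 1 logistic1 (logistic2 y).
Proof.
have d := is_derive_logistic y.
have d1 := is_derive1D (is_derive1M d d) (is_derive1M (is_derive1_cst (-1) y) d).
rewrite (_ : logistic1 = fun y => lam * (f y * f y + -1 * f y)); last first.
  by apply/funext => z; rewrite /logistic1 mulN1r.
apply: is_derive_eq (is_derive1M (is_derive1_cst lam y) d1) _.
by rewrite /logistic2; ring.
Qed.

Lemma is_derive_logistic2 (y : R) : is_derive y 1 logistic2 (logistic3 y).
Proof.
have d := is_derive_logistic y; have d' := is_derive_logistic1 y.
have d1 := is_derive1D (is_derive1M (is_derive1M (is_derive1_cst 2 y) d) d')
  (is_derive1M (is_derive1_cst (-1) y) d').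
rewrite (_ : logistic2 = fun y => lam * (2 * f y * logistic1 y + -1 * logistic1 y)); last first.
  by apply/funext => z; rewrite /logistic2 mulN1r.
apply: is_derive_eq (is_derive1M (is_derive1_cst lam y) d1) _.
by rewrite /logistic3; ring.
Qed.

Definition logistic_var (y : R) : R := f y * (1 - f y).

Lemma logistic_var_ge0 y : 0 <= logistic_var y.
Proof. by rewrite mulr_ge0// ltW ?logistic_gt0// subr_gt0 logistic_lt1. Qed.

Lemma logistic_var_le1 y : logistic_var y <= 1.
Proof.
have := logistic_gt0 y; have := logistic_lt1 y; rewrite /logistic_var; nra.
Qed.

Lemma logistic1_bound y : `|logistic1 y| <= lam * logistic_var y.
Proof.
have -> : logistic1 y = - (lam * logistic_var y) by rewrite /logistic1 /logistic_var; ring.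
by rewrite normrN ger0_norm// mulr_ge0 ?logistic_var_ge0// ltW.
Qed.

Lemma logistic2_bound y : `|logistic2 y| <= lam ^+ 2 * logistic_var y.
Proof.
have -> : logistic2 y = lam ^+ 2 * logistic_var y * (1 - 2 * f y).
  by rewrite /logistic2 /logistic1 /logistic_var; ring.
have c0 : 0 <= lam ^+ 2 * logistic_var y by rewrite mulr_ge0 ?sqr_ge0 ?logistic_var_ge0.
rewrite normrM (ger0_norm c0); apply: ler_piMr => //; rewrite ler_norml.
by have := logistic_gt0 y; have := logistic_lt1 y => ? ?; apply/andP; split; lra.
Qed.

Lemma logistic3_bound y : `|logistic3 y| <= lam ^+ 3 * logistic_var y.
Proof.
have -> : logistic3 y = lam ^+ 3 * logistic_var y * - (1 - 6 * f y + 6 * f y ^+ 2).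
  by rewrite /logistic3 /logistic2 /logistic1 /logistic_var; ring.
have l3 : 0 <= lam ^+ 3 by rewrite exprn_ge0// ltW.
have c0 : 0 <= lam ^+ 3 * logistic_var y by rewrite mulr_ge0 ?logistic_var_ge0.
rewrite normrM (ger0_norm c0); apply: ler_piMr => //; rewrite normrN ler_norml.
have := logistic_gt0 y; have := logistic_lt1 y => h0 h1.
by apply/andP; split; nra.
Qed.

(* The decay compensates the growth of the derivatives of c + |x|^2. *)
Lemma logistic_var_decay : exists2 K : R, 0 < K &
  forall y, 0 <= y -> logistic_var y * (1 + y) ^+ 3 <= K.
Proof.
(* Chosen so that 1 + y <= m (1 + lam y / 3) <= m expR (lam y / 3), whose cube is matched by the
   exponential decay of f. *)
pose m := Num.max 1 (3 / lam).
have m0 : 0 < m by rewrite lt_max ltr01.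
have m1 : 1 <= m by rewrite le_max lexx.
have m2 : 3 <= m * lam.
  by rewrite -ler_pdivrMr// le_max lexx orbT.
exists (m ^+ 3 * expR (lam * b)); first by rewrite mulr_gt0 ?expR_gt0// exprn_gt0.
move=> y y0.
have fe : f y <= expR (- (lam * (y - b))).
  rewrite expRN /f lef_pV2 ?posrE ?expR_gt0 ?addr_gt0 ?expR_gt0//.
  by rewrite lerDr.
have pe : logistic_var y <= expR (- (lam * (y - b))).
  apply: le_trans fe; have f0 := ltW (logistic_gt0 y).
  by rewrite /logistic_var ler_piMr// gerBl.
have ye : 1 + y <= m * expR (lam * y / 3).
  apply: le_trans (ler_wpM2l (ltW m0) (expR_ge1Dx _)); nra.
have ye3 : (1 + y) ^+ 3 <= m ^+ 3 * expR (lam * y).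
  have -> : expR (lam * y) = expR (lam * y / 3) ^+ 3.
    by rewrite -expRM_natl; congr expR; field.
  by rewrite -exprMn lerXn2r// nnegrE ?addr_ge0// mulr_ge0 ?expR_ge0// ltW.
apply: le_trans (ler_pM (logistic_var_ge0 y) _ pe ye3) _.
  by rewrite exprn_ge0// addr_ge0.
rewrite mulrCA -expRD le_eqVlt; apply/orP; left; apply/eqP; congr (_ * expR _); ring.
Qed.

End logistic.

Section logistic_test_functions.
Context (R : realType) (lam b : R).
Hypothesis lam_gt0 : 0 < lam.
Local Notation f := (logistic lam b).
Local Notation f1 := (logistic1 lam b).
Local Notation f2 := (logistic2 lam b).
Local Notation f3 := (logistic3 lam b).
Local Notation p := (logistic_var lam b).

Lemma is_derive_comp_at (h h' : R -> R) (q : R -> R) (dq t : R) :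
  (forall y : R, is_derive y 1 h (h' y)) -> is_derive t 1 q dq ->
  is_derive t 1 (fun t => h (q t)) (h' (q t) * dq).
Proof. by move=> hh hq; exact: (@is_derive1_comp R h q t _ _ (hh (q t)) hq). Qed.

(** Along a segment both a linear form and c + |x|^2 are polynomials q of degree at most 2 in the
    time t, so one chain rule serves both cases: the third derivative of f after q is f''' q'^3 + 3
    f'' q' q''. *)
Lemma logistic_line_bound (q0 q1 q2 M : R) (q := fun t => q0 + (t * q1 + t * t * q2))
  (q' := fun t => q1 + 2 * t * q2) :
  (forall t, p (q t) * (lam ^+ 3 * `|q' t| ^+ 3 + 3 * lam ^+ 2 * `|q' t| * `|2 * q2|) <= M) ->
  `|f (q0 + (q1 + q2)) - f q0 - f1 q0 * q1 - 2^-1 * (f2 q0 * q1 ^+ 2 + f1 q0 * (2 * q2))| <= M.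
Proof.
move=> bound.
have dq (t : R) : is_derive t 1 q (q' t).
  have it := is_derive_id t (1 : R).
  apply: is_derive_eq (is_derive1D (is_derive1_cst q0 t) (is_derive1D
    (is_derive1M it (is_derive1_cst q1 t)) (is_derive1M (is_derive1M it it) (is_derive1_cst q2 t)))) _.
  by rewrite /q'; ring.
have dq' (t : R) : is_derive t 1 q' (2 * q2).
  have it := is_derive_id t (1 : R).
  apply: is_derive_eq (is_derive1D (is_derive1_cst q1 t) (is_derive1M
    (is_derive1M (is_derive1_cst 2 t) it) (is_derive1_cst q2 t))) _.
  by ring.
have d1 (t : R) := is_derive_comp_at (is_derive_logistic lam b) (dq t).
have e1 (t : R) := is_derive_comp_at (is_derive_logistic1 lam b) (dq t).
have e2 (t : R) := is_derive_comp_at (is_derive_logistic2 lam b) (dq t).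
pose g2 t := f2 (q t) * q' t * q' t + f1 (q t) * (2 * q2).
have d2 (t : R) : is_derive t 1 (fun t => f1 (q t) * q' t) (g2 t).
  apply: is_derive_eq (is_derive1M (e1 t) (dq' t)) _; by rewrite /g2; ring.
pose g3 t := f3 (q t) * q' t * q' t * q' t + 3 * f2 (q t) * q' t * (2 * q2).
have d3 (t : R) : is_derive t 1 g2 (g3 t).
  apply: is_derive_eq (is_derive1D (is_derive1M (is_derive1M (e2 t) (dq' t)) (dq' t))
    (is_derive1M (e1 t) (is_derive1_cst (2 * q2) t))) _; by rewrite /g3; ring.
have b3 t : `|g3 t| <= M.
  have n2 := logistic2_bound lam b (q t); have n3 := logistic3_bound b lam_gt0 (q t).
  apply: le_trans (bound t); rewrite mulrDr /g3.
  move: (f3 (q t)) (f2 (q t)) n2 n3 => X Y n2 n3.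
  apply: le_trans (ler_normD _ _) _; apply: lerD.
    rewrite !normrM (_ : p (q t) * _ = lam ^+ 3 * p (q t) * (`|q' t| * `|q' t| * `|q' t|)); last by ring.
    rewrite (_ : `|X| * _ * _ * _ = `|X| * (`|q' t| * `|q' t| * `|q' t|)); last by ring.
    by apply: ler_pM => //; rewrite !mulr_ge0.
  rewrite (_ : p (q t) * _ = lam ^+ 2 * p (q t) * (3 * `|q' t| * `|2 * q2|)); last by ring.
  rewrite (_ : 3 * Y * q' t * (2 * q2) = Y * (3 * q' t * (2 * q2))); last by ring.
  by rewrite normrM; apply: ler_pM => //; rewrite !normrM (ger0_norm (ler0n _ 3)).
have := taylor_third_order d1 d2 d3 b3.
rewrite /g2 /q /q' !mul1r !mulr0 !mul0r !addr0.
by congr (`|_| <= _); ring.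
Qed.

Lemma logistic_linear_taylor2 : exists2 K : R, 0 <= K &
  exists F1 F2, taylor2 K (fun x : {ffun unit -> R} => f (x tt)) F1 F2.
Proof.
pose K := lam ^+ 2 + lam ^+ 3.
have l2 : 0 <= lam ^+ 2 by rewrite sqr_ge0.
have l3 : 0 <= lam ^+ 3 by rewrite exprn_ge0// ltW.
exists K; first by rewrite addr_ge0.
exists (fun _ x => f1 (x tt)), (fun _ _ x => f2 (x tt)).
have sumU (G : unit -> R) : \sum_j G j = G tt.
  by rewrite (bigD1 tt)//= big1 ?addr0// => -[].
have pw y : 0 <= p y <= 1 by rewrite logistic_var_ge0 logistic_var_le1.
split=> [x v|_ _ x|_ _ x v].
- rewrite /norm1 !sumU ffunE.
  have := @logistic_line_bound (x tt) (v tt) 0 (K * `|v tt| ^+ 3).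
  rewrite !mulr0 !addr0 -expr2; apply => t.
  have /andP[p0 p1] := pw (x tt + t * v tt).
  rewrite normr0 !mulr0 !addr0 mulrA ler_wpM2r ?exprn_ge0//.
  by apply: le_trans (ler_piMl l3 p1) _; rewrite lerDr.
- apply: le_trans (logistic2_bound lam b _) _.
  have /andP[p0 p1] := pw (x tt).
  by apply: le_trans (ler_piMr l2 p1) _; rewrite lerDl.
rewrite /norm1 sumU ffunE.
have D (t : R) : is_derive t 1 (fun t => f2 (x tt + t * v tt)) (f3 (x tt + t * v tt) * v tt).
  apply: is_derive_comp_at; first exact: is_derive_logistic2.
  apply: is_derive_eq (is_derive1D (is_derive1_cst _ _) (is_derive1M (is_derive_id _ _) (is_derive1_cst _ _))) _.
  by ring.
have h01 : 0 <= (1 : R) <= 1 by rewrite ler01 lexx.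
have := @mean_value_bound _ _ _ (K * `|v tt|) D _ 1 h01.
rewrite mul1r mul0r addr0; apply => t _; rewrite normrM ler_wpM2r//.
apply: le_trans (logistic3_bound b lam_gt0 _) _.
have /andP[p0 p1] := pw (x tt + t * v tt).
by apply: le_trans (ler_piMr l3 p1) _; rewrite lerDr.
Qed.

(** The constant must not depend on c, because averaging over earlier coordinates turns c into an
    arbitrary nonnegative number. Derivatives grow at most like the third power of 1 + q(x), which
    the decay of [logistic_var] absorbs. *)
Lemma logistic_radial_taylor2 (J : finType) : exists2 K : R, 0 <= K &
  forall c : R, 0 <= c ->
  exists F1 F2, taylor2 K (fun x : {ffun J -> R} => f (c + \sum_j x j ^+ 2)) F1 F2.
Proof.
have [K0 K0_gt0 hK0] := logistic_var_decay b lam_gt0.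
have l0 : 0 <= lam by rewrite ltW.
have l2 : 0 <= lam ^+ 2 by rewrite sqr_ge0.
have l3 : 0 <= lam ^+ 3 by rewrite exprn_ge0.
(* In the third derivative 8 is 2^3 and 12 is 3 * 2 * 2, from |q'| <= 2 |v| (1 + q) and |q''| <= 2
   |v|^2. The Lipschitz bound on the second derivatives yields the same two numbers, and 2 lam
   bounds their diagonal part. *)
pose K := K0 * (8 * lam ^+ 3 + 12 * lam ^+ 2 + 2 * lam).
exists K.
  apply: mulr_ge0; first exact: ltW.
  by apply: addr_ge0; [apply: addr_ge0|]; apply: mulr_ge0.
move=> c c0; pose q (x : {ffun J -> R}) := c + \sum_j x j ^+ 2.
have q_ge0 x : 0 <= q x by rewrite addr_ge0// sumr_ge0// => j _; exact: sqr_ge0.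
have coord_le (x : {ffun J -> R}) j : `|x j| <= 1 + q x.
  have h : x j ^+ 2 <= q x.
    rewrite /q (bigD1 j)//= addrCA lerDl addr_ge0// sumr_ge0// => i _; exact: sqr_ge0.
  rewrite ler_norml; have := sqr_ge0 (x j - 1); have := sqr_ge0 (x j + 1) => ? ?.
  by apply/andP; split; nra.
have pz (z : R) : 0 <= z -> [/\ p z <= K0, p z * (1 + z) <= K0, p z * (1 + z) ^+ 2 <= K0
    & p z * (1 + z) ^+ 3 <= K0].
  move=> z0; have h3 := hK0 z z0; have p0 := logistic_var_ge0 lam b z.
  have z1 : 1 <= 1 + z by rewrite lerDl.
  have e n m : (n <= m)%N -> p z * (1 + z) ^+ n <= p z * (1 + z) ^+ m.
    by move=> nm; apply: ler_wpM2l => //; exact: ler_weXn2l.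
  split=> //.
  - by have := e 0%N 3%N isT; rewrite expr0 mulr1 => /le_trans; exact.
  - by have := e 1%N 3%N isT; rewrite expr1 => /le_trans; exact.
  - by have := e 2%N 3%N isT => /le_trans; exact.
have vN (v : {ffun J -> R}) j : `|v j| <= norm1 v.
  by rewrite /norm1 (bigD1 j)//= lerDl sumr_ge0.
pose dir (x v : {ffun J -> R}) := \sum_j 2 * x j * v j.
pose sq (v : {ffun J -> R}) := \sum_j v j ^+ 2.
have sq_ge0 (v : {ffun J -> R}) : 0 <= sq v by rewrite sumr_ge0// => j _; exact: sqr_ge0.
have dir_le x v : `|dir x v| <= 2 * norm1 v * (1 + q x).
  apply: le_trans (ler_norm_sum _ _ _) _.
  rewrite -mulrA mulrCA mulr_suml; apply: le_trans (_ : \sum_j 2 * (`|v j| * (1 + q x)) <= _).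
    apply: ler_sum => j _; rewrite !normrM (ger0_norm (ler0n _ 2)) -mulrA ler_wpM2l// mulrC.
    by rewrite ler_wpM2l.
  by apply: ler_sum => j _; rewrite mulrCA.
have sq_le (v : {ffun J -> R}) : `|2 * sq v| <= 2 * norm1 v ^+ 2.
  rewrite ger0_norm ?mulr_ge0// ler_wpM2l// expr2 {2}/norm1 mulr_sumr /sq.
  apply: ler_sum => j _; rewrite -real_normK ?num_real// expr2.
  by apply: ler_wpM2r.
have qline (x v : {ffun J -> R}) (t : R) : q [ffun j => x j + t * v j] = q x + (t * dir x v + t * t * sq v).
  rewrite /q -addrA; congr (_ + _); rewrite /dir /sq !mulr_sumr -!big_split /=.
  by apply: eq_bigr => j _; rewrite ffunE; ring.
have q'line (x v : {ffun J -> R}) (t : R) : dir [ffun j => x j + t * v j] v = dir x v + 2 * t * sq v.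
  rewrite /dir /sq !mulr_sumr -!big_split /=.
  by apply: eq_bigr => j _; rewrite ffunE; ring.
exists (fun j x => f1 (q x) * (2 * x j)),
  (fun j l x => 4 * f2 (q x) * (x j * x l) + 2 * f1 (q x) * (j == l)%:R).
have N0 (v : {ffun J -> R}) : 0 <= norm1 v by exact: norm1_ge0.
split=> [x v|j l x|j l x v].
- have -> : \sum_j f1 (q x) * (2 * x j) * v j = f1 (q x) * dir x v.
    by rewrite mulr_sumr; apply: eq_bigr => j _; rewrite -mulrA.
  have -> : \sum_j \sum_l (4 * f2 (q x) * (x j * x l) + 2 * f1 (q x) * (j == l)%:R) * (v j * v l) =
      f2 (q x) * dir x v ^+ 2 + f1 (q x) * (2 * sq v).
    rewrite expr2 {1}/dir mulr_suml /sq !mulr_sumr -big_split /=; apply: eq_bigr => j _.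
    rewrite /dir !mulr_sumr -[X in _ + X](_ : \sum_l (l == j)%:R * (2 * f1 (q x) * (v l * v j)) = _); last first.
      rewrite (bigD1 j)//= eqxx mul1r big1 ?addr0; first by ring.
      by move=> l /negbTE ->; rewrite mul0r.
    rewrite -big_split /=; apply: eq_bigr => l _; rewrite eq_sym; ring.
  have -> : f (c + \sum_j (x + v) j ^+ 2) = f (q x + (dir x v + sq v)).
    have := qline x v 1; rewrite !mul1r => <-; rewrite /q; congr (f (_ + _)).
    by apply: eq_bigr => j _; rewrite !ffunE mul1r.
  apply: logistic_line_bound => t /=.
  rewrite -qline -q'line; set y := [ffun j => _]; set z := q y.
  have [k0 k1 k2 k3] := pz z (q_ge0 y); have p0 := logistic_var_ge0 lam b z.
  have d1 := dir_le y v; have s1 := sq_le v.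
  have d3 : `|dir y v| ^+ 3 <= (2 * norm1 v * (1 + z)) ^+ 3.
    by apply: lerXn2r; rewrite ?nnegrE// (le_trans _ d1).
  have d2 : `|dir y v| * `|2 * sq v| <= 2 * norm1 v * (1 + z) * (2 * norm1 v ^+ 2).
    exact: ler_pM.
  have A1 := ler_wpM2l (mulr_ge0 p0 l3) d3; have A2 := ler_wpM2l (mulr_ge0 p0 l2) d2.
  have n3 : 0 <= norm1 v ^+ 3 by rewrite exprn_ge0.
  have B1 := ler_wpM2l (mulr_ge0 l3 n3) k3; have B2 := ler_wpM2l (mulr_ge0 l2 n3) k1.
  have C1 : 0 <= K0 * lam * norm1 v ^+ 3 by rewrite !mulr_ge0// ltW.
  rewrite /K; move: (p z) (norm1 v) (`|dir y v|) (`|2 * sq v|) A1 A2 B1 B2 C1 => P N U W A1 A2 B1 B2 C1.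
  lra.
- have [k0 k1 k2 k3] := pz (q x) (q_ge0 x); have p0 := logistic_var_ge0 lam b (q x).
  have h2 := logistic2_bound lam b (q x); have h1 := logistic1_bound b lam_gt0 (q x).
  have E1 : `|x j| * `|x l| <= (1 + q x) ^+ 2 by rewrite expr2; apply: ler_pM.
  apply: le_trans (ler_normD _ _) _; apply: le_trans (_ : 4 * (lam ^+ 2 * K0) + 2 * (lam * K0) <= _).
    apply: lerD.
      rewrite -mulrA normrM (ger0_norm (ler0n _ 4)) ler_wpM2l//.
      move: (f2 (q x)) h2 => X h2; rewrite !normrM.
      apply: le_trans (ler_pM (normr_ge0 _) _ h2 E1) _; first by rewrite mulr_ge0.
      by rewrite -mulrA ler_wpM2l.
    rewrite -mulrA normrM (ger0_norm (ler0n _ 2)) ler_wpM2l//.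
    move: (f1 (q x)) h1 => X h1; rewrite normrM.
    apply: le_trans (ler_pM (normr_ge0 _) (normr_ge0 _) h1 (_ : _ <= 1)) _.
      by case: eqP => _; rewrite ?normr1 ?normr0.
    by rewrite mulr1 ler_wpM2l.
  have := mulr_ge0 (ltW K0_gt0) l2; have := mulr_ge0 (ltW K0_gt0) l3.
  by rewrite /K => ? ?; lra.
(* The Lipschitz bound comes from differentiating a second derivative along the segment from x to x
   + v. *)
pose y (t : R) : {ffun J -> R} := [ffun j => x j + t * v j].
have dy i (t : R) : is_derive t 1 (fun t => y t i) (v i).
  rewrite (_ : (fun t => y t i) = fun t => x i + t * v i); last by apply/funext => u; rewrite ffunE.
  apply: is_derive_eq (is_derive1D (is_derive1_cst _ _) (is_derive1M (is_derive_id _ _) (is_derive1_cst _ _))) _.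
  by ring.
have dq (t : R) : is_derive t 1 (fun t => q (y t)) (dir (y t) v).
  rewrite (_ : (fun t => q (y t)) = fun t => q x + (t * dir x v + t * t * sq v)); last first.
    by apply/funext => u; rewrite qline.
  have it := is_derive_id t (1 : R).
  apply: is_derive_eq (is_derive1D (is_derive1_cst _ t) (is_derive1D
    (is_derive1M it (is_derive1_cst _ t)) (is_derive1M (is_derive1M it it) (is_derive1_cst _ t)))) _.
  by rewrite q'line; ring.
pose dl : R := (j == l)%:R.
pose G t := 4 * f2 (q (y t)) * (y t j * y t l) + 2 * f1 (q (y t)) * dl.
pose G' t := 4 * (f3 (q (y t)) * dir (y t) v * (y t j * y t l))
   + 4 * (f2 (q (y t)) * (v j * y t l + y t j * v l)) + 2 * (f2 (q (y t)) * dir (y t) v * dl).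
have DG (t : R) : is_derive t 1 G (G' t).
  have e1 := is_derive_comp_at (is_derive_logistic1 lam b) (dq t).
  have e2 := is_derive_comp_at (is_derive_logistic2 lam b) (dq t).
  apply: is_derive_eq (is_derive1D (is_derive1M (is_derive1M (is_derive1_cst 4 t) e2)
    (is_derive1M (dy j t) (dy l t))) (is_derive1M (is_derive1M (is_derive1_cst 2 t) e1)
    (is_derive1_cst dl t))) _.
  by rewrite /G'; ring.
have h01 : 0 <= (1 : R) <= 1 by rewrite ler01 lexx.
have y1 : y 1 = x + v by apply/ffunP => i; rewrite !ffunE mul1r.
have y0 : y 0 = x by apply/ffunP => i; rewrite !ffunE mul0r addr0.
suff bd t : `|G' t| <= K * norm1 v.
  by have := mean_value_bound DG (fun t _ => bd t) h01; rewrite /G y1 y0.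
set Y := y t; set z := q Y.
have [k0 k1 k2 k3] := pz z (q_ge0 Y); have p0 := logistic_var_ge0 lam b z.
have h2 := logistic2_bound lam b z; have h3 := logistic3_bound b lam_gt0 z.
have z0 : 0 <= 1 + z by rewrite addr_ge0// /z.
have dl1 : `|dl| <= 1 by rewrite /dl; case: eqP => _; rewrite ?normr1 ?normr0.
have d1 := dir_le Y v; rewrite -/z in d1.
have T1 : `|f3 z * dir Y v * (Y j * Y l)| <= lam ^+ 3 * p z * (2 * norm1 v * (1 + z) * (1 + z) ^+ 2).
  move: (f3 z) h3 => X h3; rewrite -mulrA normrM; apply: ler_pM => //.
  rewrite normrM; apply: ler_pM => //; rewrite normrM expr2; exact: ler_pM.
have T2 : `|f2 z * (v j * Y l + Y j * v l)| <= lam ^+ 2 * p z * (2 * (norm1 v * (1 + z))).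
  move: (f2 z) h2 => X h2; rewrite normrM; apply: ler_pM => //.
  apply: le_trans (ler_normD _ _) _; rewrite !normrM mulr_natl mulr2n.
  by apply: lerD; [apply: ler_pM|rewrite mulrC; apply: ler_pM].
have T3 : `|f2 z * dir Y v * dl| <= lam ^+ 2 * p z * (2 * norm1 v * (1 + z)).
  move: (f2 z) h2 => X h2; rewrite -mulrA normrM; apply: ler_pM => //.
  by rewrite normrM -[leRHS]mulr1; apply: ler_pM.
have A1 := ler_wpM2l (mulr_ge0 l3 (N0 v)) k3; have A2 := ler_wpM2l (mulr_ge0 l2 (N0 v)) k1.
have C1 : 0 <= K0 * lam * norm1 v by rewrite !mulr_ge0// ltW.
rewrite /G' -/Y -/z /K; move: T1 T2 T3.
move: (f3 z * _ * _) (f2 z * (_ + _)) (f2 z * _ * _) => X1 X2 X3.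
move: (p z) (norm1 v) A1 A2 C1 => P N A1 A2 C1.
rewrite !ler_norml => /andP[? ?] /andP[? ?] /andP[? ?].
by apply/andP; split; lra.
Qed.

End logistic_test_functions.

(** * Limit laws along a finite chain *)

Section smooth_logistic.
Context (R : realType) (lam b : R).
Hypothesis lam_gt0 : 0 < lam.

Lemma sum_unit (G : unit -> R) : \sum_j G j = G tt.
Proof. by rewrite (bigD1 tt)//= big1 ?addr0// => -[]. Qed.

Lemma taylor1_of_taylor2 (K : R) F F1 F2 : taylor2 K F F1 F2 ->
  taylor1 K (fun y : R => F [ffun=> y]) (fun y => F1 tt [ffun=> y])
    (fun y => F2 tt tt [ffun=> y]).
Proof.
move=> [t _ _] x v; have := t [ffun=> x] [ffun=> v].
rewrite /norm1 !sum_unit !ffunE.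
have -> : [ffun=> x] + [ffun=> v] = [ffun=> x + v] :> {ffun unit -> R}.
  by apply/ffunP => i; rewrite !ffunE.
by congr (`|_| <= _); ring.
Qed.

Lemma unit_valued_logistic : unit_valued (logistic lam b).
Proof.
split; first exact: measurable_logistic.
by move=> z; rewrite !ltW ?logistic_gt0 ?logistic_lt1.
Qed.

Lemma smooth_logistic : exists2 K : R, 0 <= K & smooth K (logistic lam b) /\
  exists F1 F2, taylor2 K (fun x : {ffun unit -> R} => logistic lam b (x tt)) F1 F2.
Proof.
have [K K0 [F1 [F2 t]]] := logistic_linear_taylor2 b lam_gt0.
exists K => //; split; last by exists F1, F2.
split; first exact: unit_valued_logistic.
exists (fun y => F1 tt [ffun=> y]), (fun y => F2 tt tt [ffun=> y]).
have := taylor1_of_taylor2 t.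
by rewrite (_ : (fun y => _) = logistic lam b)//; apply/funext => y; rewrite ffunE.
Qed.

Lemma radially_smooth_logistic : exists2 K : R, 0 <= K & radially_smooth K (logistic lam b).
Proof.
have [K K0 h] := logistic_radial_taylor2 b lam_gt0 unit.
exists K => //; split; first exact: unit_valued_logistic.
move=> c c0; have [F1 [F2 t]] := h c c0.
split.
  have [mf f01] := unit_valued_logistic; split=> [|z]; last exact: f01.
  by apply: measurableT_comp => //; apply: measurable_funD => //; exact: measurable_funX.
exists (fun y => F1 tt [ffun=> y]), (fun y => F2 tt tt [ffun=> y]).
have := taylor1_of_taylor2 t.
rewrite (_ : (fun y => _) = fun y => logistic lam b (c + y ^+ 2))//.
by apply/funext => y; rewrite sum_unit ffunE.
Qed.

End smooth_logistic.

Section cvg_criterion.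
Context (R : realType).

Lemma cvg_inv_sqrt : ((Num.sqrt n.+1%:R)^-1 : R) @[n --> \oo] --> (0 : R).
Proof.
apply/cvgrPdist_le => e e0; near=> n.
rewrite sub0r normrN ger0_norm ?invr_ge0 ?sqrtr_ge0//.
rewrite -[leRHS]invrK lef_pV2 ?posrE ?invr_gt0 ?sqrtr_gt0//.
have -> : e^-1 = Num.sqrt (e^-1 ^+ 2) by rewrite sqrtr_sqr ger0_norm// invr_ge0 ltW.
apply: ler_wsqrtr.
apply: (@le_trans _ _ n%:R); last by rewrite ler_nat.
by near: n; exact: nbhs_infty_ger.
Unshelve. all: by end_near. Qed.

(** M may depend on e, as does the constant L of the Lindeberg comparison: e is fixed first, then n
    grows. *)
Lemma cvg_from_bound (u : nat -> R) (l K : R) : 0 <= K ->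
  (forall e, 0 < e -> exists M : R,
     forall n, `|u n.+1 - l| <= K * e + M * (Num.sqrt n.+1%:R)^-1) ->
  u @ \oo --> l.
Proof.
move=> K0 h; rewrite -cvg_shiftS; apply/cvgrPdist_le => e e0.
have e1 : 0 < e / (2 * (K + 1)) by rewrite divr_gt0// mulr_gt0// ltr_wpDl.
have [M hM] := h _ e1.
have Ke : K * (e / (2 * (K + 1))) <= e / 2.
  rewrite mulrA ler_pdivrMr ?mulr_gt0 ?ltr_wpDl//.
  have -> : e / 2 * (2 * (K + 1)) = e * (K + 1) by field.
  by rewrite mulrC ler_wpM2l ?(ltW e0)// lerDl.
have c : M * (Num.sqrt n.+1%:R)^-1 @[n --> \oo] --> (0 : R).
  by rewrite -(mulr0 M); apply: cvgMr; exact: cvg_inv_sqrt.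
have e2 : 0 < e / 2 by rewrite divr_gt0.
move/cvgrPdist_le : c => /(_ _ e2); apply: filterS => n.
rewrite sub0r normrN distrC => hn.
apply: le_trans (hM n) _.
have := le_trans (ler_norm _) hn; lra.
Qed.

End cvg_criterion.

Section chain_expectation.
Context (R : realType) (S C : finType) (Q : S -> C -> R) (nxt : S -> C -> S).

(** The mean over the next n letters, by recursion on the first one; [G] sees the word of letters,
    from which [path_sum] recovers the states. *)
Fixpoint expect (n : nat) (s : S) (G : seq C -> R) : R :=
  if n is n'.+1 then \sum_c Q s c * expect n' (nxt s c) (fun cs => G (c :: cs))
  else G [::].

Fixpoint path_sum (D : S -> C -> R) (s : S) (cs : seq C) : R :=
  if cs is c :: cs' then D s c + path_sum D (nxt s c) cs' else 0.

Lemma iter_walk_op_expect (J : finType) (D : S -> C -> J -> R) h n F s x :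
  iter n (walk_op Q nxt D h) (fun=> F) s x =
  expect n s (fun cs => F (x + [ffun j => h * path_sum (fun s c => D s c j) s cs])).
Proof.
elim: n s x => [|n IH] s x /=.
  by congr F; apply/ffunP => j; rewrite !ffunE mulr0 addr0.
rewrite /walk_op; apply: eq_bigr => c _; rewrite IH; congr (_ * expect n _ _).
apply/funext => cs; congr F; apply/ffunP => j.
by rewrite !ffunE mulrDr addrA.
Qed.

Hypothesis Q_ge0 : forall s c, 0 <= Q s c.
Hypothesis Q_sum1 : forall s, \sum_c Q s c = 1.

Lemma le_expect n s (G G' : seq C -> R) :
  (forall cs, size cs = n -> G cs <= G' cs) -> expect n s G <= expect n s G'.
Proof.
elim: n s G G' => [|n IH] s G G' h /=; first exact: h.
apply: ler_sum => c _; apply: ler_wpM2l => //; apply: IH => cs sz.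
by apply: h; rewrite /= sz.
Qed.

Lemma eq_expect n s (G G' : seq C -> R) :
  (forall cs, size cs = n -> G cs = G' cs) -> expect n s G = expect n s G'.
Proof.
by move=> h; apply/eqP; rewrite eq_le; apply/andP; split; apply: le_expect => cs /h ->.
Qed.

Lemma expectD n s (G G' : seq C -> R) :
  expect n s (fun cs => G cs + G' cs) = expect n s G + expect n s G'.
Proof.
elim: n s G G' => //= n IH s G G'; rewrite -big_split /=; apply: eq_bigr => c _.
by rewrite IH mulrDr.
Qed.

Lemma expectZ n s (a : R) (G : seq C -> R) :
  expect n s (fun cs => a * G cs) = a * expect n s G.
Proof.
elim: n s G => //= n IH s G; rewrite mulr_sumr; apply: eq_bigr => c _.
by rewrite IH mulrCA.
Qed.

Lemma expect_cst n s (a : R) : expect n s (fun=> a) = a.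
Proof. by elim: n s => //= n IH s; under eq_bigr do rewrite IH; rewrite -mulr_suml Q_sum1 mul1r. Qed.

Lemma expect_sum n s (I : Type) (r : seq I) (G : I -> seq C -> R) :
  expect n s (fun cs => \sum_(i <- r) G i cs) = \sum_(i <- r) expect n s (G i).
Proof.
elim: r => [|i r IH].
  by rewrite big_nil (@eq_expect n s _ (fun=> 0)) ?expect_cst// => cs _; rewrite big_nil.
by rewrite big_cons -IH -expectD; apply: eq_expect => cs _; rewrite big_cons.
Qed.

End chain_expectation.

Section chain_limits.
Context (R : realType) (S C : finType) (Q : S -> C -> R) (nxt : S -> C -> S).
Context (pi : S -> R).
Hypothesis Q_ge0 : forall s c, 0 <= Q s c.
Hypothesis Q_sum1 : forall s, \sum_c Q s c = 1.
Hypothesis pi_sum1 : \sum_s pi s = 1.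
Hypothesis mixing : forall g e, 0 < e ->
  exists n, forall s, `|iter n (markov_op Q nxt) g s - \sum_t pi t * g t| <= e.

Lemma sqrt_inv_facts n (h := (Num.sqrt n.+1%:R)^-1 : R) :
  [/\ 0 < h, h <= 1 & n.+1%:R * h ^+ 2 = 1].
Proof.
have n0 : 0 < n.+1%:R :> R by [].
split; first by rewrite invr_gt0 sqrtr_gt0.
  rewrite invf_le1 ?sqrtr_gt0// -[leLHS]sqrtr1; apply: ler_wsqrtr.
  by rewrite (@ler_nat _ 1 n.+1).
by rewrite exprVn sqr_sqrtr ?ltW// divff// gt_eqF.
Qed.

(** The Lindeberg comparison with a single coordinate leads to Rademacher steps of size kap / sqrt
    n, and [gaussian_clt] then to a Gaussian of deviation kap. For kap = 0 the Rademacher steps do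
    not move at all. *)
Lemma martingale_clt_logistic (D : S -> C -> R) (kap lam b : R) s :
  0 < lam -> 0 <= kap ->
  (forall s, \sum_c Q s c * D s c = 0) ->
  \sum_s pi s * (\sum_c Q s c * D s c ^+ 2) = kap ^+ 2 ->
  expect Q nxt n s (fun cs => logistic lam b ((Num.sqrt n%:R)^-1 * path_sum nxt D s cs))
    @[n --> \oo] --> (if kap == 0 then logistic lam b 0 else gauss_mean 0 kap (logistic lam b)).
Proof.
move=> lam0 kap0 mart var.
have [K K0 [sm [F1 [F2 t]]]] := smooth_logistic b lam0.
set l := (X in _ --> X).
apply: (@cvg_from_bound _ _ _ K) => // e e0.
have mart' s' (j : unit) : \sum_c Q s' c * D s' c = 0 by [].
have var' (i j : unit) : \sum_s pi s * (\sum_c Q s c * (D s c * D s c)) = kap ^+ 2 * (i == j)%:R.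
  by case: i; case: j; rewrite eqxx mulr1 -var.
have [L L0 hL] := lindeberg_comparison (D := fun s c (_ : unit) => D s c) Q_ge0 Q_sum1
  pi_sum1 mixing mart' kap0 var' e0.
exists (K * L + K * L * 2 + 59 * K * kap ^+ 3) => n.
have [h0 h1 nh] := sqrt_inv_facts n.
move: (hL n.+1 _ K _ _ _ s 0 (ltW h0) K0 t); rewrite iter_walk_op_expect.
set h := (Num.sqrt n.+1%:R)^-1 in h0 h1 nh *.
rewrite (@eq_expect _ _ _ _ _ Q_ge0 n.+1 s _ (fun cs => logistic lam b (h * path_sum nxt D s cs))); last first.
  by move=> cs _; rewrite !ffunE add0r.
set E := expect _ _ _ _ _.
have -> : enum (Finite.clone _ unit) = [:: tt] by rewrite enumT unlock.
have -> : (0 : {ffun unit -> R}) = 0 + coord tt 0.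
  by apply/ffunP => i; rewrite !ffunE /= ?if_same addr0.
rewrite -[rademachers _ _]/(rademacher (kap * h) tt) iter_rademacher_coord.
rewrite (_ : (fun y => _) = logistic lam b); last first.
  by apply/funext => y; rewrite !ffunE eqxx add0r.
set W := iter _ _ _ _ => B1.
have B2 : `|W - l| <= 59 * K * kap ^+ 3 * h.
  rewrite /l; case: (eqVneq kap 0) => [k0|kn0].
    have -> : W = logistic lam b 0.
      rewrite /W k0 mul0r (_ : iter _ _ _ = logistic lam b)//; elim: n.+1 => //= m ->.
      by apply/funext => y; rewrite /rademacher1 subr0 addr0; field.
    by rewrite subrr normr0 !mulr_ge0// ?exprn_ge0// ltW.
  have kp : 0 < kap by rewrite lt_def kn0.
  have := gaussian_clt n (mulr_gt0 kp h0) K0 sm; rewrite -/W.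
  have -> : kap * h * Num.sqrt n.+1%:R = kap.
    by rewrite -mulrA mulVf ?mulr1// gt_eqF// sqrtr_gt0.
  have -> : n.+1%:R * (59 * K * (kap * h) ^+ 3) = 59 * K * kap ^+ 3 * h * (n.+1%:R * h ^+ 2).
    by move: (n.+1%:R : R) => N; ring.
  by rewrite nh mulr1.
have B1' : `|E - W| <= K * e + (K * L + K * L * 2) * h.
  apply: le_trans B1 _.
  rewrite (_ : n.+1%:R * _ = n.+1%:R * h ^+ 2 * (e + L * h)); last by rewrite mulrA.
  rewrite nh mul1r.
  have h2 : h ^+ 2 * (1 + h) <= 2 * h.
    by rewrite [leRHS]mulrC expr2 -mulrA; apply: ler_wpM2l; [exact: ltW|nra].
  have := ler_wpM2l (mulr_ge0 K0 L0) h2; lra.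
move: B1' B2; rewrite !ler_norml => /andP[? ?] /andP[? ?].
by apply/andP; split; lra.
Qed.

Lemma martingale_chi_squared_logistic (J : finType) (D : S -> C -> J -> R) (lam b : R) s :
  0 < lam ->
  (forall s j, \sum_c Q s c * D s c j = 0) ->
  (forall i j, \sum_s pi s * (\sum_c Q s c * (D s c i * D s c j)) = (i == j)%:R) ->
  expect Q nxt n s (fun cs => logistic lam b
     (\sum_j ((Num.sqrt n%:R)^-1 * path_sum nxt (fun s c => D s c j) s cs) ^+ 2))
    @[n --> \oo] --> gauss_chi #|J| (logistic lam b) 0.
Proof.
move=> lam0 mart var.
have [K' K'0 rs] := radially_smooth_logistic b lam0.
have [K K0 hK] := logistic_radial_taylor2 b lam0 J.
have [F1 [F2 t]] := hK 0 (lexx 0).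
set l := (X in _ --> X).
apply: (@cvg_from_bound _ _ _ K) => // e e0.
have var' i j : \sum_s pi s * (\sum_c Q s c * (D s c i * D s c j)) = 1 ^+ 2 * (i == j)%:R.
  by rewrite expr1n mul1r.
have [L L0 hL] := lindeberg_comparison Q_ge0 Q_sum1 pi_sum1 mixing mart ler01 var' e0.
exists (K * L + K * L * 2 + #|J|%:R * (59 * K')) => n.
have [h0 h1 nh] := sqrt_inv_facts n.
move: (hL n.+1 _ K _ _ _ s 0 (ltW h0) K0 t); rewrite iter_walk_op_expect mul1r.
set h := (Num.sqrt n.+1%:R)^-1 in h0 h1 nh *.
rewrite (@eq_expect _ _ _ _ _ Q_ge0 n.+1 s _ (fun cs => logistic lam b
   (\sum_j (h * path_sum nxt (fun s c => D s c j) s cs) ^+ 2))); last first.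
  by move=> cs _; rewrite add0r; congr logistic; apply: eq_bigr => j _; rewrite !ffunE add0r.
set E := expect _ _ _ _ _.
rewrite iter_rademachers_radial ?enum_uniq//; last by move=> j _; rewrite ffunE.
rewrite big1 ?addr0 => [|j _]; last by rewrite ffunE expr0n.
rewrite -cardE; set W := rademacher_chi _ _ _ _ _ => B1.
have B2 : `|W - l| <= #|J|%:R * (59 * K') * h.
  by rewrite -mulrA; exact: rademacher_chi_gauss_chi.
have B1' : `|E - W| <= K * e + (K * L + K * L * 2) * h.
  apply: le_trans B1 _.
  rewrite (_ : n.+1%:R * _ = n.+1%:R * h ^+ 2 * (e + L * h)); last by rewrite mulrA.
  rewrite nh mul1r.
  have h2 : h ^+ 2 * (1 + h) <= 2 * h.
    by rewrite [leRHS]mulrC expr2 -mulrA; apply: ler_wpM2l; [exact: ltW|nra].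
  have := ler_wpM2l (mulr_ge0 K0 L0) h2; lra.
move: B1' B2; move: (#|J|%:R : R) => N; rewrite !ler_norml => /andP[? ?] /andP[? ?].
by apply/andP; split; lra.
Qed.

End chain_limits.

(** * From logistic means to distribution functions *)

Section logistic_to_cdf.
Context (R : realType).

Lemma logistic_ge (lam b d y : R) : 0 < lam -> y <= b - d ->
  1 - expR (- (lam * d)) <= logistic lam b y.
Proof.
move=> lam0 yb; rewrite /logistic.
have le : expR (lam * (y - b)) <= expR (- (lam * d)).
  by rewrite ler_expR -mulrN ler_pM2l//; lra.
set X := expR (lam * (y - b)) in le *; have X0 : 0 < X by exact: expR_gt0.
rewrite -div1r ler_pdivlMr ?addr_gt0//.
set Y := expR _ in le *; nra.
Qed.

Lemma logistic_le (lam b d y : R) : 0 < lam -> b + d <= y ->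
  logistic lam b y <= expR (- (lam * d)).
Proof.
move=> lam0 yb; rewrite /logistic expRN lef_pV2 ?posrE ?expR_gt0 ?addr_gt0 ?expR_gt0//.
rewrite (@le_trans _ _ (expR (lam * (y - b))))//; last by rewrite lerDr.
by rewrite ler_expR ler_pM2l//; lra.
Qed.

Section criterion.
Context (mu : probability (measurableTypeR R) R) (x : R).
Local Notation F y := (fine (mu `]-oo, y]%classic)).

Let muF (y : R) : mu `]-oo, y]%classic = (F y)%:E.
Proof. by rewrite fineK// fin_num_measure. Qed.

Let int_logistic (lam b : R) (m : R) :=
  (\int[mu]_z (logistic lam b z)%:E = m%:E)%E.

Let mlog lam b : measurable_fun [set: measurableTypeR R] (fun z => (logistic lam b z)%:E).
Proof. by apply/measurable_EFinP; exact: measurable_logistic. Qed.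

Let int_cst (a : R) : (\int[mu]_(z in setT) a%:E = a%:E)%E.
Proof.
rewrite integral_cst//; transitivity (a%:E * 1)%E; last by rewrite mule1.
by congr (_ * _)%E; exact: (probability_setT mu).
Qed.

Let int_indic (A : set (measurableTypeR R)) : measurable A ->
  mu A = (\int[mu]_(z in setT) (\1_A z)%:E)%E.
Proof. by move=> mA; rewrite integral_indic// setIT. Qed.

Lemma integral_logistic_le (lam b d m : R) : 0 < lam -> 0 <= d -> int_logistic lam b m ->
  m <= F (b + d) + expR (- (lam * d)).
Proof.
move=> lam0 d0 im; rewrite -lee_fin -im EFinD -muF.
pose A := `]-oo, b + d]%classic : set (measurableTypeR R).
have mA : measurable A by exact: measurable_itv.
have -> : (expR (- (lam * d)))%:E = (\int[mu]_(z in setT) (expR (- (lam * d)))%:E)%E.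
  by rewrite int_cst.
rewrite int_indic// -ge0_integralD//; first last.
- by apply/measurable_EFinP; exact: measurable_indic.
apply: ge0_le_integral => //.
- by move=> z _; rewrite lee_fin ltW ?logistic_gt0.
- apply: emeasurable_funD; first by apply/measurable_EFinP; exact: measurable_indic.
  exact: measurable_cst.
move=> z _; rewrite -EFinD lee_fin indicE.
have [|zA] := boolP (z \in A) => /=.
  by move=> _; rewrite (le_trans (ltW (logistic_lt1 _ _ _)))// lerDl expR_ge0.
rewrite add0r; apply: logistic_le => //.
move: zA; rewrite notin_setE /A /= in_itv/= => /negP; rewrite -ltNge; exact: ltW.
Qed.

Lemma integral_logistic_ge (lam b d m : R) : 0 < lam -> 0 <= d -> int_logistic lam b m ->
  F (b - d) <= m + expR (- (lam * d)).
Proof.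
move=> lam0 d0 im; rewrite -lee_fin EFinD -im -muF.
pose A := `]-oo, b - d]%classic : set (measurableTypeR R).
have mA : measurable A by exact: measurable_itv.
have -> : (expR (- (lam * d)))%:E = (\int[mu]_(z in setT) (expR (- (lam * d)))%:E)%E.
  by rewrite int_cst.
rewrite int_indic// -ge0_integralD//; first last.
- by move=> z _; rewrite lee_fin ltW ?logistic_gt0.
apply: ge0_le_integral => //.
- by apply/measurable_EFinP; exact: measurable_indic.
- by apply: emeasurable_funD => //; exact: measurable_cst.
move=> z _; rewrite -EFinD lee_fin indicE.
have [|zA] := boolP (z \in A) => /=.
  rewrite inE /A /= in_itv/= => zb.
  by have := logistic_ge lam0 zb; lra.
by rewrite addr_ge0 ?expR_ge0// ltW// logistic_gt0.
Qed.

(** The indicator of y <= x lies between logistic functions centred at x - dd and x + dd, up to expR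
    (- lam dd). The same sandwich under mu compares their limits with the distribution function at x
    - 2 dd and x + 2 dd, where continuity applies. *)
Lemma cvg_cdf_of_logistic (E : nat -> (R -> R) -> R) (m : R -> R -> R) :
  (forall n g g', (forall y, g y <= g' y) -> E n g <= E n g') ->
  (forall n g a, E n (fun y => g y + a) = E n g + a) ->
  (forall lam b, 0 < lam -> int_logistic lam b (m lam b)) ->
  (forall lam b, 0 < lam -> E n (logistic lam b) @[n --> \oo] --> m lam b) ->
  {for x, continuous (fun y : R => mu `]-oo, y]%classic)} ->
  E n (fun y => (y <= x)%R%:R) @[n --> \oo] --> F x.
Proof.
move=> mono shift im cvgE cont.
apply/cvgrPdist_le => e e0.
have contF : {for x, continuous (fun y => F y)}.
  apply: fine_cvg.
  move: cont; rewrite /prop_for /continuous_at muF; apply.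
have e8 : 0 < e / 8 by rewrite divr_gt0.
have /cvgrPdist_le/(_ _ e8)[d /= d0 hd] := contF.
pose dd := d / 4.
have dd0 : 0 < dd by rewrite divr_gt0.
have near_x y : `|x - y| <= 2 * dd -> `|F x - F y| <= e / 8.
  move=> xy; apply: hd; rewrite /ball /=.
  by apply: le_lt_trans xy _; rewrite /dd; lra.
(* Then lam dd = 8 / e, and expR (8 / e) >= 8 / e makes the tail at most e / 8. *)
pose lam := ((e / 8)^-1) / dd.
have lam0 : 0 < lam by rewrite divr_gt0// invr_gt0.
have ex : expR (- (lam * dd)) <= e / 8.
  have -> : lam * dd = (e / 8)^-1 by rewrite /lam -mulrA mulVf ?mulr1// gt_eqF.
  rewrite expRN -[leRHS]invrK lef_pV2 ?posrE ?expR_gt0 ?invr_gt0//.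
  by apply: le_trans (expR_ge1Dx _); rewrite lerDr.
have /cvgrPdist_le/(_ _ e8) c1 := cvgE lam (x + dd) lam0.
have /cvgrPdist_le/(_ _ e8) c2 := cvgE lam (x - dd) lam0.
near=> n.
have n1 : `|m lam (x + dd) - E n (logistic lam (x + dd))| <= e / 8 by near: n.
have n2 : `|m lam (x - dd) - E n (logistic lam (x - dd))| <= e / 8 by near: n.
have u1 : E n (fun y => (y <= x)%R%:R) <= E n (logistic lam (x + dd)) + expR (- (lam * dd)).
  rewrite -shift; apply: mono => y; have [yx|_] := leP y x; last first.
    by rewrite addr_ge0 ?expR_ge0// ltW// logistic_gt0.
  have yx' : y <= x + dd - dd by rewrite addrK.
  by have := logistic_ge lam0 yx' => /=; lra.
have u2 : E n (logistic lam (x - dd)) <= E n (fun y => (y <= x)%R%:R) + expR (- (lam * dd)).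
  rewrite -shift; apply: mono => y; have [_|yx] := leP y x.
    by rewrite (le_trans (ltW (logistic_lt1 _ _ _)))// lerDl expR_ge0.
  by rewrite add0r; apply: logistic_le => //; rewrite subrK ltW.
have i1 := integral_logistic_le lam0 (ltW dd0) (im _ (x + dd) lam0).
have i2 := integral_logistic_ge lam0 (ltW dd0) (im _ (x - dd) lam0).
have f1 : `|F x - F (x + dd + dd)| <= e / 8.
  by apply: near_x; rewrite -addrA opprD addrA subrr add0r normrN ger0_norm; lra.
have f2 : `|F x - F (x - dd - dd)| <= e / 8.
  by apply: near_x; rewrite -addrA !opprD !opprK addrA subrr add0r ger0_norm; lra.
move: n1 n2 f1 f2; rewrite !ler_norml => /andP[? ?] /andP[? ?] /andP[? ?] /andP[? ?].
by apply/andP; split; lra.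
Unshelve. all: by end_near. Qed.

End criterion.
End logistic_to_cdf.

Lemma logistic_lipschitz (R : realType) (lam b x y : R) : 0 < lam ->
  `|logistic lam b x - logistic lam b y| <= lam * `|x - y|.
Proof.
move=> lam0.
have D (t : R) : is_derive t 1 (fun t => logistic lam b (y + t * (x - y)))
    (logistic1 lam b (y + t * (x - y)) * (x - y)).
  apply: is_derive_comp_at; first exact: is_derive_logistic.
  apply: is_derive_eq (is_derive1D (is_derive1_cst _ _)
    (is_derive1M (is_derive_id _ _) (is_derive1_cst _ _))) _.
  by ring.
have h01 : 0 <= (1 : R) <= 1 by rewrite ler01 lexx.
have := @mean_value_bound _ _ _ (lam * `|x - y|) D _ 1 h01.
rewrite mul1r mul0r addr0 subrKC; apply => t _; rewrite normrM ler_wpM2r//.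
apply: le_trans (logistic1_bound b lam0 _) _.
by rewrite ler_piMr ?(ltW lam0)// logistic_var_le1.
Qed.

Section slutsky.
Context (R : realType) (S C : finType) (Q : S -> C -> R) (nxt : S -> C -> S).
Hypothesis Q_ge0 : forall s c, 0 <= Q s c.
Hypothesis Q_sum1 : forall s, \sum_c Q s c = 1.
Context (s : S) (T W : nat -> seq C -> R).
Local Notation expect n G := (expect Q nxt n s G).

Lemma expect_dist n (G G' H : seq C -> R) :
  (forall cs, size cs = n -> `|G cs - G' cs| <= H cs) ->
  `|expect n G - expect n G'| <= expect n H.
Proof.
move=> h; rewrite ler_norml; apply/andP; split.
  rewrite lerBrDr addrC lerBlDr addrC -expectD; apply: le_expect => // cs /h.
  by rewrite ler_norml => /andP[? ?]; lra.
rewrite lerBlDr -expectD; apply: le_expect => // cs /h.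
by rewrite ler_norml => /andP[? ?]; lra.
Qed.

(** Where T and W are within e / (3 lam) of each other, the Lipschitz bound costs e / 3; elsewhere
    two values in [0, 1] differ by at most 1, on an event of probability at most e / 3. *)
Lemma slutsky_logistic (lam b m : R) : 0 < lam ->
  expect n (fun cs => logistic lam b (W n cs)) @[n --> \oo] --> m ->
  (forall d e, 0 < d -> 0 < e ->
    \forall n \near \oo, expect n (fun cs => (d < `|T n cs - W n cs|)%R%:R) <= e) ->
  expect n (fun cs => logistic lam b (T n cs)) @[n --> \oo] --> m.
Proof.
move=> lam0 cvgW close; apply/cvgrPdist_le => e e0.
have e3 : 0 < e / 3 by rewrite divr_gt0.
have d0 : 0 < e / 3 / lam by rewrite divr_gt0.
have /cvgrPdist_le/(_ _ e3) c1 := cvgW; have c2 := close _ _ d0 e3.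
near=> n.
have h1 : `|m - expect n (fun cs => logistic lam b (W n cs))| <= e / 3 by near: n.
have h2 : expect n (fun cs => (e / 3 / lam < `|T n cs - W n cs|)%R%:R) <= e / 3 by near: n.
have h3 : `|expect n (fun cs => logistic lam b (T n cs)) - expect n (fun cs => logistic lam b (W n cs))|
    <= expect n (fun cs => e / 3 + (e / 3 / lam < `|T n cs - W n cs|)%R%:R).
  apply: expect_dist => cs _; have [tw|tw] := ltP.
    have f0 := logistic_gt0 lam b; have f1 := logistic_lt1 lam b.
    have := f0 (T n cs); have := f1 (T n cs); have := f0 (W n cs); have := f1 (W n cs).
    by move=> ? ? ? ?; rewrite ler_norml; apply/andP; split => /=; lra.
  rewrite /= addr0; apply: le_trans (logistic_lipschitz b _ _ lam0) _.
  by rewrite mulrC -ler_pdivlMr.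
rewrite expectD// expect_cst// in h3.
move: h1 h3; rewrite !ler_norml => /andP[? ?] /andP[? ?].
by apply/andP; split; lra.
Unshelve. all: by end_near. Qed.

Lemma cvg_cdf_expect (mu : probability (measurableTypeR R) R) (m : R -> R -> R) :
  (forall lam b, 0 < lam -> (\int[mu]_z (logistic lam b z)%:E = (m lam b)%:E)%E) ->
  (forall lam b, 0 < lam ->
    expect n (fun cs => logistic lam b (W n cs)) @[n --> \oo] --> m lam b) ->
  (forall d e, 0 < d -> 0 < e ->
    \forall n \near \oo, expect n (fun cs => (d < `|T n cs - W n cs|)%R%:R) <= e) ->
  forall x, {for x, continuous (fun y : R => mu `]-oo, y]%classic)} ->
  expect n (fun cs => (T n cs <= x)%R%:R) @[n --> \oo] --> fine (mu `]-oo, x]%classic).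
Proof.
move=> im cvgW close x cont.
apply: (@cvg_cdf_of_logistic R mu x (fun n g => expect n (fun cs => g (T n cs))) m) => //.
- by move=> n g g' gg'; apply: le_expect.
- by move=> n g a; rewrite expectD// expect_cst.
by move=> lam b lam0; apply: slutsky_logistic => //; exact: cvgW.
Qed.

End slutsky.

(** * Moments of additive functionals of the chain *)

Section additive_functionals.
Context (R : realType) (S C : finType) (Q : S -> C -> R) (nxt : S -> C -> S).
Context (pi : S -> R) (k : nat) (q0 : R).
Hypothesis Q_ge0 : forall s c, 0 <= Q s c.
Hypothesis Q_sum1 : forall s, \sum_c Q s c = 1.
Hypothesis pi_ge0 : forall s, 0 <= pi s.
Hypothesis pi_sum1 : \sum_s pi s = 1.
Hypothesis pi_inv : forall g, \sum_s pi s * markov_op Q nxt g s = \sum_s pi s * g s.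
Hypothesis q0_gt0 : 0 < q0.
Hypothesis Q_ge : forall s c, q0 <= Q s c.
Hypothesis reach : forall s t, exists2 cs, size cs = k & foldl nxt s cs = t.
Local Notation path_sum := (path_sum nxt).
Local Notation expect := (expect Q nxt).
Local Notation q := (markov_op Q nxt).

Definition stat_mean (l : S -> C -> R) : R := \sum_s pi s * \sum_c Q s c * l s c.

Lemma finite_bound (g : S -> R) : exists2 B : R, 0 <= B & forall s, `|g s| <= B.
Proof.
exists (\sum_s `|g s|); first exact: sumr_ge0.
by move=> s; rewrite (bigD1 s)//= lerDl sumr_ge0.
Qed.

Lemma martingale_decomposition (l : S -> C -> R) : exists D : S -> C -> R,
  (forall s, \sum_c Q s c * D s c = 0) /\
  exists2 B : R, 0 <= B & forall s cs,
    `|path_sum l s cs - (size cs)%:R * stat_mean l - path_sum D s cs| <= B.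
Proof.
have [phi hphi] := poisson_equation Q_ge0 Q_sum1 pi_ge0 pi_sum1 pi_inv q0_gt0 Q_ge reach
  (fun s => \sum_c Q s c * l s c).
(* The increments of phi telescope, leaving its values at the two ends of the path. *)
exists (fun s c => l s c - stat_mean l + phi (nxt s c) - phi s); split.
  move=> s; have := hphi s; rewrite -/(stat_mean l) /markov_op => e.
  under eq_bigr do rewrite !mulrDr !mulrN.
  rewrite !big_split /= !sumrN -!mulr_suml Q_sum1; lra.
have [B B0 hB] := finite_bound phi.
exists (2 * B); first by rewrite mulr_ge0.
move=> s cs.
have -> : path_sum l s cs - (size cs)%:R * stat_mean l
    - path_sum (fun s c => l s c - stat_mean l + phi (nxt s c) - phi s) s cs =
    phi s - phi (foldl nxt s cs).
  elim: cs s => [|c cs IH] s /=; first by rewrite mul0r !subr0 subrr.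
  have := IH (nxt s c); rewrite -natr1.
  by move: (size cs)%:R => N; lra.
apply: le_trans (ler_normB _ _) _.
by have := hB s; have := hB (foldl nxt s cs); lra.
Qed.

Section martingale.
Variable D : S -> C -> R.
Hypothesis D_mart : forall s, \sum_c Q s c * D s c = 0.

Lemma expect_martingale n s : expect n s (path_sum D s) = 0.
Proof.
elim: n s => //= n IH s.
under eq_bigr do rewrite (expectD Q nxt n _ (fun=> _)) expect_cst// IH addr0.
exact: D_mart.
Qed.

(** The conditional variance of an increment is a function of the state. Its Poisson solution psi
    gives an exact formula for the second moment, n times the stationary variance plus psi s minus
    the n-step mean of psi, whose last two terms stay bounded. *)
Lemma expect_martingale_sqr : exists2 B : R, 0 <= B & forall n s,
  `|expect n s (fun cs => path_sum D s cs ^+ 2)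
    - n%:R * stat_mean (fun s c => D s c ^+ 2)| <= B.
Proof.
pose G s := \sum_c Q s c * D s c ^+ 2.
have [psi hpsi] := poisson_equation Q_ge0 Q_sum1 pi_ge0 pi_sum1 pi_inv q0_gt0 Q_ge reach G.
have [B B0 hB] := finite_bound psi.
exists (2 * B); first by rewrite mulr_ge0.
move=> n s.
have E : expect n s (fun cs => path_sum D s cs ^+ 2) =
    n%:R * stat_mean (fun s c => D s c ^+ 2) + psi s - iter n q psi s.
  elim: n s => [|n IH] s; first by rewrite /= expr0n mul0r add0r subrr.
  rewrite /=.
  have step c : expect n (nxt s c) (fun cs => (D s c + path_sum D (nxt s c) cs) ^+ 2) =
      D s c ^+ 2 + (n%:R * stat_mean (fun s c => D s c ^+ 2) + psi (nxt s c) - iter n q psi (nxt s c)).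
    rewrite -IH -[X in _ = X + _](expect_cst nxt Q_sum1 n (nxt s c)).
    (* The cross term is subtracted as a multiple of the mean of the remaining martingale, which is
       0. *)
    rewrite -[LHS]subr0 -(mulr0 (2 * D s c)) -(expect_martingale n (nxt s c)).
    rewrite -expectD -expectZ; apply/eqP; rewrite subr_eq -expectD; apply/eqP.
    by apply: eq_expect => // cs _; ring.
  under eq_bigr do rewrite step.
  under eq_bigr do rewrite 2!mulrDr mulrN [Q _ _ * (_ + _)]mulrDr.
  rewrite !big_split /= sumrN -/(G s) -mulr_suml Q_sum1 -/(markov_op Q nxt psi s)
    -/(markov_op Q nxt (iter n q psi) s).
  have := hpsi s; rewrite -/(stat_mean (fun s c => D s c ^+ 2)) -natr1.
  by move: (n%:R : R) => N; lra.
rewrite E.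
have -> : n%:R * stat_mean (fun s c => D s c ^+ 2) + psi s - iter n q psi s -
    n%:R * stat_mean (fun s c => D s c ^+ 2) = psi s - iter n q psi s by ring.
have hi : `|iter n q psi s| <= B.
  have lo := @iter_markov_op_le _ _ _ _ nxt Q_ge0 n (fun=> - B) psi.
  have hi := @iter_markov_op_le _ _ _ _ nxt Q_ge0 n psi (fun=> B).
  rewrite iter_markov_op_cst// in lo; rewrite iter_markov_op_cst// in hi.
  rewrite ler_norml lo ?hi// => t; by have := hB t; rewrite ler_norml => /andP[].
apply: le_trans (ler_normB _ _) _; have := hB s; lra.
Qed.

End martingale.

Lemma expect_additive_sqr_le (l : S -> C -> R) : exists2 K : R, 0 <= K & forall n s,
  expect n s (fun cs => (path_sum l s cs - n%:R * stat_mean l) ^+ 2) <= K * n.+1%:R.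
Proof.
have [D [mart [B B0 hB]]] := martingale_decomposition l.
have [B' B'0 hB'] := expect_martingale_sqr mart.
set v := stat_mean (fun s c => D s c ^+ 2) in hB' *.
have v0 : 0 <= v.
  by apply: sumr_ge0 => s _; rewrite mulr_ge0// sumr_ge0// => c _; rewrite mulr_ge0// sqr_ge0.
exists (2 * v + 2 * B' + 2 * B ^+ 2).
  by rewrite !addr_ge0// ?mulr_ge0// sqr_ge0.
move=> n s.
apply: (@le_trans _ _ (expect n s (fun cs => 2 * path_sum D s cs ^+ 2 + 2 * B ^+ 2))).
  apply: le_expect => // cs sz; have := hB s cs; rewrite sz.
  move: (path_sum l s cs - _) (path_sum D s cs) => x y; rewrite ler_norml => /andP[h1 h2].
  have := sqr_ge0 (x - 2 * y); nra.
rewrite expectD expectZ expect_cst//.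
have := hB' n s; rewrite ler_norml => /andP[_ h2].
have n0 : 0 <= n%:R :> R by [].
rewrite -(natr1 n); move: (n%:R : R) n0 h2 => N N0 h2.
have := mulr_ge0 N0 v0; have := mulr_ge0 N0 B'0; have := mulr_ge0 N0 (sqr_ge0 B); lra.
Qed.

Lemma expect_additive_mean_le (l : S -> C -> R) : exists2 K : R, 0 <= K & forall n s,
  `|expect n s (fun cs => path_sum l s cs - n%:R * stat_mean l)| <= K.
Proof.
have [D [mart [B B0 hB]]] := martingale_decomposition l.
exists B => // n s; rewrite -[X in `|X|]subr0 -(expect_martingale mart n s).
rewrite -[leRHS](expect_cst nxt Q_sum1 n s); apply: expect_dist => // cs sz.
by have := hB s cs; rewrite sz.
Qed.

End additive_functionals.

(** * Conditional mutual information near an all-positive law *)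

Section relative_entropy_terms.
Context (R : realType).

Definition entropy_term (x y : R) : R := x * ln (x / y).

Lemma ln_le_subr1 (y : R) : 0 < y -> ln y <= y - 1.
Proof.
move=> y0; have := expR_ge1Dx (ln y); rewrite lnK ?posrE//; lra.
Qed.

Lemma ln_eq_subr1 (y : R) : 0 < y -> ln y = y - 1 -> y = 1.
Proof.
move=> y0 e; apply/eqP; apply/negP => /negP y1.
have l0 : ln y != 0 by rewrite e subr_eq0.
by have := expR_gt1Dx l0; rewrite lnK ?posrE// e addrC subrK ltxx.
Qed.

Lemma ln_ge_subr1V (y : R) : 0 < y -> 1 - y^-1 <= ln y.
Proof.
move=> y0; have := ln_le_subr1 (_ : 0 < y^-1); rewrite invr_gt0 => /(_ y0).
rewrite lnV ?posrE//; lra.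
Qed.

(** From 1 - 1/z <= ln z <= z - 1 at z = x / y. Nothing forces x to be close to y, since an
    empirical law can miss cells; at x = 0 the bound is an equality. *)
Lemma entropy_term_first_order (x y : R) : 0 <= x -> 0 < y ->
  `|entropy_term x y - (x - y)| <= (x - y) ^+ 2 / y.
Proof.
move=> x0 y0; rewrite /entropy_term.
have [x_gt0|] := ltP 0 x; last first.
  move=> xle; have -> : x = 0 by apply/eqP; rewrite eq_le xle.
  by rewrite mul0r !sub0r opprK sqrrN expr2 mulfK ?gt_eqF// gtr0_norm.
have z0 : 0 < x / y by rewrite divr_gt0.
have h1 := ler_wpM2l x0 (ln_le_subr1 z0); have h2 := ler_wpM2l x0 (ln_ge_subr1V z0).
have e1 : x * (x / y - 1) = (x - y) ^+ 2 / y + (x - y) by field; rewrite gt_eqF.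
have e2 : x * (1 - (x / y)^-1) = x - y by field; rewrite !gt_eqF.
rewrite e1 in h1; rewrite e2 in h2.
rewrite ger0_norm; lra.
Qed.

(** With g z = z ln z - (z - 1) - (z - 1)^2 / 2 the error is y g(x / y). Both g and g' vanish at 1,
    and g' is quadratically small for z >= 1/2, a range ensured by the assumption on x - y. *)
Lemma entropy_term_second_order (x y : R) : 0 < y -> `|x - y| <= y / 2 ->
  `|entropy_term x y - (x - y) - (x - y) ^+ 2 / (2 * y)| <= 2 * `|x - y| ^+ 3 / y ^+ 2.
Proof.
move=> y0 xy.
pose g z : R := z * ln z + (-1 * (z + -1) + - 2^-1 * ((z + -1) * (z + -1))).
pose g' z : R := ln z - (z - 1).
have dg (z : R) : 0 < z -> is_derive z 1 g (g' z).
  move=> z0; have iz := is_derive_id z (1 : R).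
  have i1 := is_derive1D iz (is_derive1_cst (-1) z).
  apply: is_derive_eq (is_derive1D (is_derive1M iz (is_derive1_ln z0))
    (is_derive1D (is_derive1M (is_derive1_cst (-1) z) i1)
      (is_derive1M (is_derive1_cst (- 2^-1) z) (is_derive1M i1 i1)))) _.
  by rewrite /g' /=; field; rewrite gt_eqF.
have g'b (z : R) : 1 / 2 <= z -> `|g' z| <= 2 * (z - 1) ^+ 2.
  move=> z2; have z0 : 0 < z by lra.
  have := ln_le_subr1 z0; have := ln_ge_subr1V z0 => h1 h2.
  rewrite /g' ler0_norm; last by lra.
  have zi2 : z^-1 <= 2 by rewrite -[leRHS]invrK lef_pV2 ?posrE ?invr_gt0//; lra.
  have e : (z - 1) - (1 - z^-1) = z^-1 * (z - 1) ^+ 2 by field; rewrite gt_eqF.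
  have := ler_wpM2r (sqr_ge0 (z - 1)) zi2; rewrite -e; lra.
pose w := x / y - 1.
have wE : x - y = y * w by rewrite /w; field; rewrite gt_eqF.
have w2 : `|w| <= 1 / 2.
  by move: xy; rewrite wE normrM (gtr0_norm y0) ler_pM2l//; lra.
have in12 t : 0 <= t <= 1 -> 1 / 2 <= 1 + t * w.
  by move: w2; rewrite ler_norml => /andP[? ?] /andP[? ?]; nra.
have D (t : R) : 0 <= t <= 1 -> is_derive t 1 (fun t => g (1 + t * w)) (g' (1 + t * w) * w).
  move=> /in12 t12; have z0 : 0 < 1 + t * w by lra.
  have dl : is_derive t 1 (fun t => 1 + t * w) w.
    apply: is_derive_eq (is_derive1D (is_derive1_cst 1 t)
      (is_derive1M (is_derive_id t (1 : R)) (is_derive1_cst w t))) _.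
    by ring.
  exact: (@is_derive1_comp R g (fun t => 1 + t * w) t _ _ (dg _ z0) dl).
have bd t : 0 <= t <= 1 -> `|g' (1 + t * w) * w| <= 2 * `|w| ^+ 3.
  move=> t01; rewrite normrM exprSr mulrA ler_wpM2r//.
  apply: le_trans (g'b _ (in12 _ t01)) _; rewrite ler_wpM2l//.
  have /andP[t0 t1] := t01.
  rewrite [1 + _]addrC addrK exprMn -[w ^+ 2]real_normK ?num_real// ler_piMl ?sqr_ge0//.
  by rewrite exprn_ile1.
have h01 : 0 <= (1 : R) <= 1 by rewrite ler01 lexx.
have := mean_value_bound_on D bd h01.
have g1 : g (1 + 0 * w) = 0 by rewrite /g mul0r addr0 ln1; ring.
rewrite g1 subr0 mul1r => H.
have -> : entropy_term x y - (x - y) - (x - y) ^+ 2 / (2 * y) = y * g (1 + w).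
  have xE : x / y = 1 + w by rewrite /w addrC subrK.
  rewrite /entropy_term xE /g; have -> : x = y * (1 + w) by rewrite -xE mulrCA divff ?mulr1// gt_eqF.
  by field; rewrite gt_eqF.
rewrite normrM (gtr0_norm y0) wE normrM (gtr0_norm y0).
apply: le_trans (ler_wpM2l (ltW y0) H) _.
by rewrite le_eqVlt; apply/orP; left; apply/eqP; field; rewrite gt_eqF.
Qed.

End relative_entropy_terms.

Section entropy_sums.
Context (R : realType) (I : finType) (x y : I -> R) (d : R).
Hypothesis x_ge0 : forall i, 0 <= x i.
Hypothesis y_gt0 : forall i, 0 < y i.
Hypothesis xy_d : forall i, `|x i - y i| <= d.

Lemma sum_entropy_first_order :
  `|\sum_i entropy_term (x i) (y i) - \sum_i (x i - y i)| <= d ^+ 2 * \sum_i (y i)^-1.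
Proof.
rewrite -sumrB mulr_sumr; apply: le_trans (ler_norm_sum _ _ _) _; apply: ler_sum => i _.
apply: le_trans (entropy_term_first_order (x_ge0 i) (y_gt0 i)) _.
rewrite ler_wpM2r ?invr_ge0 ?(ltW (y_gt0 i))// -[leLHS]real_normK ?num_real//.
by apply: lerXn2r; rewrite ?nnegrE// (le_trans _ (xy_d i)).
Qed.

Lemma sum_entropy_second_order : (forall i, d <= y i / 2) ->
  `|\sum_i entropy_term (x i) (y i) - \sum_i (x i - y i)
     - 2^-1 * \sum_i (x i - y i) ^+ 2 / y i| <= d ^+ 3 * \sum_i 2 / y i ^+ 2.
Proof.
move=> dy; rewrite mulr_sumr -!sumrB mulr_sumr.
apply: le_trans (ler_norm_sum _ _ _) _; apply: ler_sum => i _.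
have := entropy_term_second_order (y_gt0 i) (le_trans (xy_d i) (dy i)).
rewrite (_ : (x i - y i) ^+ 2 / (2 * y i) = 2^-1 * ((x i - y i) ^+ 2 / y i)); last first.
  by field; rewrite gt_eqF.
move=> /le_trans; apply; rewrite [leRHS]mulrA; apply: ler_wpM2r.
  by rewrite invr_ge0 exprn_ge0// ltW.
rewrite mulrC; apply: ler_wpM2r => //.
by apply: lerXn2r; rewrite ?nnegrE// (le_trans _ (xy_d i)).
Qed.

End entropy_sums.

Section triple_information.
Context (R : realType) (U V W : finType) (p : U -> V -> W -> R).
Hypothesis p_gt0 : forall u v w, 0 < p u v w.

Definition pmf_UW (q : U -> V -> W -> R) (u : U) (w : W) : R := \sum_v q u v w.
Definition pmf_VW (q : U -> V -> W -> R) (v : V) (w : W) : R := \sum_u q u v w.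

Lemma sum2E (S T : finType) (F : S -> T -> R) :
  \sum_s \sum_t F s t = \sum_(i : S * T) F i.1 i.2.
Proof. by rewrite pair_bigA. Qed.

Lemma sum3E (F : U -> V -> W -> R) :
  \sum_u \sum_v \sum_w F u v w = \sum_(i : U * V * W) F i.1.1 i.1.2 i.2.
Proof.
rewrite -(sum2E (fun uv w => F uv.1 uv.2 w)) -(sum2E (fun u v => \sum_w F u v w)).
by [].
Qed.

Lemma sum3_W (F : W -> R) (q : U -> V -> W -> R) :
  \sum_u \sum_v \sum_w q u v w * F w = \sum_w pmf_W q w * F w.
Proof.
rewrite [RHS](eq_bigr (fun w => \sum_u \sum_v q u v w * F w)); last first.
  by move=> w _; rewrite /pmf_W mulr_suml; apply: eq_bigr => u _; rewrite mulr_suml.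
rewrite [RHS]exchange_big /=; apply: eq_bigr => u _; by rewrite exchange_big.
Qed.

Lemma sum3_UW (F : U -> W -> R) (q : U -> V -> W -> R) :
  \sum_u \sum_v \sum_w q u v w * F u w = \sum_u \sum_w pmf_UW q u w * F u w.
Proof.
apply: eq_bigr => u _; rewrite exchange_big /=; apply: eq_bigr => w _.
by rewrite /pmf_UW mulr_suml.
Qed.

Lemma sum3_VW (F : V -> W -> R) (q : U -> V -> W -> R) :
  \sum_u \sum_v \sum_w q u v w * F v w = \sum_v \sum_w pmf_VW q v w * F v w.
Proof.
rewrite exchange_big /=; apply: eq_bigr => v _; rewrite exchange_big /=.
by apply: eq_bigr => w _; rewrite /pmf_VW mulr_suml.
Qed.

Lemma marginals_gt0 (q : U -> V -> W -> R) u v w :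
  (forall u v w, 0 <= q u v w) -> 0 < q u v w ->
  [/\ 0 < pmf_UW q u w, 0 < pmf_VW q v w & 0 < pmf_W q w].
Proof.
move=> q0 quvw.
have s1 : q u v w <= pmf_UW q u w by rewrite /pmf_UW (bigD1 v)//= lerDl sumr_ge0.
have s2 : q u v w <= pmf_VW q v w by rewrite /pmf_VW (bigD1 u)//= lerDl sumr_ge0.
have s3 : pmf_UW q u w <= pmf_W q w.
  by rewrite /pmf_W (bigD1 u)//= lerDl sumr_ge0// => u' _; rewrite sumr_ge0.
have h1 := lt_le_trans quvw s1.
by split => //; [exact: lt_le_trans s2|exact: lt_le_trans s3].
Qed.

Lemma ln_likelihood_ratio (q : U -> V -> W -> R) u v w :
  (forall u v w, 0 <= q u v w) -> 0 < q u v w ->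
  ln (likelihood_ratio q u v w) =
  ln (q u v w) + ln (pmf_W q w) - ln (pmf_UW q u w) - ln (pmf_VW q v w).
Proof.
move=> q0 quvw; have [h1 h2 h3] := marginals_gt0 q0 quvw.
rewrite /likelihood_ratio /cond_pmf_UV /cond_pmf_U /cond_pmf_V -/(pmf_UW q u w) -/(pmf_VW q v w).
rewrite (_ : _ / _ = q u v w * pmf_W q w / (pmf_UW q u w * pmf_VW q v w)); last first.
  by field; rewrite !gt_eqF.
rewrite ln_div ?posrE ?mulr_gt0// !lnM ?posrE//; ring.
Qed.

(** Where q is positive, each log-ratio splits into four logarithms, of the joint law and of three
    marginals, and a logarithm of a marginal integrates to a sum over that marginal. Cells with q =
    0 contribute 0 to both sides. *)
Lemma entropy_terms_cmi (q : U -> V -> W -> R) : (forall u v w, 0 <= q u v w) ->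
  cond_mutual_info q - \sum_u \sum_v \sum_w q u v w * ln (likelihood_ratio p u v w) =
  \sum_u \sum_v \sum_w entropy_term (q u v w) (p u v w)
  + \sum_w entropy_term (pmf_W q w) (pmf_W p w)
  - \sum_u \sum_w entropy_term (pmf_UW q u w) (pmf_UW p u w)
  - \sum_v \sum_w entropy_term (pmf_VW q v w) (pmf_VW p v w).
Proof.
move=> q0.
rewrite -(sum3_W (fun w => ln (pmf_W q w / pmf_W p w))).
rewrite -(sum3_UW (fun u w => ln (pmf_UW q u w / pmf_UW p u w))).
rewrite -(sum3_VW (fun v w => ln (pmf_VW q v w / pmf_VW p v w))).
rewrite /cond_mutual_info !sum3E -big_split /= -!sumrB; apply: eq_bigr => -[[u v] w] _ /=.
have [z|nz] := eqVneq (q u v w) 0; first by rewrite /entropy_term z !mul0r; ring.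
have qp : 0 < q u v w by rewrite lt_def nz q0.
have [h1 h2 h3] := marginals_gt0 q0 qp.
have [k1 k2 k3] := marginals_gt0 (fun u v w => ltW (p_gt0 u v w)) (p_gt0 u v w).
rewrite !ln_likelihood_ratio// => [|? ? ?]; last exact: ltW.
by rewrite /entropy_term !ln_div ?posrE//; ring.
Qed.

Definition total_deviation (q : U -> V -> W -> R) : R :=
  \sum_u \sum_v \sum_w `|q u v w - p u v w|.

Definition chi_square_form (q : U -> V -> W -> R) : R :=
  \sum_u \sum_v \sum_w (q u v w - p u v w) ^+ 2 / p u v w
  + \sum_w (pmf_W q w - pmf_W p w) ^+ 2 / pmf_W p w
  - \sum_u \sum_w (pmf_UW q u w - pmf_UW p u w) ^+ 2 / pmf_UW p u w
  - \sum_v \sum_w (pmf_VW q v w - pmf_VW p v w) ^+ 2 / pmf_VW p v w.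

Section deviations.
Variable q : U -> V -> W -> R.
Local Notation d := (total_deviation q).

Lemma deviation_ge0 : 0 <= d.
Proof. by apply: sumr_ge0 => u _; apply: sumr_ge0 => v _; exact: sumr_ge0. Qed.

Lemma sum_deviation_le (P : pred (U * V * W)) :
  `|\sum_(i | P i) (q i.1.1 i.1.2 i.2 - p i.1.1 i.1.2 i.2)| <= d.
Proof.
apply: le_trans (ler_norm_sum _ _ _) _; rewrite /total_deviation sum3E.
by rewrite [leRHS](bigID P) /= lerDl sumr_ge0.
Qed.

Lemma deviation_UVW u v w : `|q u v w - p u v w| <= d.
Proof.
have := sum_deviation_le (pred1 (u, v, w)).
by rewrite (big_pred1 (u, v, w)).
Qed.

Lemma deviation_W w : `|pmf_W q w - pmf_W p w| <= d.
Proof.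
have := sum_deviation_le (fun i => i.2 == w).
rewrite (_ : \sum_(i | _) _ = pmf_W q w - pmf_W p w)//.
rewrite /pmf_W -sumrB; under [RHS]eq_bigr do rewrite -sumrB.
rewrite sum2E (reindex_onto (fun uv : U * V => (uv, w)) (fst))/=; last by case=> ? ? /= /eqP ->.
by apply: eq_bigl => uv; rewrite !eqxx.
Qed.

Lemma deviation_UW u w : `|pmf_UW q u w - pmf_UW p u w| <= d.
Proof.
have := sum_deviation_le (fun i => (i.1.1 == u) && (i.2 == w)).
rewrite (_ : \sum_(i | _) _ = pmf_UW q u w - pmf_UW p u w)//.
rewrite /pmf_UW -sumrB.
rewrite (reindex_onto (fun v => (u, v, w)) (fun i => i.1.2))/=; last first.
  by case=> [[? ?] ?] /= /andP[/eqP -> /eqP ->].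
by apply: eq_bigl => v; rewrite !eqxx.
Qed.

Lemma deviation_VW v w : `|pmf_VW q v w - pmf_VW p v w| <= d.
Proof.
have := sum_deviation_le (fun i => (i.1.2 == v) && (i.2 == w)).
rewrite (_ : \sum_(i | _) _ = pmf_VW q v w - pmf_VW p v w)//.
rewrite /pmf_VW -sumrB.
rewrite (reindex_onto (fun u => (u, v, w)) (fun i => i.1.1))/=; last first.
  by case=> [[? ?] ?] /= /andP[/eqP -> /eqP ->].
by apply: eq_bigl => u; rewrite !eqxx.
Qed.

Hypothesis q_ge0 : forall u v w, 0 <= q u v w.

Lemma pmf_UW_ge0 u w : 0 <= pmf_UW q u w. Proof. exact: sumr_ge0. Qed.
Lemma pmf_VW_ge0 v w : 0 <= pmf_VW q v w. Proof. exact: sumr_ge0. Qed.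
Lemma pmf_W_ge0 w : 0 <= pmf_W q w.
Proof. by apply: sumr_ge0 => u _; exact: sumr_ge0. Qed.

(** All four sums equal the difference of the total masses, and two of them come with a minus
    sign. *)
Lemma first_order_terms_cancel :
  \sum_u \sum_v \sum_w (q u v w - p u v w)
  + \sum_w (pmf_W q w - pmf_W p w)
  - \sum_u \sum_w (pmf_UW q u w - pmf_UW p u w)
  - \sum_v \sum_w (pmf_VW q v w - pmf_VW p v w) = 0.
Proof.
pose D u v w := q u v w - p u v w.
have e0 : \sum_u \sum_v \sum_w D u v w = \sum_u \sum_v \sum_w D u v w * 1.
  by apply: eq_bigr => u _; apply: eq_bigr => v _; apply: eq_bigr => w _; rewrite mulr1.
have e1 : \sum_w (pmf_W q w - pmf_W p w) = \sum_u \sum_v \sum_w D u v w.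
  rewrite e0 (sum3_W (fun=> 1)); apply: eq_bigr => w _.
  by rewrite mulr1 /pmf_W -sumrB; apply: eq_bigr => u _; rewrite -sumrB.
have e2 : \sum_u \sum_w (pmf_UW q u w - pmf_UW p u w) = \sum_u \sum_v \sum_w D u v w.
  rewrite e0 (sum3_UW (fun _ _ => 1)); apply: eq_bigr => u _; apply: eq_bigr => w _.
  by rewrite mulr1 /pmf_UW -sumrB.
have e3 : \sum_v \sum_w (pmf_VW q v w - pmf_VW p v w) = \sum_u \sum_v \sum_w D u v w.
  rewrite e0 (sum3_VW (fun _ _ => 1)); apply: eq_bigr => v _; apply: eq_bigr => w _.
  by rewrite mulr1 /pmf_VW -sumrB.
by rewrite e1 e2 e3; ring.
Qed.

End deviations.

Hypothesis inhabited_U : U.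
Hypothesis inhabited_V : V.

Let p_ge0 u v w : 0 <= p u v w. Proof. exact: ltW. Qed.

Let UW_gt0 u w : 0 < pmf_UW p u w.
Proof. by have [] := marginals_gt0 p_ge0 (p_gt0 u inhabited_V w). Qed.

Let VW_gt0 v w : 0 < pmf_VW p v w.
Proof. by have [] := marginals_gt0 p_ge0 (p_gt0 inhabited_U v w). Qed.

Let W_gt0 w : 0 < pmf_W p w.
Proof. by have [] := marginals_gt0 p_ge0 (p_gt0 inhabited_U inhabited_V w). Qed.

Lemma cmi_first_order : exists2 K : R, 0 <= K & forall q : U -> V -> W -> R,
  (forall u v w, 0 <= q u v w) ->
  `|cond_mutual_info q - \sum_u \sum_v \sum_w q u v w * ln (likelihood_ratio p u v w)|
    <= K * total_deviation q ^+ 2.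
Proof.
pose K1 := \sum_(i : U * V * W) (p i.1.1 i.1.2 i.2)^-1.
pose K2 := \sum_w (pmf_W p w)^-1.
pose K3 := \sum_(i : U * W) (pmf_UW p i.1 i.2)^-1.
pose K4 := \sum_(i : V * W) (pmf_VW p i.1 i.2)^-1.
exists (K1 + K2 + K3 + K4).
  by rewrite !addr_ge0// sumr_ge0// => i _; rewrite invr_ge0 ltW.
move=> q q0; rewrite entropy_terms_cmi//.
have := first_order_terms_cancel q.
rewrite !sum3E !sum2E.
have h1 := @sum_entropy_first_order R _ _ _ (total_deviation q)
  (fun i : U * V * W => q0 i.1.1 i.1.2 i.2) (fun i => p_gt0 i.1.1 i.1.2 i.2)
  (fun i => deviation_UVW q i.1.1 i.1.2 i.2).
have h2 := @sum_entropy_first_order R _ _ _ (total_deviation q)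
  (pmf_W_ge0 q0) W_gt0 (deviation_W q).
have h3 := @sum_entropy_first_order R _ _ _ (total_deviation q)
  (fun i : U * W => pmf_UW_ge0 q0 i.1 i.2) (fun i => UW_gt0 i.1 i.2)
  (fun i => deviation_UW q i.1 i.2).
have h4 := @sum_entropy_first_order R _ _ _ (total_deviation q)
  (fun i : V * W => pmf_VW_ge0 q0 i.1 i.2) (fun i => VW_gt0 i.1 i.2)
  (fun i => deviation_VW q i.1 i.2).
move: h1 h2 h3 h4; rewrite -/K1 -/K2 -/K3 -/K4 !ler_norml.
move=> /andP[? ?] /andP[? ?] /andP[? ?] /andP[? ?] E.
by apply/andP; split; lra.
Qed.

Lemma cmi_second_order : exists2 r0 : R, 0 < r0 & exists2 K : R, 0 <= K &
  forall q : U -> V -> W -> R,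
  (forall u v w, 0 <= q u v w) -> total_deviation q <= r0 ->
  `|cond_mutual_info q - \sum_u \sum_v \sum_w q u v w * ln (likelihood_ratio p u v w)
    - 2^-1 * chi_square_form q| <= K * total_deviation q ^+ 3.
Proof.
pose K1 := \sum_(i : U * V * W) 2 / p i.1.1 i.1.2 i.2 ^+ 2.
pose K2 := \sum_w 2 / pmf_W p w ^+ 2.
pose K3 := \sum_(i : U * W) 2 / pmf_UW p i.1 i.2 ^+ 2.
pose K4 := \sum_(i : V * W) 2 / pmf_VW p i.1 i.2 ^+ 2.
(* The inverse of r1 is at most half of every cell of p, hence of every marginal, as the
   second-order expansion requires. *)
pose r1 := 1 + \sum_(i : U * V * W) 2 / p i.1.1 i.1.2 i.2.
have s0 : 0 <= \sum_(i : U * V * W) 2 / p i.1.1 i.1.2 i.2.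
  by apply: sumr_ge0 => i _; rewrite divr_ge0.
have r1_gt0 : 0 < r1 by rewrite ltr_wpDr.
have r1V u v w : r1^-1 <= p u v w / 2.
  rewrite -[leRHS]invrK lef_pV2 ?posrE ?invr_gt0 ?divr_gt0// invf_div.
  by rewrite /r1 (bigD1 (u, v, w))//= addrCA lerDl addr_ge0// sumr_ge0// => i _; rewrite divr_ge0.
exists r1^-1; first by rewrite invr_gt0.
exists (K1 + K2 + K3 + K4).
  by rewrite !addr_ge0// sumr_ge0// => i _; rewrite divr_ge0// exprn_ge0// ltW.
move=> q q0 dr; rewrite entropy_terms_cmi//.
have := first_order_terms_cancel q.
rewrite /chi_square_form !sum3E !sum2E.
have le_UW u v w : p u v w <= pmf_UW p u w by rewrite /pmf_UW (bigD1 v)//= lerDl sumr_ge0.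
have le_VW u v w : p u v w <= pmf_VW p v w by rewrite /pmf_VW (bigD1 u)//= lerDl sumr_ge0.
have le_W u v w : p u v w <= pmf_W p w.
  apply: le_trans (le_UW u v w) _; rewrite /pmf_W (bigD1 u)//= lerDl sumr_ge0// => i _.
  exact: sumr_ge0.
have d1 u v w : total_deviation q <= p u v w / 2 by apply: le_trans dr (r1V _ _ _).
have half (a b : R) : a <= b -> a / 2 <= b / 2 by move=> ?; lra.
have h1 := @sum_entropy_second_order R _ _ _ (total_deviation q)
  (fun i : U * V * W => p_gt0 i.1.1 i.1.2 i.2)
  (fun i => deviation_UVW q i.1.1 i.1.2 i.2) (fun i => d1 _ _ _).
have h2 := @sum_entropy_second_order R _ _ _ (total_deviation q)
  W_gt0 (deviation_W q)
  (fun w => le_trans (d1 inhabited_U inhabited_V w) (half _ _ (le_W _ _ _))).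
have h3 := @sum_entropy_second_order R _ _ _ (total_deviation q)
  (fun i : U * W => UW_gt0 i.1 i.2)
  (fun i => deviation_UW q i.1 i.2)
  (fun i => le_trans (d1 i.1 inhabited_V i.2) (half _ _ (le_UW _ _ _))).
have h4 := @sum_entropy_second_order R _ _ _ (total_deviation q)
  (fun i : V * W => VW_gt0 i.1 i.2)
  (fun i => deviation_VW q i.1 i.2)
  (fun i => le_trans (d1 inhabited_U i.1 i.2) (half _ _ (le_VW _ _ _))).
move: h1 h2 h3 h4; rewrite -/K1 -/K2 -/K3 -/K4 !ler_norml.
move=> /andP[? ?] /andP[? ?] /andP[? ?] /andP[? ?] E.
by apply/andP; split; lra.
Qed.

(** Equality case of Gibbs' inequality. For y the ratio of the right side to the left, the terms p
    (y - 1) sum to 0 and the information is minus the p-mean of ln y, so the nonnegative terms p (y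
    - 1 - ln y) sum to 0. *)
Lemma cmi_eq0_independent : cond_mutual_info p = 0 ->
  forall u v w, p u v w * pmf_W p w = pmf_UW p u w * pmf_VW p v w.
Proof.
move=> I0.
pose y u v w := pmf_UW p u w * pmf_VW p v w / (p u v w * pmf_W p w).
have y_gt0 u v w : 0 < y u v w by rewrite divr_gt0// mulr_gt0.
have yE u v w : ln (likelihood_ratio p u v w) = - ln (y u v w).
  rewrite ln_likelihood_ratio// /y ln_div ?posrE ?mulr_gt0// !lnM ?posrE//; ring.
have sy : \sum_u \sum_v \sum_w p u v w * (y u v w - 1) = 0.
  transitivity (\sum_w \sum_u \sum_v (pmf_UW p u w * pmf_VW p v w / pmf_W p w - p u v w)).
    rewrite [RHS]exchange_big /=; apply: eq_bigr => u _; rewrite [RHS]exchange_big /=.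
    apply: eq_bigr => v _; apply: eq_bigr => w _; rewrite /y; field.
    by rewrite !gt_eqF.
  apply: big1 => w _.
  under eq_bigr do rewrite sumrB -!mulr_suml -mulr_sumr.
  rewrite sumrB -!mulr_suml -/(pmf_W p w).
  have -> : \sum_v pmf_VW p v w = pmf_W p w by rewrite /pmf_W exchange_big.
  by rewrite -/(pmf_W p w) mulfK ?subrr// gt_eqF.
have term_ge0 u v w : 0 <= p u v w * (y u v w - 1 - ln (y u v w)).
  by rewrite mulr_ge0// subr_ge0 ln_le_subr1.
have s0 : \sum_(i : U * V * W) p i.1.1 i.1.2 i.2 * (y i.1.1 i.1.2 i.2 - 1 - ln (y i.1.1 i.1.2 i.2)) = 0.
  rewrite -(sum3E (fun u v w => p u v w * (y u v w - 1 - ln (y u v w)))).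
  transitivity (\sum_u \sum_v \sum_w p u v w * (y u v w - 1) + cond_mutual_info p); last first.
    by rewrite sy I0 addr0.
  rewrite /cond_mutual_info !sum3E -big_split /=; apply: eq_bigr => i _.
  by rewrite yE; ring.
move=> u v w.
have /psumr_eq0P/(_ s0 (u, v, w) isT) /= : forall i : U * V * W, true ->
  0 <= p i.1.1 i.1.2 i.2 * (y i.1.1 i.1.2 i.2 - 1 - ln (y i.1.1 i.1.2 i.2)) by move=> i _.
move=> /eqP; rewrite mulf_eq0 gt_eqF//= subr_eq0 => /eqP /esym /ln_eq_subr1 => /(_ (y_gt0 u v w)).
rewrite /y => /(congr1 (fun z => z * (p u v w * pmf_W p w))).
by rewrite divfK ?mul1r// gt_eqF// mulr_gt0.
Qed.

End triple_information.

(** * Orthonormal scores for conditional independence *)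

Section householder.
Context (R : realType) (T : finType) (t0 : T) (c : T -> R).
Hypothesis c_ge0 : forall t, 0 <= c t.
Hypothesis c_unit : \sum_t c t ^+ 2 = 1.

(* The matrix of the reflection mapping the unit vector [c] to minus the basis
   vector at [t0]; its rows other than [t0] are orthonormal and orthogonal to [c]. *)
Definition householder (a t : T) : R :=
  (a == t)%:R - (c a + (a == t0)%:R) * (c t + (t == t0)%:R) / (1 + c t0).

(** Reflecting onto minus the basis vector, and not plus, gives the denominator 1 + c t0, which
    cannot vanish for nonnegative c. *)
Let den_neq0 : 1 + c t0 != 0.
Proof. by rewrite gt_eqF// ltr_wpDr. Qed.

Let sum_delta (F : T -> R) a : \sum_t (a == t)%:R * F t = F a.
Proof.
rewrite (bigD1 a)//= eqxx mul1r big1 ?addr0// => t /negbTE.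
by rewrite eq_sym => ->; rewrite mul0r.
Qed.

Let sum_delta' (F : T -> R) a : \sum_t (t == a)%:R * F t = F a.
Proof. by rewrite -[RHS](sum_delta F); apply: eq_bigr => t _; rewrite eq_sym. Qed.

Let sumE (x : T -> R) a : \sum_t householder a t * x t =
  x a - (c a + (a == t0)%:R) / (1 + c t0) * (\sum_t c t * x t + x t0).
Proof.
have -> : \sum_t c t * x t + x t0 = \sum_t (c t + (t == t0)%:R) * x t.
  by under [RHS]eq_bigr do rewrite mulrDl; rewrite big_split /= sum_delta'.
rewrite -(sum_delta x a) mulr_sumr -sumrB.
by apply: eq_bigr => t _; rewrite /householder; field.
Qed.

Lemma householder_orthogonal a : a != t0 -> \sum_t householder a t * c t = 0.
Proof.
move=> /negbTE at0; rewrite sumE at0 addr0.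
under eq_bigr do rewrite -expr2.
by rewrite c_unit; field.
Qed.

Let row_t0 t : householder t0 t = - c t.
Proof. by rewrite /householder eqxx [t0 == t]eq_sym; case: (t == t0); rewrite /=; field. Qed.

Lemma householder_sym a t : householder a t = householder t a.
Proof. by rewrite /householder eq_sym; congr (_ - _); rewrite [X in X / _]mulrC. Qed.

Lemma householder_orthonormal a b : \sum_t householder a t * householder b t = (a == b)%:R.
Proof.
rewrite sumE (householder_sym b t0) row_t0.
have -> : \sum_t c t * householder b t = - (b == t0)%:R.
  under eq_bigr do rewrite mulrC.
  rewrite sumE; under eq_bigr do rewrite -expr2.
  by rewrite c_unit; field.
rewrite /householder [b == a]eq_sym; field.
by [].
Qed.

(** A reflection is an isometry, and the omitted row is minus c: dropping it removes the squared
    component along c. *)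
Lemma householder_parseval (x : T -> R) :
  \sum_(a | a != t0) (\sum_t householder a t * x t) ^+ 2 =
  \sum_t x t ^+ 2 - (\sum_t c t * x t) ^+ 2.
Proof.
have full : \sum_a (\sum_t householder a t * x t) ^+ 2 = \sum_t x t ^+ 2.
  under eq_bigr do rewrite expr2 mulr_suml.
  rewrite exchange_big /=; apply: eq_bigr => t _.
  under eq_bigr do rewrite mulr_sumr.
  rewrite exchange_big /= expr2.
  rewrite -[X in _ = _ * X](sum_delta x t) mulr_sumr; apply: eq_bigr => u _.
  rewrite -householder_orthonormal mulr_suml mulr_sumr; apply: eq_bigr => a _.
  by rewrite (householder_sym t a) (householder_sym u a); ring.
rewrite -full [in RHS](bigD1 t0)//= (_ : \sum_t householder t0 t * x t = - \sum_t c t * x t).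
  by rewrite sqrrN addrC addrK.
by rewrite -sumrN; apply: eq_bigr => t _; rewrite row_t0 mulNr.
Qed.

End householder.

Lemma big_sig_val (R : nmodType) (T : finType) (P : pred T) (F : T -> R) :
  \sum_(i : {x : T | P x}) F (val i) = \sum_(x | P x) F x.
Proof.
rewrite (reindex_omap (val : {x : T | P x} -> T) insub) /=; last first.
  by move=> i Pi; rewrite insubT.
by apply: eq_bigl => i; rewrite valK eqxx (valP i).
Qed.

Section independence_scores.
Context (R : realType) (U V W : finType) (p : U -> V -> W -> R) (u0 : U) (v0 : V).
Hypothesis p_gt0 : forall u v w, 0 < p u v w.
Hypothesis p_indep : forall u v w, p u v w * pmf_W p w = pmf_UW p u w * pmf_VW p v w.

Let p_ge0 u v w : 0 <= p u v w. Proof. exact: ltW. Qed.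
Let UW_gt0 u w : 0 < pmf_UW p u w.
Proof. by have [] := marginals_gt0 p_ge0 (p_gt0 u v0 w). Qed.
Let VW_gt0 v w : 0 < pmf_VW p v w.
Proof. by have [] := marginals_gt0 p_ge0 (p_gt0 u0 v w). Qed.
Let W_gt0 w : 0 < pmf_W p w.
Proof. by have [] := marginals_gt0 p_ge0 (p_gt0 u0 v0 w). Qed.

(** Square roots of conditional probabilities given w are unit vectors, and under conditional
    independence the square root of p factors through them. *)
Let cU w u : R := Num.sqrt (pmf_UW p u w / pmf_W p w).
Let cV w v : R := Num.sqrt (pmf_VW p v w / pmf_W p w).

Let cU_unit w : \sum_u cU w u ^+ 2 = 1.
Proof.
under eq_bigr do rewrite sqr_sqrtr ?divr_ge0 ?ltW//.
by rewrite -mulr_suml -/(pmf_W p w) divff// gt_eqF.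
Qed.

Let cV_unit w : \sum_v cV w v ^+ 2 = 1.
Proof.
under eq_bigr do rewrite sqr_sqrtr ?divr_ge0 ?ltW//.
rewrite -mulr_suml (_ : \sum_v _ = pmf_W p w) ?divff// ?gt_eqF//.
by rewrite /pmf_W exchange_big.
Qed.

Let sqrt_p_U u v w : Num.sqrt (p u v w) = Num.sqrt (pmf_VW p v w) * cU w u.
Proof.
rewrite -sqrtrM ?ltW//; congr Num.sqrt.
have := p_indep u v w; move: (W_gt0 w) => W0 e.
by rewrite mulrA [_ * pmf_UW _ _ _]mulrC -e mulfK// gt_eqF.
Qed.

Let sqrt_p_V u v w : Num.sqrt (p u v w) = Num.sqrt (pmf_UW p u w) * cV w v.
Proof.
rewrite -sqrtrM ?ltW//; congr Num.sqrt.
have := p_indep u v w; move: (W_gt0 w) => W0 e.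
by rewrite mulrA -e mulfK// gt_eqF.
Qed.

Definition score_index : finType := (W * {u : U | u != u0} * {v : V | v != v0})%type.

(** Products of rows of the two reflections, divided by the square root of p, are orthonormal in
    L^2(p); w acts as a label. Leaving out the rows of u0 and v0 leaves as many scores as there are
    degrees of freedom. *)
Definition score (j : score_index) (u : U) (v : V) (w : W) : R :=
  (j.1.1 == w)%:R * householder u0 (cU w) (val j.1.2) u
    * householder v0 (cV w) (val j.2) v / Num.sqrt (p u v w).

Let sp_gt0 u v w : 0 < Num.sqrt (p u v w). Proof. by rewrite sqrtr_gt0. Qed.

Let p_sqr u v w : p u v w = Num.sqrt (p u v w) ^+ 2.
Proof. by rewrite sqr_sqrtr. Qed.

(** With v and w fixed, the square root of p is proportional to [cU w], to which every remaining row
    is orthogonal. Summing over u alone is what later makes the scores martingale increments. *)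
Lemma score_centered j v w : \sum_u p u v w * score j u v w = 0.
Proof.
rewrite (eq_bigr (fun u => (j.1.1 == w)%:R * householder v0 (cV w) (val j.2) v *
   Num.sqrt (pmf_VW p v w) * (householder u0 (cU w) (val j.1.2) u * cU w u))).
  rewrite -mulr_sumr householder_orthogonal ?mulr0// ?(valP j.1.2)// => u.
  exact: sqrtr_ge0.
move=> u _; rewrite /score {1}p_sqr -[in RHS]mulrA [in RHS]mulrCA.
have s := sp_gt0 u v w; have := sqrt_p_U u v w => e.
transitivity (Num.sqrt (p u v w) * (j.1.1 == w)%:R * householder u0 (cU w) (val j.1.2) u
    * householder v0 (cV w) (val j.2) v).
  by field; rewrite gt_eqF.
by rewrite e; ring.
Qed.

Lemma score_orthonormal i j :
  \sum_u \sum_v \sum_w p u v w * (score i u v w * score j u v w) = (i == j)%:R.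
Proof.
rewrite (eq_bigr (fun u => \sum_v \sum_w ((i.1.1 == w)%:R * (j.1.1 == w)%:R) *
   ((householder u0 (cU w) (val i.1.2) u * householder u0 (cU w) (val j.1.2) u) *
   (householder v0 (cV w) (val i.2) v * householder v0 (cV w) (val j.2) v)))); last first.
  move=> u _; apply: eq_bigr => v _; apply: eq_bigr => w _.
  rewrite /score {1}p_sqr; have s := sp_gt0 u v w; field; by rewrite gt_eqF.
under eq_bigr do rewrite exchange_big /=.
rewrite exchange_big /=.
rewrite (eq_bigr (fun w => ((i.1.1 == w)%:R * (j.1.1 == w)%:R) *
   ((val i.1.2 == val j.1.2)%:R * (val i.2 == val j.2)%:R))); last first.
  move=> w _; rewrite -(householder_orthonormal u0 (fun u => sqrtr_ge0 _) (cU_unit w)).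
  rewrite -(householder_orthonormal v0 (fun v => sqrtr_ge0 _) (cV_unit w)).
  rewrite mulr_suml mulr_sumr; apply: eq_bigr => u _.
  by rewrite mulr_sumr mulr_sumr.
rewrite -mulr_suml (bigD1 i.1.1)//= eqxx mul1r big1 ?addr0; last first.
  by move=> w /negbTE; rewrite eq_sym => ->; rewrite mul0r.
case: i j => [[w a] b] [[w' a'] b'] /=.
rewrite -!natrM !mulnb; congr (_%:R); rewrite -!pair_eqE /= /pair_eq /=.
by rewrite [w' == w]eq_sym -!val_eqE andbA.
Qed.

(** Parseval twice for each w, applied to (q - p) divided by the square root of p. The components
    removed along [cU], along [cV] and along both are the VW, UW and W terms of the form, with their
    signs. *)
Lemma chi_square_form_score (q : U -> V -> W -> R) : chi_square_form p q =
  \sum_j (\sum_u \sum_v \sum_w (q u v w - p u v w) * score j u v w) ^+ 2.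
Proof.
pose D u v w := q u v w - p u v w.
pose eta w u v := D u v w / Num.sqrt (p u v w).
pose HU w := householder u0 (cU w); pose HV w := householder v0 (cV w).
have -> : \sum_j (\sum_u \sum_v \sum_w (q u v w - p u v w) * score j u v w) ^+ 2 =
   \sum_(j : score_index) (\sum_v HV j.1.1 (val j.2) v *
       (\sum_u HU j.1.1 (val j.1.2) u * eta j.1.1 u v)) ^+ 2.
  apply: eq_bigr => j _; congr (_ ^+ 2).
  rewrite exchange_big /=; apply: eq_bigr => v _; rewrite mulr_sumr; apply: eq_bigr => u _.
  rewrite (bigD1 j.1.1)//= big1 ?addr0.
    by rewrite /score eqxx mul1r /eta /HU /HV /D; ring.
  by move=> w /negbTE; rewrite /score eq_sym => ->; rewrite !mul0r mulr0.
transitivity (\sum_w \sum_(a | a != u0) \sum_(b | b != v0)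
    (\sum_v HV w b v * (\sum_u HU w a u * eta w u v)) ^+ 2); last first.
  rewrite -(pair_bigA _ (fun wa (b : {v | v != v0}) => (\sum_v HV wa.1 (val b) v *
       (\sum_u HU wa.1 (val wa.2) u * eta wa.1 u v)) ^+ 2)) /=.
  rewrite -(pair_bigA _ (fun w (a : {u | u != u0}) => \sum_b (\sum_v HV w (val b) v *
       (\sum_u HU w (val a) u * eta w u v)) ^+ 2)) /=.
  apply: eq_bigr => w _.
  rewrite -(big_sig_val (fun a => a != u0) (fun a => \sum_(b | b != v0)
    (\sum_v HV w b v * (\sum_u HU w a u * eta w u v)) ^+ 2)).
  by apply: eq_bigr => a _; rewrite -(big_sig_val (fun b => b != v0)).
have hU w := @householder_parseval _ _ u0 _ (fun u => sqrtr_ge0 _) (cU_unit w).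
have hV w := @householder_parseval _ _ v0 _ (fun v => sqrtr_ge0 _) (cV_unit w).
have uE w v : \sum_u cU w u * eta w u v = (pmf_VW q v w - pmf_VW p v w) / Num.sqrt (pmf_VW p v w).
  rewrite /pmf_VW -sumrB -/(pmf_VW p v w) mulr_suml; apply: eq_bigr => u _.
  by rewrite /eta /D sqrt_p_U; field; rewrite !gt_eqF ?sqrtr_gt0// ?divr_gt0.
have vE w u : \sum_v cV w v * eta w u v = (pmf_UW q u w - pmf_UW p u w) / Num.sqrt (pmf_UW p u w).
  rewrite /pmf_UW -sumrB -/(pmf_UW p u w) mulr_suml; apply: eq_bigr => v _.
  by rewrite /eta /D sqrt_p_V; field; rewrite !gt_eqF ?sqrtr_gt0// ?divr_gt0.
have uvE w : \sum_u cU w u * (\sum_v cV w v * eta w u v) =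
    (pmf_W q w - pmf_W p w) / Num.sqrt (pmf_W p w).
  rewrite /pmf_W -sumrB -/(pmf_W p w) mulr_suml; apply: eq_bigr => u _.
  rewrite vE /cU sqrtrM ?ltW// sqrtrV ?ltW//.
  rewrite /pmf_UW -sumrB -/(pmf_UW p u w); field.
  by rewrite !gt_eqF ?sqrtr_gt0.
have sq (a b : R) : 0 < b -> (a / Num.sqrt b) ^+ 2 = a ^+ 2 / b.
  by move=> b0; rewrite exprMn exprVn sqr_sqrtr// ltW.
have step w : \sum_(a | a != u0) \sum_(b | b != v0)
    (\sum_v HV w b v * (\sum_u HU w a u * eta w u v)) ^+ 2 =
  \sum_u \sum_v D u v w ^+ 2 / p u v w
  - \sum_v (pmf_VW q v w - pmf_VW p v w) ^+ 2 / pmf_VW p v w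
  - (\sum_u (pmf_UW q u w - pmf_UW p u w) ^+ 2 / pmf_UW p u w
     - (pmf_W q w - pmf_W p w) ^+ 2 / pmf_W p w).
  under eq_bigr do rewrite hV.
  rewrite sumrB; congr (_ - _).
    rewrite exchange_big /=; under eq_bigr do rewrite hU uE sq//.
    rewrite sumrB exchange_big /=; congr (_ - _); apply: eq_bigr => u _; apply: eq_bigr => v _.
    by rewrite /eta sq.
  rewrite (eq_bigr (fun a => (\sum_u HU w a u * (\sum_v cV w v * eta w u v)) ^+ 2)).
    rewrite hU uvE sq//; congr (_ - _); apply: eq_bigr => u _.
    by rewrite vE sq.
  move=> a _; congr (_ ^+ 2).
  under eq_bigr do rewrite mulr_sumr.
  rewrite exchange_big /=; apply: eq_bigr => u _; rewrite mulr_sumr; apply: eq_bigr => v _.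
  by rewrite mulrCA.
under [RHS]eq_bigr do rewrite step.
rewrite /chi_square_form !sumrB.
have -> : \sum_u \sum_v \sum_w (q u v w - p u v w) ^+ 2 / p u v w =
    \sum_w \sum_u \sum_v D u v w ^+ 2 / p u v w.
  by rewrite [RHS]exchange_big /=; apply: eq_bigr => u _; rewrite [RHS]exchange_big.
rewrite [\sum_u \sum_w (pmf_UW q u w - _) ^+ 2 / _]exchange_big /=.
rewrite [\sum_v \sum_w (pmf_VW q v w - _) ^+ 2 / _]exchange_big /=.
ring.
Qed.

Lemma card_score_index : #|score_index| = (#|W| * (#|U| - 1) * (#|V| - 1))%N.
Proof.
rewrite !card_prod !card_sig !subn1 -(cardC1 u0) -(cardC1 v0).
by congr (_ * _ * _)%N; apply: eq_card => x; rewrite !inE.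
Qed.

End independence_scores.

(** * The plug-in estimator along a chain *)

Lemma sqr_sum_le (R : realType) (I : finType) (a : I -> R) :
  (\sum_i a i) ^+ 2 <= #|I|%:R * \sum_i a i ^+ 2.
Proof.
rewrite expr2 mulr_suml.
apply: (@le_trans _ _ (\sum_i \sum_j (a i ^+ 2 + a j ^+ 2) / 2)).
  apply: ler_sum => i _; rewrite mulr_sumr; apply: ler_sum => j _.
  by have := sqr_ge0 (a i - a j); nra.
have e1 : \sum_(i : I) \sum_j a j ^+ 2 = #|I|%:R * \sum_i a i ^+ 2.
  by rewrite sumr_const -[LHS]mulr_natl.
have e2 : \sum_i \sum_(j : I) a i ^+ 2 = #|I|%:R * \sum_i a i ^+ 2.
  by rewrite exchange_big.
under eq_bigr do rewrite -mulr_suml big_split.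
by rewrite -mulr_suml big_split /= e1 e2; lra.
Qed.

Section observed_chain.
Context (R : realType) (S C : finType) (Q : S -> C -> R) (nxt : S -> C -> S).
Context (pi : S -> R) (k : nat) (q0 : R).
Hypothesis Q_ge0 : forall s c, 0 <= Q s c.
Hypothesis Q_sum1 : forall s, \sum_c Q s c = 1.
Hypothesis pi_ge0 : forall s, 0 <= pi s.
Hypothesis pi_sum1 : \sum_s pi s = 1.
Hypothesis pi_inv : forall g, \sum_s pi s * markov_op Q nxt g s = \sum_s pi s * g s.
Hypothesis q0_gt0 : 0 < q0.
Hypothesis Q_ge : forall s c, q0 <= Q s c.
Hypothesis reach : forall s t, exists2 cs, size cs = k & foldl nxt s cs = t.
Context (U V W : finType) (uf : S -> C -> U) (vf : S -> C -> V) (wf : S -> C -> W).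
Context (p : U -> V -> W -> R) (u0 : U) (v0 : V).
Hypothesis p_gt0 : forall u v w, 0 < p u v w.
Hypothesis p_law : forall F, stat_mean Q pi (fun s c => F (uf s c) (vf s c) (wf s c)) =
  \sum_u \sum_v \sum_w p u v w * F u v w.
Local Notation expect := (expect Q nxt).
Local Notation path_sum := (path_sum nxt).

Let mixing g e : 0 < e -> exists n, forall s,
  `|iter n (markov_op Q nxt) g s - \sum_t pi t * g t| <= e.
Proof. exact: (markov_op_mixing Q_ge0 Q_sum1 pi_ge0 pi_sum1 pi_inv q0_gt0 Q_ge reach). Qed.

Let visit u v w s c : R := ((uf s c == u) && (vf s c == v) && (wf s c == w))%:R.

Definition empirical (n : nat) (s : S) (cs : seq C) (u : U) (v : V) (w : W) : R :=
  n%:R^-1 * path_sum (visit u v w) s cs.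

Lemma sum_indicator (F : U -> V -> W -> R) u v w :
  \sum_u' \sum_v' \sum_w' ((u == u') && (v == v') && (w == w'))%:R * F u' v' w' = F u v w.
Proof.
rewrite (bigD1 u)//= [X in _ + X]big1 ?addr0; last first.
  move=> u' /negbTE; rewrite eq_sym => ->; apply: big1 => v' _; apply: big1 => w' _.
  by rewrite mul0r.
rewrite (bigD1 v)//= [X in _ + X]big1 ?addr0; last first.
  move=> v' /negbTE; rewrite eq_sym => ->; apply: big1 => w' _.
  by rewrite andbF mul0r.
rewrite (bigD1 w)//= [X in _ + X]big1 ?addr0; last first.
  by move=> w' /negbTE; rewrite eq_sym => ->; rewrite andbF mul0r.
by rewrite !eqxx mul1r.
Qed.

Lemma sum_empirical n s cs (F : U -> V -> W -> R) :
  \sum_u \sum_v \sum_w empirical n s cs u v w * F u v w =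
  n%:R^-1 * path_sum (fun s c => F (uf s c) (vf s c) (wf s c)) s cs.
Proof.
transitivity (n%:R^-1 * (\sum_u \sum_v \sum_w path_sum (visit u v w) s cs * F u v w)).
  rewrite !sum3E mulr_sumr; apply: eq_bigr => i _.
  by rewrite mulrA.
congr (_ * _); elim: cs s => [|c cs IH] s /=.
  by apply: big1 => u _; apply: big1 => v _; apply: big1 => w _; rewrite mul0r.
rewrite -IH -(sum_indicator F (uf s c) (vf s c) (wf s c)).
rewrite !sum3E -big_split /=; apply: eq_bigr => i _.
by rewrite mulrDl.
Qed.

Lemma empirical_ge0 n s cs u v w : 0 <= empirical n s cs u v w.
Proof.
rewrite mulr_ge0 ?invr_ge0//; elim: cs s => //= c cs IH s.
by rewrite addr_ge0// /visit; case: (_ && _).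
Qed.

Let deviation n s cs : R := total_deviation p (empirical n s cs).

(** Each cell count is an additive functional with mean square error O(n); Cauchy-Schwarz collects
    the cells. *)
Lemma expect_sqr_deviation : exists2 K : R, 0 <= K & forall n s,
  expect n.+1 s (fun cs => deviation n.+1 s cs ^+ 2) <= K * n.+1%:R^-1.
Proof.
have mean_visit u v w : stat_mean Q pi (visit u v w) = p u v w.
  rewrite (p_law (fun u' v' w' => ((u' == u) && (v' == v) && (w' == w))%:R)).
  rewrite -[RHS](sum_indicator p u v w); apply: eq_bigr => u' _.
  apply: eq_bigr => v' _; apply: eq_bigr => w' _.
  by rewrite mulrC [u' == u]eq_sym [v' == v]eq_sym [w' == w]eq_sym.
have /choice[K hK] : forall i : U * V * W, exists K : R, 0 <= K /\ forall n s,
    expect n s (fun cs => (path_sum (visit i.1.1 i.1.2 i.2) s cs - n%:R * p i.1.1 i.1.2 i.2) ^+ 2)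
      <= K * n.+1%:R.
  move=> [[u v] w] /=.
  have [K K0 h] := expect_additive_sqr_le Q_ge0 Q_sum1 pi_ge0 pi_sum1 pi_inv q0_gt0 Q_ge reach (visit u v w).
  by exists K; split=> // n s; rewrite -(mean_visit u v w).
have K0 i : 0 <= K i by have [] := hK i.
pose N : R := #|{: U * V * W}|%:R.
have N0 : 0 <= N by exact: ler0n.
exists (N * (\sum_i K i * 2)).
  by rewrite mulr_ge0// sumr_ge0// => i _; rewrite mulr_ge0.
move=> n s; have n0 : 0 < n.+1%:R :> R by [].
apply: (@le_trans _ _ (expect n.+1 s (fun cs => N * \sum_(i : U * V * W)
    (n.+1%:R ^- 2 * (path_sum (visit i.1.1 i.1.2 i.2) s cs - n.+1%:R * p i.1.1 i.1.2 i.2) ^+ 2)))).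
  apply: le_expect => // cs _; rewrite /deviation /total_deviation sum3E.
  apply: le_trans (sqr_sum_le _) _; rewrite ler_wpM2l//; apply: ler_sum => i _.
  rewrite real_normK ?num_real// /empirical -exprVn -exprMn le_eqVlt; apply/orP; left; apply/eqP.
  by congr (_ ^+ 2); field; rewrite gt_eqF.
rewrite expectZ -mulrA ler_wpM2l// expect_sum// mulr_suml; apply: ler_sum => i _.
rewrite expectZ; have [_ /(_ n.+1 s) h] := hK i.
have n2 : 0 <= n.+1%:R ^- 2 :> R by rewrite invr_ge0 exprn_ge0.
apply: le_trans (ler_wpM2l n2 h) _.
have -> : K i * 2 * n.+1%:R^-1 = n.+1%:R ^- 2 * (K i * (2 * n.+1%:R)).
  by field; rewrite gt_eqF.
rewrite ler_wpM2l// ler_wpM2l//.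
by rewrite mulr_natl mulr2n -(natr1 n.+1) lerD2l (@ler_nat _ 1 n.+1).
Qed.

Let loglik s c : R := ln (likelihood_ratio p (uf s c) (vf s c) (wf s c)).

Let stat_mean_loglik : stat_mean Q pi loglik = cond_mutual_info p.
Proof. exact: (p_law (fun u v w => ln (likelihood_ratio p u v w))). Qed.

Lemma near_succ (P : nat -> Prop) :
  (\forall n \near \oo, P n.+1) -> \forall n \near \oo, P n.
Proof. by case=> N _ hN; exists N.+1 => // -[//|n] /= Nn; exact: hN. Qed.

Lemma indicator_le_div (d x : R) : 0 < d -> 0 <= x -> (d < x)%R%:R <= d^-1 * x.
Proof.
move=> d0 x0; have [dx|_] := ltP d x; last by rewrite mulr_ge0// invr_ge0 ltW.
by rewrite mulrC ler_pdivlMr// mul1r ltW.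
Qed.

(** The variance is the stationary second moment of the martingale increments of the log-ratio,
    hence the same from every start s; both claims follow from the closeness of the log-ratio, and
    then of the estimator, to that martingale. *)
Lemma plugin_clt : exists2 sigma2 : R, 0 <= sigma2 &
  (forall s, n%:R^-1 * expect n s (fun cs => (path_sum loglik s cs
      - n%:R * cond_mutual_info p) ^+ 2) @[n --> \oo] --> sigma2) /\
  forall s x, {for x, continuous (fun y : R => normal_law sigma2 `]-oo, y]%classic)} ->
    expect n s (fun cs => (Num.sqrt n%:R *
       (cond_mutual_info (empirical n s cs) - cond_mutual_info p) <= x)%R%:R)
    @[n --> \oo] --> fine (normal_law sigma2 `]-oo, x]%classic).
Proof.
have [D [mart [B B0 hB]]] := martingale_decomposition Q_ge0 Q_sum1 pi_ge0 pi_sum1 pi_inv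
  q0_gt0 Q_ge reach loglik.
rewrite stat_mean_loglik in hB.
pose sigma2 := stat_mean Q pi (fun s c => D s c ^+ 2).
have s0 : 0 <= sigma2.
  by apply: sumr_ge0 => s _; rewrite mulr_ge0// sumr_ge0// => c _; rewrite mulr_ge0// sqr_ge0.
exists sigma2 => //; split=> s.
  have [B' B'0 hB'] := expect_martingale_sqr Q_ge0 Q_sum1 pi_ge0 pi_sum1 pi_inv q0_gt0 Q_ge reach mart.
  rewrite -/sigma2 in hB'.
  apply: (@cvg_from_bound _ _ _ 0) => // e e0.
  exists (B' + B * (sigma2 + B' + 1 + B)) => n; rewrite mul0r add0r.
  have [h0 h1 nh] := sqrt_inv_facts R n.
  set h := (Num.sqrt n.+1%:R)^-1 in h0 h1 nh *.
  have n0 : 0 < n.+1%:R :> R by [].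
  have hn : n.+1%:R^-1 = h ^+ 2 by apply: (mulfI (lt0r_neq0 n0)); rewrite nh divff// gt_eqF.
  set E1 := expect _ _ _; pose E2 := expect n.+1 s (fun cs => path_sum D s cs ^+ 2).
  (* The difference x^2 - y^2 is at most B (B + 2 |y|), and 2 |y| <= h y^2 + 1 / h balances the
     cross term at order sqrt n, negligible after division by n. *)
  have d12 : `|E1 - E2| <= B * (h * E2 + h^-1 + B).
    have -> : B * (h * E2 + h^-1 + B) =
      expect n.+1 s (fun cs => B * (h * path_sum D s cs ^+ 2 + (h^-1 + B))).
      by rewrite expectZ expectD expectZ expect_cst// addrA.
    apply: expect_dist => // cs sz; have := hB s cs; rewrite sz.
    move: (path_sum loglik s cs - _) (path_sum D s cs) => x y xy.
    rewrite subr_sqr normrM; apply: ler_pM => //.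
    have y2 : 2 * `|y| <= h * y ^+ 2 + h^-1.
      have := mulr_ge0 (ltW h0) (sqr_ge0 (`|y| - h^-1)).
      rewrite -[y ^+ 2]real_normK ?num_real//.
      have : h * h^-1 = 1 by rewrite divff// gt_eqF.
      move: (`|y|) (h^-1) => Y g hg.
      have -> : h * (Y - g) ^+ 2 = h * Y ^+ 2 - 2 * Y * (h * g) + (h * g) * g by ring.
      by rewrite hg; lra.
    have -> : x + y = (x - y) + 2 * y by ring.
    apply: le_trans (ler_normD _ _) _; rewrite normrM (ger0_norm (ler0n _ 2)).
    by move: xy y2; lra.
  have e2 : `|E2 - n.+1%:R * sigma2| <= B' by exact: hB'.
  have e2' : `|h ^+ 2 * E2 - sigma2| <= h ^+ 2 * B'.
    have -> : h ^+ 2 * E2 - sigma2 = h ^+ 2 * (E2 - n.+1%:R * sigma2).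
      by rewrite mulrBr mulrA [h ^+ 2 * n.+1%:R]mulrC nh mul1r.
    by rewrite normrM ger0_norm ?sqr_ge0// ler_wpM2l// sqr_ge0.
  have E2le : h * (h ^+ 2 * E2) <= h * (sigma2 + B').
    rewrite ler_wpM2l ?(ltW h0)//.
    have hB1 : h ^+ 2 * B' <= B' by rewrite ler_piMl// exprn_ile1// ltW.
    by move: e2'; rewrite ler_norml => /andP[_]; lra.
  have h2 : h ^+ 2 <= h by rewrite expr2 ler_piMl// ltW.
  have d12' : `|h ^+ 2 * E1 - h ^+ 2 * E2| <= B * (h * (sigma2 + B' + 1 + B)).
    rewrite -mulrBr normrM ger0_norm ?sqr_ge0//.
    apply: le_trans (ler_wpM2l (sqr_ge0 h) d12) _.
    rewrite mulrCA ler_wpM2l//.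
    have -> : h ^+ 2 * (h * E2 + h^-1 + B) = h * (h ^+ 2 * E2) + h + h ^+ 2 * B.
      by field; rewrite gt_eqF.
    by have := ler_wpM2r B0 h2; lra.
  rewrite hn; have := ler_wpM2r B'0 h2.
  move: d12' e2'; rewrite !ler_norml => /andP[? ?] /andP[? ?] ?.
  by apply/andP; split; lra.
move=> x cont.
pose kap := Num.sqrt sigma2.
have kap2 : \sum_s pi s * (\sum_c Q s c * D s c ^+ 2) = kap ^+ 2 by rewrite sqr_sqrtr.
pose m lam b := if kap == 0 then logistic lam b 0 else gauss_mean 0 kap (logistic lam b).
apply: (@cvg_cdf_expect R S C Q nxt Q_ge0 Q_sum1 s _
   (fun n cs => (Num.sqrt n%:R)^-1 * path_sum D s cs) (normal_law sigma2) m) => //.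
- move=> lam b lam0; rewrite /m /kap sqrtr_eq0 /normal_law.
  have [s20|s20] := eqVneq sigma2 0.
    rewrite s20 lexx /= integral_dirac//; last first.
      by apply/measurable_EFinP; exact: measurable_logistic.
    by rewrite diracT mul1e.
  rewrite leNgt lt_def s20 s0 /=; apply: integral_normal_prob; last exact: unit_valued_logistic.
  by rewrite sqrtr_gt0 lt_def s20.
- move=> lam b lam0; exact: (@martingale_clt_logistic R S C Q nxt pi Q_ge0 Q_sum1 pi_sum1
    mixing D kap lam b s lam0 (sqrtr_ge0 _) mart kap2).
move=> d e d0 e0.
have [K K0 hK] := cmi_first_order p_gt0 u0 v0.
have [K' K'0 hK'] := expect_sqr_deviation.
apply: near_succ.
pose M := d^-1 * (K * K' + B).
have M0 : 0 <= M by rewrite mulr_ge0 ?invr_ge0 ?(ltW d0)// addr_ge0// mulr_ge0.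
have cM : M * (Num.sqrt n.+1%:R)^-1 @[n --> \oo] --> (0 : R).
  by rewrite -(mulr0 M); apply: cvgMr; exact: cvg_inv_sqrt.
move/cvgrPdist_le : cM => /(_ _ e0); apply: filterS => n.
rewrite sub0r normrN => /(le_trans (ler_norm _)) hn; apply: le_trans hn.
have [h0 h1 nh] := sqrt_inv_facts R n.
have n0 : 0 < n.+1%:R :> R by [].
have sE : Num.sqrt n.+1%:R = n.+1%:R * (Num.sqrt n.+1%:R)^-1 :> R.
  by rewrite -{2}[n.+1%:R](sqr_sqrtr (ltW n0)) expr2 mulfK// gt_eqF// sqrtr_gt0.
set h := (Num.sqrt n.+1%:R)^-1 in h0 h1 nh sE *; rewrite sE.
have hn : n.+1%:R^-1 = h ^+ 2 by apply: (mulfI (lt0r_neq0 n0)); rewrite nh divff// gt_eqF.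
apply: (@le_trans _ _ (expect n.+1 s (fun cs => d^-1 *
   (n.+1%:R * h * K * deviation n.+1 s cs ^+ 2 + h * B)))).
  apply: le_expect => // cs sz; apply: le_trans (indicator_le_div d0 (normr_ge0 _)) _.
  rewrite ler_wpM2l ?invr_ge0 ?(ltW d0)//.
  have := hK (empirical n.+1 s cs) (empirical_ge0 _ _ _); rewrite sum_empirical -/(loglik) -/(deviation n.+1 s cs).
  have := hB s cs; rewrite sz.
  rewrite -[path_sum (fun _ _ => _) _ _]/(path_sum loglik s cs).
  move: (cond_mutual_info (empirical _ _ _)) (path_sum loglik s cs) (path_sum D s cs) => X L Y b1 b2.
  (* The remainder of the first-order expansion plus the error of the martingale approximation, at
     most n h K dev^2 and h B, both of mean O(h). *)
  have -> : n.+1%:R * h * (X - cond_mutual_info p) - h * Y =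
    n.+1%:R * h * (X - n.+1%:R^-1 * L) + h * (L - n.+1%:R * cond_mutual_info p - Y).
    by field; rewrite gt_eqF.
  apply: le_trans (ler_normD _ _) _; apply: lerD.
    have nh0 : 0 <= n.+1%:R * h by rewrite mulr_ge0// ltW.
    by rewrite normrM (ger0_norm nh0) -[leRHS]mulrA ler_wpM2l.
  by rewrite normrM (gtr0_norm h0) ler_wpM2l// ltW.
rewrite expectZ expectD expectZ expect_cst// /M -[leRHS]mulrA.
apply: ler_wpM2l; first by rewrite invr_ge0 ltW.
have nhK : 0 <= n.+1%:R * h * K by rewrite !mulr_ge0// ltW.
have := ler_wpM2l nhK (hK' n s).
have -> : n.+1%:R * h * K * (K' * n.+1%:R^-1) = K * K' * h by field; rewrite gt_eqF.
rewrite mulrDl [B * h]mulrC; lra.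
Qed.

(** The second assumption turns centring in u under p into centring of a step of the chain. The
    scores are then martingale increments, and [p_law] makes their stationary covariance the
    identity. *)
Lemma plugin_chi_squared : cond_mutual_info p = 0 ->
  (forall F : U -> V -> W -> R, (forall v w, \sum_u p u v w * F u v w = 0) ->
     forall s, \sum_c Q s c * F (uf s c) (vf s c) (wf s c) = 0) ->
  forall s x, {for x, continuous (fun y : R =>
    chi_squared R #|score_index W u0 v0| `]-oo, y]%classic)} ->
  expect n s (fun cs => (2 * n%:R * cond_mutual_info (empirical n s cs) <= x)%R%:R)
    @[n --> \oo] --> fine (chi_squared R #|score_index W u0 v0| `]-oo, x]%classic).
Proof.
move=> I0 centered s x cont.
have indep := cmi_eq0_independent p_gt0 u0 v0 I0.
pose D s c (j : score_index W u0 v0) := score p j (uf s c) (vf s c) (wf s c).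
have mart t j : \sum_c Q t c * D t c j = 0.
  apply: (centered (score p j)) => v w.
  exact: (score_centered p_gt0 indep).
have cov i j : \sum_t pi t * (\sum_c Q t c * (D t c i * D t c j)) = (i == j)%:R.
  rewrite -(score_orthonormal p_gt0).
  exact: (p_law (fun u v w => score p i u v w * score p j u v w)).
(* The linear term of the expansion disappears, so the chi-square form is the leading order. *)
have lnLR u v w : ln (likelihood_ratio p u v w) = 0.
  have p0 u' v' w' : 0 <= p u' v' w' by exact: ltW.
  have [h1 h2 h3] := marginals_gt0 p0 (p_gt0 u v w).
  rewrite ln_likelihood_ratio// -lnM ?posrE// indep lnM ?posrE//; ring.
pose m (lam b : R) := gauss_chi #|score_index W u0 v0| (logistic lam b) 0.
refine (@cvg_cdf_expect R S C Q nxt Q_ge0 Q_sum1 s (fun n cs => 2 * n%:R * cond_mutual_info (empirical n s cs))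
   (fun n cs => \sum_j ((Num.sqrt n%:R)^-1 * path_sum (fun s c => D s c j) s cs) ^+ 2)
   (chi_squared R #|score_index W u0 v0|) m _ _ _ x cont).
- move=> lam b lam0; rewrite -(integral_chi_squared _ 0 (unit_valued_logistic lam b)).
  by apply: eq_integral => z _; rewrite add0r.
- move=> lam b lam0; exact: (martingale_chi_squared_logistic Q_ge0 Q_sum1 pi_sum1 mixing).
move=> d e d0 e0.
have [r0 r0_gt0 [K K0 hK]] := cmi_second_order p_gt0 u0 v0.
have [K' K'0 hK'] := expect_sqr_deviation.
have KK : 0 < 4 * (K * K' + 1) by rewrite mulr_gt0// ltr_wpDl// mulr_ge0.
(* Within radius r the cubic error 2 n K dev^3 is at most 2 n K r dev^2, of mean at most 2 K K' r; r
   makes this at most d e / 2 while staying in the range of the expansion. *)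
pose r := Num.min r0 (d * e / (4 * (K * K' + 1))).
have r_gt0 : 0 < r by rewrite lt_min r0_gt0 divr_gt0// mulr_gt0.
have r_le : 2 * K * K' * r <= d * (e / 2).
  have h : r <= d * e / (4 * (K * K' + 1)) by rewrite ge_min lexx orbT.
  rewrite ler_pdivlMr// in h.
  have : 0 <= K * K' * r by rewrite !mulr_ge0// ltW.
  nra.
apply: near_succ.
have e2 : 0 < e / 2 by rewrite divr_gt0.
have cM : K' * r ^- 2 * (n.+1%:R)^-1 @[n --> \oo] --> (0 : R).
  by rewrite -(mulr0 (K' * r ^- 2)); apply: cvgMr; exact: cvg_harmonic.
move/cvgrPdist_le : cM => /(_ _ e2); apply: filterS => n.
rewrite sub0r normrN => /(le_trans (ler_norm _)) hn.
have n0 : 0 < n.+1%:R :> R by [].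
(* Chebyshev's bound for a deviation above r, Markov's bound on the cubic error below r: the two
   coefficients of dev^2 dominate the indicator in the two cases. *)
apply: (@le_trans _ _ (expect n.+1 s (fun cs =>
   (r ^- 2 + d^-1 * (2 * n.+1%:R * K * r)) * deviation n.+1 s cs ^+ 2))).
  apply: le_expect => // cs sz.
  have dev0 : 0 <= deviation n.+1 s cs by exact: deviation_ge0.
  have c1 : 0 <= r ^- 2 * deviation n.+1 s cs ^+ 2 by rewrite mulr_ge0 ?invr_ge0 ?sqr_ge0.
  have c2 : 0 <= d^-1 * (2 * n.+1%:R * K * r) * deviation n.+1 s cs ^+ 2.
    by rewrite mulr_ge0 ?sqr_ge0// mulr_ge0 ?invr_ge0 ?(ltW d0)// !mulr_ge0// ltW.
  rewrite [leRHS]mulrDl; have [dr|dr] := leP (deviation n.+1 s cs) r; last first.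
    apply: (@le_trans _ _ 1); first by case: (_ < _).
    apply: (@le_trans _ _ (r ^- 2 * deviation n.+1 s cs ^+ 2)); last by rewrite lerDl.
    rewrite mulrC ler_pdivlMr ?exprn_gt0// mul1r.
    by rewrite ler_pXn2r// ?nnegrE ?(ltW r_gt0)// ltW.
  apply: le_trans (indicator_le_div d0 (normr_ge0 _)) _.
  rewrite -[X in _ <= _ + X]mulrA; apply: ler_wpDl => //.
  rewrite ler_wpM2l ?invr_ge0 ?(ltW d0)//.
  have dr0 : deviation n.+1 s cs <= r0 by apply: le_trans dr _; rewrite ge_min lexx.
  have := hK (empirical n.+1 s cs) (empirical_ge0 _ _ _) dr0.
  rewrite -/(deviation n.+1 s cs).
  rewrite [X in _ - X - _](_ : _ = 0) ?subr0; last first.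
    by apply: big1 => u _; apply: big1 => v _; apply: big1 => w _; rewrite lnLR mulr0.
  have -> : \sum_j ((Num.sqrt n.+1%:R)^-1 * path_sum (fun s c => D s c j) s cs) ^+ 2 =
      n.+1%:R * chi_square_form p (empirical n.+1 s cs).
    rewrite (chi_square_form_score u0 v0 p_gt0 indep) mulr_sumr; apply: eq_bigr => j _.
    have -> : \sum_u \sum_v \sum_w (empirical n.+1 s cs u v w - p u v w) * score p j u v w =
      n.+1%:R^-1 * path_sum (fun s c => D s c j) s cs.
      have z : \sum_u \sum_v \sum_w p u v w * score p j u v w = 0.
        rewrite exchange_big /=; apply: big1 => v _; rewrite exchange_big /=.
        by apply: big1 => w _; exact: (score_centered p_gt0 indep).
      rewrite -(sum_empirical n.+1 s cs (score p j)) -[RHS]subr0 -[X in _ = _ - X]z.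
      by rewrite !sum3E -sumrB; apply: eq_bigr => i _; rewrite mulrBl.
    by rewrite exprMn exprVn sqr_sqrtr ?(ltW n0)//; field; rewrite gt_eqF.
  move: (cond_mutual_info _) (chi_square_form _ _) (deviation n.+1 s cs) dev0 dr => X Y w w0 wr h.
  have -> : 2 * n.+1%:R * X - n.+1%:R * Y = 2 * n.+1%:R * (X - 2^-1 * Y) by field.
  have N2 : 0 <= 2 * n.+1%:R :> R by [].
  rewrite normrM (ger0_norm N2) -!mulrA.
  rewrite [2 * _]mulrA [X in _ <= X]mulrA ler_wpM2l//.
  apply: le_trans h _; apply: ler_wpM2l => //; rewrite exprS; apply: ler_wpM2r => //.
  exact: sqr_ge0.
rewrite expectZ.
have c0 : 0 <= r ^- 2 + d^-1 * (2 * n.+1%:R * K * r).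
  by rewrite addr_ge0 ?invr_ge0 ?sqr_ge0// mulr_ge0 ?invr_ge0 ?(ltW d0)// !mulr_ge0// ltW.
apply: le_trans (ler_wpM2l c0 (hK' n s)) _.
have -> : (r ^- 2 + d^-1 * (2 * n.+1%:R * K * r)) * (K' * n.+1%:R^-1) =
   K' * r ^- 2 * n.+1%:R^-1 + d^-1 * (2 * K * K' * r).
  by field; rewrite !gt_eqF.
have : d^-1 * (2 * K * K' * r) <= e / 2 by rewrite ler_pdivrMl.
by move=> h2; rewrite [leRHS](splitr e); exact: lerD.
Qed.

End observed_chain.

(** * Chains of blocks and processes on a probability space *)

Section finite_valued_variable.
Context (R : realType) (d : measure_display) (Omega : measurableType d)
  (P : probability Omega R) (T : finType) (Z : Omega -> T).
Hypothesis Z_rv : finite_rv Z.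

Definition pmf (t : T) : R := fine (P (Z @^-1` [set t])).

Lemma finite_variableE (g : T -> R) :
  g \o Z = fun w => \sum_t g t * \1_(Z @^-1` [set t]) w.
Proof.
apply/funext => w /=; rewrite (bigD1 (Z w))//= big1 => [|t neq].
  by rewrite indicE mem_set// mulr1 addr0.
by rewrite indicE memNset ?mulr0// => /= e; rewrite e eqxx in neq.
Qed.

Lemma measurable_finite_variable (g : T -> R) : measurable_fun setT (g \o Z).
Proof.
rewrite finite_variableE; apply: measurable_sum => t.
by apply: measurable_funM => //; exact: measurable_indic.
Qed.

Lemma expectation_finite_variable (g : T -> R) :
  ('E_P[g \o Z] = (\sum_t pmf t * g t)%:E)%E.
Proof.
rewrite unlock finite_variableE.
under eq_integral do rewrite -sumEFin.
have mi t : measurable_fun setT (\1_(Z @^-1` [set t]) : Omega -> R).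
  exact: measurable_indic.
have ii t : P.-integrable setT (EFin \o (\1_(Z @^-1` [set t]) : Omega -> R)).
  by apply: integrable_indic => //; rewrite ltey_eq fin_num_measure.
have igi t : P.-integrable setT (fun w => (g t * \1_(Z @^-1` [set t]) w)%:E).
  have := integrableZl measurableT (g t) (ii t).
  by apply: eq_integrable => // w _; rewrite /= EFinM.
rewrite (integral_sum measurableT igi).
rewrite -sumEFin; apply: eq_bigr => t _.
under eq_integral do rewrite EFinM.
have -> := integralZl measurableT (ii t) (g t).
by rewrite integral_indic// setIT /pmf mulrC EFinM fineK// fin_num_measure.
Qed.

Lemma probability_finite_variable (E : pred T) :
  P [set w | E (Z w)] = (\sum_t pmf t * (E t)%:R)%:E.
Proof.
rewrite -expectation_finite_variable.
have mE : measurable [set w | E (Z w)].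
  have := measurable_finite_variable (fun t => (E t)%:R) measurableT.
  move=> /(_ [set 1] (measurable_set1 _)); rewrite setTI.
  rewrite (_ : _ @^-1` _ = [set w | E (Z w)])//.
  apply/seteqP; split => w /=; last by move=> ->.
  by case: (E (Z w)) => // /esym/eqP; rewrite oner_eq0.
rewrite unlock -[X in P X]setIT -integral_indic//.
apply: eq_integral => w _ /=; congr (_%:E); rewrite indicE; congr ((nat_of_bool _)%:R).
apply/idP/idP => [/set_mem//|h]; exact: mem_set.
Qed.

Lemma sum_pmf : \sum_t pmf t = 1.
Proof.
have := probability_finite_variable xpredT.
rewrite [X in P X](_ : _ = setT); last by apply/seteqP.
rewrite probability_setT => -[->]; apply: eq_bigr => t _; by rewrite mulr1.
Qed.

End finite_valued_variable.

Section trajectories.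
Context (R : realType) (A B : finType) (k : nat).
Local Notation C := (A * B)%type.
Local Notation S := (k.-tuple A * k.-tuple B)%type.

Lemma val_block (T : Type) (x : nat -> T) t r : block x t r = map x (iota t r) :> seq T.
Proof.
apply: (@eq_from_nth _ (x 0%N)) => [|i]; first by rewrite size_tuple size_map size_iota.
rewrite size_tuple => ir.
by rewrite -[i]/(val (Ordinal ir)) -tnth_nth tnth_mktuple (nth_map 0%N) ?size_iota ?nth_iota.
Qed.

Lemma iota_rcons t r : iota t r.+1 = rcons (iota t r) (t + r)%N.
Proof. by rewrite -addn1 iotaD cats1. Qed.

Lemma block_rcons (T : Type) (x : nat -> T) t r :
  block x t r.+1 = rcons_tuple (block x t r) (x (t + r)%N).
Proof. by apply: val_inj; rewrite /= !val_block iota_rcons map_rcons. Qed.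

Definition push (T : Type) (s : k.-tuple T) (x : T) : k.-tuple T :=
  behead_tuple (rcons_tuple s x).

Lemma push_block (T : Type) (x : nat -> T) t : push (block x t k) (x (t + k)%N) = block x t.+1 k.
Proof. by apply: val_inj; rewrite /push /= !val_block -map_rcons -iota_rcons. Qed.

Definition next_state (s : S) (c : C) : S := (push s.1 c.1, push s.2 c.2).

Definition state_at (z : nat -> C) (t : nat) : S :=
  (block (fst \o z) t k, block (snd \o z) t k).

Definition letters (z : nat -> C) (t n : nat) : seq C := map z (iota (t + k) n).

Lemma next_state_at z t : next_state (state_at z t) (z (t + k)%N) = state_at z t.+1.
Proof. by congr pair; exact: push_block. Qed.

Lemma path_sum_letters (f : S -> C -> R) z t n :
  path_sum next_state f (state_at z t) (letters z t n) =
  \sum_(i < n) f (state_at z (t + i)%N) (z (t + i + k)%N).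
Proof.
elim: n t => [|n IH] t; first by rewrite big_ord0.
rewrite big_ord_recl addn0 /= next_state_at -[map _ _]/(letters z t.+1 n) IH.
by congr (_ + _); apply: eq_bigr => i _; rewrite /bump /= add1n addSnnS.
Qed.

Lemma val_foldl_push (T : Type) (s : k.-tuple T) (xs : seq T) :
  foldl (@push _) s xs = drop (size xs) (s ++ xs) :> seq T.
Proof.
elim: xs s => [|x xs IH] s; first by rewrite /= cats0 drop0.
rewrite /= IH /= -cat_rcons.
by case: (rcons s x) (size_rcons s x).
Qed.

(** Feeding the [k] letters of t pushes out every letter of s; this [k] is the block length of the
    mixing argument. *)
Lemma next_state_reach (s t : S) : exists2 cs, size cs = k & foldl next_state s cs = t.
Proof.
exists (zip t.1 t.2); first by rewrite size_zip !size_tuple minnn.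
have foldl_zip (xs : seq A) (ys : seq B) : size xs = size ys ->
    foldl next_state s (zip xs ys) = (foldl (@push _) s.1 xs, foldl (@push _) s.2 ys).
  elim: xs ys s {t} => [|x xs IH] [|y ys] s //=; first by case: s.
  by move=> [/IH ->].
rewrite foldl_zip ?size_tuple//; case: t => a b; congr pair; apply: val_inj;
  by rewrite [LHS]val_foldl_push /= drop_size_cat// !size_tuple.
Qed.

Variable Q : S -> C -> R.

Fixpoint path_prob (s : S) (cs : seq C) : R :=
  if cs is c :: cs' then Q s c * path_prob (next_state s c) cs' else 1.

Lemma path_prob_letters z t n :
  path_prob (state_at z t) (letters z t n) =
  \prod_(i < n) Q (state_at z (t + i)%N) (z (t + i + k)%N).
Proof.
elim: n t => [|n IH] t; first by rewrite big_ord0.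
rewrite big_ord_recl addn0 /= next_state_at -[map _ _]/(letters z t.+1 n) IH.
by congr (_ * _); apply: eq_bigr => i _; rewrite /bump /= add1n addSnnS.
Qed.

Lemma expect_path_prob n s (G : seq C -> R) :
  expect Q next_state n s G = \sum_(cs : n.-tuple C) path_prob s cs * G cs.
Proof.
elim: n s G => [|n IH] s G /=.
  rewrite (bigD1 [tuple])//= big1 ?addr0 ?mul1r// => cs.
  by rewrite (tuple0 cs) => /eqP; case.
pose h (x : C * n.-tuple C) := [tuple of x.1 :: x.2].
rewrite (reindex h) /=; last first.
  exists (fun cs : n.+1.-tuple C => (thead cs, [tuple of behead cs])) => cs _.
    by case: cs => c cs; rewrite /h /= theadE; congr pair; exact: val_inj.
  by rewrite /h /= -tuple_eta.
rewrite -(pair_bigA _ (fun c cs => path_prob s (h (c, cs)) * G (h (c, cs)))) /=.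
apply: eq_bigr => c _; rewrite IH mulr_sumr; apply: eq_bigr => cs _.
by rewrite mulrA.
Qed.

(** The letters of s followed by cs, as a sequence on nat: the Markov property, stated for such
    sequences, can then be applied to a state and a word. [z0] only fills the end. *)
Definition realization (z0 : C) (s : S) (cs : seq C) (j : nat) : C :=
  nth z0 (zip s.1 s.2 ++ cs) j.

Lemma state_at_realization z0 s cs : state_at (realization z0 s cs) 0 = s.
Proof.
have sz : size (zip s.1 s.2) = k by rewrite size_zip !size_tuple minnn.
case: s z0 sz => a b [a0 b0] /= sz; congr pair; apply: eq_from_tnth => i;
  by rewrite tnth_mktuple /realization /= nth_cat sz ltn_ord nth_zip ?size_tuple//= -tnth_nth.
Qed.

Lemma letters_realization z0 s cs : letters (realization z0 s cs) 0 (size cs) = cs.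
Proof.
have sz : size (zip s.1 s.2) = k by rewrite size_zip !size_tuple minnn.
apply: (@eq_from_nth _ z0) => [|i]; first by rewrite size_map size_iota.
rewrite size_map size_iota => ic.
rewrite (nth_map 0%N) ?size_iota// nth_iota// /realization nth_cat sz.
by rewrite ltnNge leq_addr /= addKn.
Qed.

End trajectories.

Section chain_law.
Context (R : realType) (d : measure_display) (Omega : measurableType d)
  (P : probability Omega R) (A B : finType) (k : nat)
  (Q : k.-tuple A -> k.-tuple B -> A -> B -> R)
  (X : nat -> Omega -> A) (Y : nat -> Omega -> B).
Hypothesis XY_markov : markov_chain P Q X Y.
Local Notation C := (A * B)%type.
Local Notation S := (k.-tuple A * k.-tuple B)%type.

Definition pair_kernel (s : S) (c : C) : R := Q s.1 s.2 c.1 c.2.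
Definition trajectory (w : Omega) (j : nat) : C := (X j w, Y j w).
Definition initial_law (s : S) : R := block_law P X Y 0 k s.1 s.2.
Definition agree (z : nat -> C) (r : nat) : set Omega :=
  [set w | forall i, (i < r)%N -> trajectory w i = z i].

Lemma block_event_agree (z : nat -> C) r :
  block_event X Y 0 (block (fst \o z) 0 r) (block (snd \o z) 0 r) = agree z r.
Proof.
apply/seteqP; split => w /=.
  move=> [ex ey] i ir; move: (congr1 (fun t => tnth t (Ordinal ir)) ex).
  move: (congr1 (fun t => tnth t (Ordinal ir)) ey).
  by rewrite !tnth_mktuple /= /trajectory => -> ->; case: (z i).
by move=> h; split; apply: eq_from_tnth => i; rewrite !tnth_mktuple /= -(h i (ltn_ord i)).
Qed.

Lemma agreeS z r : agree z r.+1 =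
  agree z r `&` [set w | X r w = (z r).1 /\ Y r w = (z r).2].
Proof.
apply/seteqP; split => w /=.
  move=> h; split; first by move=> i ir; apply: h; exact: ltnW.
  by rewrite -(h r (ltnSn _)).
move=> [h [ex ey]] i; rewrite ltnS leq_eqVlt => /predU1P[->|]; last exact: h.
by rewrite /trajectory ex ey; case: (z r).
Qed.

Lemma measurable_agree z r : measurable (agree z r).
Proof.
have [mX mY _] := XY_markov.
elim: r => [|r IH].
  by rewrite (_ : agree z 0 = setT); [exact: measurableT | exact/seteqP].
by rewrite agreeS; apply: measurableI => //; apply: measurableI; [exact: mX|exact: mY].
Qed.

Lemma agree_step z n : fine (P (agree z (n + k).+1)) =
  fine (P (agree z (n + k))) * pair_kernel (state_at k z n) (z (n + k)%N).
Proof.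
have [_ _ /(_ n (fst \o z) (snd \o z))] := XY_markov.
rewrite /= block_event_agree /cond_prob => step.
(* A null past leaves the conditional probability unspecified, but its extension by one letter is
   then null as well. *)
have [P0|P0] := eqVneq (P (agree z (n + k))) 0%E.
  rewrite P0 mul0r; suff -> : P (agree z (n + k).+1) = 0%E by [].
  apply/eqP; rewrite eq_le measure_ge0 andbT -P0.
  apply: le_measure; rewrite ?inE; try exact: measurable_agree.
  by rewrite agreeS; exact: subIsetl.
rewrite /pair_kernel /= -step// agreeS setIC mulrC divfK//.
by rewrite fine_eq0 // fin_num_measure//; exact: measurable_agree.
Qed.

Lemma agree_law z n : fine (P (agree z (n + k))) =
  initial_law (state_at k z 0) *
  path_prob pair_kernel (state_at k z 0) (letters k z 0 n).
Proof.
rewrite path_prob_letters; elim: n => [|n IH].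
  by rewrite big_ord0 mulr1 /initial_law /block_law block_event_agree.
by rewrite addSn agree_step IH big_ord_recr mulrA.
Qed.

(** The finite-valued variable through which all statistics of the sample factor. *)
Definition observed_path (n : nat) (w : Omega) : S * n.-tuple C :=
  (state_at k (trajectory w) 0, block (trajectory w) k n).

Lemma observed_path_fiber z n :
  observed_path n @^-1` [set (state_at k z 0, block z k n)] = agree z (n + k).
Proof.
apply/seteqP; split => w /=; last first.
  move=> h; congr (_, _, _); apply: eq_from_tnth => i; rewrite !tnth_mktuple ?add0n.
  - by rewrite /= -(h i)// (leq_trans (ltn_ord i))// leq_addl.
  - by rewrite /= -(h i)// (leq_trans (ltn_ord i))// leq_addl.
  - by rewrite h// addnC ltn_add2r.
move=> e i ink; have [ik|ki] := ltnP i k.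
  move: (congr1 (fun t => tnth t.1.1 (Ordinal ik)) e).
  move: (congr1 (fun t => tnth t.1.2 (Ordinal ik)) e).
  by rewrite !tnth_mktuple /= !add0n /trajectory => -> ->; case: (z i).
have ikn : (i - k < n)%N by rewrite ltn_subLR// addnC.
move: (congr1 (fun t => tnth t.2 (Ordinal ikn)) e).
by rewrite !tnth_mktuple /= subnKC.
Qed.

Section inhabited.
Variable z0 : C.

Let observed_pathP n (t : S * n.-tuple C) :
  exists z, t = (state_at k z 0, block z k n) /\ t.2 = letters k z 0 n :> seq C.
Proof.
case: t => s cs; exists (realization z0 s cs); split=> /=.
  rewrite state_at_realization; congr pair; apply: val_inj.
  by rewrite [RHS]val_block -[LHS](letters_realization z0 s) size_tuple.
by rewrite -[LHS](letters_realization z0 s) size_tuple.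
Qed.

Lemma observed_path_rv n : finite_rv (observed_path n).
Proof.
move=> t; have [z [-> _]] := observed_pathP t.
by rewrite observed_path_fiber; exact: measurable_agree.
Qed.

Lemma pmf_observed_path n (t : S * n.-tuple C) :
  pmf P (observed_path n) t = initial_law t.1 * path_prob pair_kernel t.1 t.2.
Proof.
have [z [e ez]] := observed_pathP t.
rewrite ez e /pmf observed_path_fiber agree_law.
by [].
Qed.

Let letters_trajectory n w : letters k (trajectory w) 0 n = (observed_path n w).2 :> seq C.
Proof. by rewrite /= val_block. Qed.

Let sum_observed_path n (G : S -> seq C -> R) :
  \sum_(t : S * n.-tuple C) pmf P (observed_path n) t * G t.1 t.2 =
  \sum_s initial_law s * expect pair_kernel (@next_state A B k) n s (G s).
Proof.
under eq_bigr do rewrite pmf_observed_path.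
rewrite -(pair_bigA _ (fun s (cs : n.-tuple C) =>
  initial_law s * path_prob pair_kernel s cs * G s cs)) /=.
apply: eq_bigr => s _; rewrite expect_path_prob mulr_sumr.
by apply: eq_bigr => cs _; rewrite mulrA.
Qed.

Lemma sum_initial_law : \sum_s initial_law s = 1.
Proof.
rewrite -(sum_pmf P (@observed_path_rv 0)).
under [RHS]eq_bigr do rewrite -[pmf _ _ _]mulr1.
rewrite (@sum_observed_path 0 (fun _ _ => 1)) /=.
by under [RHS]eq_bigr do rewrite mulr1.
Qed.

Lemma measurable_along_path n (G : S -> seq C -> R) :
  measurable_fun setT (fun w => G (state_at k (trajectory w) 0) (letters k (trajectory w) 0 n)).
Proof.
have := measurable_finite_variable (@observed_path_rv n) (fun t => G t.1 t.2).
by under [X in _ -> measurable_fun _ X]eq_fun do rewrite letters_trajectory.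
Qed.

Lemma expectation_along_path n (G : S -> seq C -> R) :
  ('E_P[fun w => G (state_at k (trajectory w) 0) (letters k (trajectory w) 0 n)] =
   (\sum_s initial_law s * expect pair_kernel (@next_state A B k) n s (G s))%:E)%E.
Proof.
rewrite -sum_observed_path.
rewrite -(expectation_finite_variable P (@observed_path_rv n) (fun t => G t.1 t.2)).
by congr ('E_P[_])%E; apply/funext => w; rewrite letters_trajectory.
Qed.

Lemma probability_along_path n (E : S -> seq C -> bool) :
  P [set w | E (state_at k (trajectory w) 0) (letters k (trajectory w) 0 n)] =
  (\sum_s initial_law s *
    expect pair_kernel (@next_state A B k) n s (fun cs => (E s cs)%:R))%:E.
Proof.
rewrite -(sum_observed_path n (fun s cs => (E s cs)%:R)).
rewrite -(probability_finite_variable P (@observed_path_rv n) (fun t => E t.1 t.2)).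
by congr (P _); apply/seteqP; split => w /=; rewrite letters_trajectory.
Qed.

End inhabited.

End chain_law.

(** * The stationary version and its one-step law *)

Section stationary_chain.
Context (R : realType) (d : measure_display) (Omega : measurableType d)
  (P : probability Omega R) (A B : finType) (k : nat)
  (Q : k.-tuple A -> k.-tuple B -> A -> B -> R)
  (X : int -> Omega -> A) (Y : int -> Omega -> B).
Hypothesis Q_trans : transition_matrix Q.
Hypothesis Q_gt0 : forall a b a' b', 0 < Q a b a' b'.
Hypothesis XY_stationary : stationary_version P Q X Y.
Local Notation C := (A * B)%type.
Local Notation S := (k.-tuple A * k.-tuple B)%type.
Local Notation next_state := (@next_state A B k).
Local Notation K := (pair_kernel Q).
Variable z0 : C.

(** Index 0 now stands for time -k: the state is the window of times -k, ..., -1, and the next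
    letter is that of time 0. *)
Let X' := shifted X (- k%:Z).
Let Y' := shifted Y (- k%:Z).
Let XY_markov : markov_chain P Q X' Y'. Proof. by have [h _ _] := XY_stationary; exact: h. Qed.

Definition invariant_pmf : S -> R := initial_law P X' Y'.
Local Notation pi := invariant_pmf.

Lemma pair_kernel_ge0 (s : S) (c : C) : 0 <= K s c. Proof. exact/ltW/Q_gt0. Qed.

Lemma sum_pair_kernel (s : S) : \sum_c K s c = 1.
Proof. by rewrite -(Q_trans.2 s.1 s.2) pair_bigA. Qed.

Definition kernel_min : R := \big[Order.min/1]_(x : S * C) K x.1 x.2.

Lemma kernel_min_gt0 : 0 < kernel_min.
Proof. by apply: lt_bigmin => // x _; exact: Q_gt0. Qed.

Lemma kernel_min_le (s : S) (c : C) : kernel_min <= K s c.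
Proof. exact: (bigmin_le 1 (s, c) (fun x => K x.1 x.2)). Qed.

Lemma invariant_pmf_ge0 s : 0 <= pi s. Proof. exact: fine_ge0. Qed.

Lemma sum_invariant_pmf : \sum_s pi s = 1.
Proof. exact: (sum_initial_law XY_markov z0). Qed.

(* The state and letter leading to [t] when the letter dropped by [push] is [x]. *)
Definition pull (T : Type) (x : T) (t : k.-tuple T) : k.-tuple T * T :=
  (belast_tuple x t, last x t).

Lemma rcons_pull (T : Type) (x : T) (t : k.-tuple T) :
  rcons (pull x t).1 (pull x t).2 = x :: t.
Proof. by rewrite /= -lastI. Qed.

Lemma push_pull (T : Type) (x : T) (t : k.-tuple T) : push (pull x t).1 (pull x t).2 = t.
Proof. by apply: val_inj; rewrite /= -lastI. Qed.

Lemma thead_pull (T : Type) (x : T) (t : k.-tuple T) :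
  thead (rcons_tuple (pull x t).1 (pull x t).2) = x.
Proof. by rewrite /thead (tnth_nth x) /= -lastI. Qed.

Lemma pull_rcons (T : Type) (s : k.-tuple T) (y : T) (v : k.+1.-tuple T) :
  rcons s y = v :> seq T -> pull (thead v) (behead_tuple v) = (s, y).
Proof.
move=> e; have := rcons_pull (thead v) (behead_tuple v).
have -> : thead v :: behead_tuple v = v := esym (congr1 val (tuple_eta v)).
rewrite -e => /rcons_inj[e1 e2]; rewrite [LHS]surjective_pairing.
by congr pair => //; exact: val_inj.
Qed.

(** A window of k + 1 letters is a state with its next letter, or a dropped letter with the new
    state; the sum is reindexed by this bijection. *)
Lemma sum_pull (F : S -> C -> R) :
  \sum_s \sum_c F s c = \sum_(t : S) \sum_(c : C)
    F ((pull c.1 t.1).1, (pull c.2 t.2).1) ((pull c.1 t.1).2, (pull c.2 t.2).2).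
Proof.
rewrite [LHS]pair_bigA [RHS]pair_bigA /=.
rewrite (reindex (fun x : S * C => (((pull x.2.1 x.1.1).1, (pull x.2.2 x.1.2).1),
  ((pull x.2.1 x.1.1).2, (pull x.2.2 x.1.2).2))))//.
exists (fun x : S * C => (next_state x.1 x.2,
  (thead (rcons_tuple x.1.1 x.2.1), thead (rcons_tuple x.1.2 x.2.2)))).
- by move=> [[a b] [x y]] _; rewrite /next_state !push_pull !thead_pull.
- move=> [[a b] [x y]] _.
  pose l := pull (thead (rcons_tuple a x)) (push a x).
  pose r := pull (thead (rcons_tuple b y)) (push b y).
  rewrite -[LHS]/((l.1, r.1), (l.2, r.2)) /l /r /push.
  by rewrite (@pull_rcons _ a x)// (@pull_rcons _ b y).
Qed.

Lemma invariant_pmf_inv (g : S -> R) :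
  \sum_s pi s * markov_op K next_state g s = \sum_s pi s * g s.
Proof.
have [_ st iv] := XY_stationary.
under eq_bigr do rewrite mulr_sumr.
rewrite (sum_pull (fun s c => pi s * (K s c * g (next_state s c)))) /=.
apply: eq_bigr => -[a b] _; rewrite /next_state.
have -> : pi (a, b) = \sum_(a0 : A) \sum_(b0 : B)
    pi (belast_tuple a0 a, belast_tuple b0 b) *
    Q (belast_tuple a0 a) (belast_tuple b0 b) (last a0 a) (last b0 b).
  (* The invariance equation is stated for the window starting at 1 - k; stationarity transports it
     to the one starting at -k. *)
  rewrite /pi /initial_law /= -/(shifted X _) st -(st (1 - k%:Z)) iv.
  by apply: eq_bigr => a0 _; apply: eq_bigr => b0 _; rewrite !st.
rewrite [in RHS]pair_bigA mulr_suml; apply: eq_bigr => -[x y] _ /=.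
by rewrite !push_pull mulrA.
Qed.

(** The invariant law is its own image after k steps, in which every state leads to t with
    probability at least [kernel_min ^+ k]. *)
Lemma invariant_pmf_gt0 t : 0 < pi t.
Proof.
pose g s : R := (s == t)%:R.
have -> : pi t = \sum_s pi s * g s.
  rewrite (bigD1 t)//= big1 ?addr0 /g ?eqxx ?mulr1// => s /negPf ->.
  by rewrite mulr0.
rewrite -(pi_iter_markov_op invariant_pmf_inv k).
apply: (@lt_le_trans _ _ (\sum_s pi s * kernel_min ^+ k)).
  by rewrite -mulr_suml sum_invariant_pmf mul1r exprn_gt0// kernel_min_gt0.
apply: ler_sum => s _; apply: ler_wpM2l; first exact: invariant_pmf_ge0.
have [cs sz e] := next_state_reach s t.
have := iter_markov_op_ge_path next_state pair_kernel_ge0 sum_pair_kernel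
  kernel_min_gt0 kernel_min_le s cs (fun u => ler0n R (u == t)).
by rewrite e eqxx mulr1 sz.
Qed.

Definition stationary_triple : B -> k.+1.-tuple A -> k.-tuple B -> R :=
  directed_triple (block_law P X' Y' 0 k.+1).
Local Notation p := stationary_triple.

Lemma stationary_tripleE (s : S) (c : C) :
  p c.2 (rcons_tuple s.1 c.1) s.2 = pi s * K s c.
Proof.
have := agree_law XY_markov (realization z0 s [:: c]) 1.
rewrite -block_event_agree add1n !block_rcons.
have := letters_realization z0 s [:: c]; rewrite /letters /= => -[->].
have es := state_at_realization z0 s [:: c].
have /= -> := congr1 fst es; have /= -> := congr1 snd es.
by rewrite es mulr1.
Qed.

Lemma stationary_triple_pull u v w : p u v w =
  let x := pull (thead v) (behead_tuple v) in pi (x.1, w) * K (x.1, w) (x.2, u).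
Proof.
rewrite /= -stationary_tripleE /=; congr (p u _ w); apply: val_inj.
by rewrite /= -lastI; exact: (congr1 val (tuple_eta v)).
Qed.

Lemma stationary_triple_gt0 u v w : 0 < p u v w.
Proof. by rewrite stationary_triple_pull mulr_gt0//; [exact: invariant_pmf_gt0|exact: Q_gt0]. Qed.

Lemma stationary_triple_law (F : B -> k.+1.-tuple A -> k.-tuple B -> R) :
  stat_mean K pi (fun s c => F c.2 (rcons_tuple s.1 c.1) s.2) =
  \sum_u \sum_v \sum_w p u v w * F u v w.
Proof.
rewrite /stat_mean; under eq_bigr do rewrite mulr_sumr.
rewrite pair_bigA /= sum3E.
rewrite (reindex (fun x : S * C => (x.2.2, rcons_tuple x.1.1 x.2.1, x.1.2))) /=; last first.
  exists (fun t : B * k.+1.-tuple A * k.-tuple B =>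
    let x := pull (thead t.1.2) (behead_tuple t.1.2) in ((x.1, t.2), (x.2, t.1.1))).
    move=> [[a b] [x y]] _; pose l := pull (thead (rcons_tuple a x)) (push a x).
    by rewrite -[LHS]/((l.1, b), (l.2, y)) /l /push (@pull_rcons _ a x).
  move=> [[u v] w] _ /=; congr (_, _, _); apply: val_inj.
  by rewrite /= -lastI; exact/esym/(congr1 val (tuple_eta v)).
by apply: eq_bigr => -[s c] _; rewrite stationary_tripleE mulrA.
Qed.

(** Given the state, the next pair is summed over the Y-letter first, with the X-letter fixed: up to
    the factor [pi s], this inner sum is a p-sum over u with v and w fixed. *)
Lemma conditional_mean0 (F : B -> k.+1.-tuple A -> k.-tuple B -> R) :
  (forall v w, \sum_u p u v w * F u v w = 0) ->
  forall s : S, \sum_c K s c * F c.2 (rcons_tuple s.1 c.1) s.2 = 0.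
Proof.
move=> F0 s; apply: (mulfI (lt0r_neq0 (invariant_pmf_gt0 s))).
rewrite mulr0 mulr_sumr.
under eq_bigr do rewrite mulrA -stationary_tripleE.
rewrite -(pair_bigA _ (fun a b => p b (rcons_tuple s.1 a) s.2 * F b (rcons_tuple s.1 a) s.2)).
by apply: big1 => a _; exact: F0.
Qed.

End stationary_chain.

Lemma cvg_weighted_sum (R : realType) (S : finType) (a l : S -> R) (u : S -> nat -> R) :
  (forall s, u s n @[n --> \oo] --> l s) ->
  \sum_s a s * u s n @[n --> \oo] --> \sum_s a s * l s.
Proof.
move=> h; elim: (index_enum S) => [|s r IH].
  by under eq_fun do rewrite big_nil; rewrite big_nil; exact: cvg_cst.
under eq_fun do rewrite big_cons.
rewrite big_cons; apply: cvgD => //.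
by apply: cvgM; [exact: cvg_cst|exact: h].
Qed.

Lemma cvg_EFin_of (R : realType) (u : nat -> R) (l : R) :
  u n @[n --> \oo] --> l -> (u n)%:E @[n --> \oo] --> l%:E.
Proof.
move=> h; apply/fine_cvgP; split; first exact: nearW.
exact: h.
Qed.

Section along_paths.
Context (R : realType) (d : measure_display) (Omega : measurableType d)
  (P : probability Omega R) (A B : finType) (k : nat)
  (Q : k.-tuple A -> k.-tuple B -> A -> B -> R)
  (X : nat -> Omega -> A) (Y : nat -> Omega -> B).
Hypothesis XY_markov : markov_chain P Q X Y.
Variable z0 : A * B.
Local Notation C := (A * B)%type.
Local Notation S := (k.-tuple A * k.-tuple B)%type.
Local Notation next_state := (@next_state A B k).
Local Notation K := (pair_kernel Q).
Local Notation start w := (state_at k (trajectory X Y w) 0).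
Local Notation sample n w := (letters k (trajectory X Y w) 0 n).

(** The arbitrary initial law only mixes the starting states, with weights summing to 1, and the
    limit is the same from each of them. *)
Lemma cvg_in_distribution_along_path (G : nat -> S -> seq C -> R)
    (mu : probability (measurableTypeR R) R) :
  (forall s x, {for x, continuous (fun y : R => mu `]-oo, y]%classic)} ->
     expect K next_state n s (fun cs => (G n s cs <= x)%R%:R) @[n --> \oo]
       --> fine (mu `]-oo, x]%classic)) ->
  cvg_in_distribution P (fun n w => G n (start w) (sample n w)) mu.
Proof.
move=> h; split=> [n|x cx].
  exact: (measurable_along_path XY_markov z0).
under eq_fun do rewrite (probability_along_path XY_markov z0 _ (fun s cs => G _ s cs <= x)).
rewrite -[mu _]fineK ?fin_num_measure//.
apply: cvg_EFin_of.
have -> : fine (mu `]-oo, x]%classic) =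
    \sum_(s : S) initial_law P X Y s * fine (mu `]-oo, x]%classic).
  by rewrite -mulr_suml (sum_initial_law XY_markov z0) mul1r.
by apply: cvg_weighted_sum => s; exact: h.
Qed.

Lemma plugin_along_path n w : plugin_estimator R k X Y n w =
  cond_mutual_info (empirical R next_state (fun _ c => c.2)
    (fun s c => rcons_tuple s.1 c.1) (fun s _ => s.2) n (start w) (sample n w)).
Proof.
congr cond_mutual_info; apply/funext => u; apply/funext => v; apply/funext => yp.
rewrite /directed_triple /empirical_law /empirical path_sum_letters.
congr (_ * _); apply: eq_bigr => i _; rewrite add0n; congr (nat_of_bool _)%:R.
have e (a : k.-tuple B) y : (rcons_tuple a y == rcons_tuple yp u) = (a == yp) && (y == u).
  exact: eqseq_rcons.
rewrite !block_rcons e /=; case: (_ == u); last by rewrite !andbF.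
by rewrite andbT.
Qed.

Lemma log_likelihood_along_path (q : k.+1.-tuple A -> k.+1.-tuple B -> R) n w :
  (forall u v yp, 0 < directed_triple q u v yp) ->
  log_likelihood_ratio X Y q n w =
  path_sum next_state (fun s c => ln (likelihood_ratio (directed_triple q)
    c.2 (rcons_tuple s.1 c.1) s.2)) (start w) (sample n w).
Proof.
move=> q0; rewrite path_sum_letters /log_likelihood_ratio.
have r0 u v yp : 0 < likelihood_ratio (directed_triple q) u v yp.
  have [h1 h2 h3] := marginals_gt0 (fun u v yp => ltW (q0 u v yp)) (q0 u v yp).
  by apply: divr_gt0; [exact: divr_gt0|apply: mulr_gt0; exact: divr_gt0].
elim: n => [|n IH]; first by rewrite !big_ord0 ln1.
rewrite !big_ord_recr /= lnM ?posrE ?prodr_gt0// IH add0n; congr (_ + ln _).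
by rewrite block_rcons.
Qed.

(** The variance is expanded around m, to be taken as n I, rather than around the true mean, which
    depends on the initial law; c is the resulting bias. *)
Lemma variance_along_path n (L : S -> seq C -> R) (m : R) (c := \sum_s initial_law P X Y s *
      expect K next_state n s (fun cs => L s cs - m)) :
  (forall s c, 0 <= K s c) -> (forall s, \sum_c K s c = 1) ->
  ('V_P[fun w => L (start w) (sample n w)] =
   (\sum_s initial_law P X Y s * expect K next_state n s (fun cs => (L s cs - m) ^+ 2)
    - c ^+ 2)%:E)%E.
Proof.
move=> K0 K1.
rewrite /variance unlock.
rewrite (expectation_along_path XY_markov z0) /=.
set mu := \sum_s _ * expect _ _ n s (L s).
have cE : c = mu - m.
  rewrite /c /mu -[m in RHS]mul1r -(sum_initial_law XY_markov z0) mulr_suml -sumrB.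
  apply: eq_bigr => s _; rewrite expectD// expect_cst//; ring.
apply: etrans (expectation_along_path XY_markov z0 n
  (fun s cs => (L s cs - mu) * (L s cs - mu))) _.
congr (_%:E).
rewrite cE.
have sqrE s : expect K next_state n s (fun cs => (L s cs - mu) * (L s cs - mu)) =
    expect K next_state n s (fun cs => (L s cs - m) ^+ 2) +
    2 * (m - mu) * expect K next_state n s (fun cs => L s cs - m) + (m - mu) ^+ 2.
  rewrite -(expect_cst next_state K1 n s ((m - mu) ^+ 2)) -expectZ// -!expectD//.
  by apply: eq_expect => // cs _; ring.
transitivity (\sum_s (initial_law P X Y s * expect K next_state n s (fun cs => (L s cs - m) ^+ 2) +
     (2 * (m - mu)) * (initial_law P X Y s * expect K next_state n s (fun cs => L s cs - m)) +
     initial_law P X Y s * (m - mu) ^+ 2)).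
  apply: eq_bigr => s _; rewrite -[in RHS]mulrCA -!mulrDr; congr (_ * _); exact: sqrE.
rewrite !big_split /= -mulr_sumr -mulr_suml (sum_initial_law XY_markov z0).
by rewrite -/c cE; ring.
Qed.

End along_paths.

Lemma cvg_div_bounded (R : realType) (u : nat -> R) (b : R) :
  (forall n, `|u n| <= b) -> n%:R^-1 * u n @[n --> \oo] --> (0 : R).
Proof.
move=> h; apply/cvgr0Pnorm_le => e e0; near=> n.
have n0 : 0 < n%:R :> R by rewrite ltr0n; near: n; exact: nbhs_infty_gt.
rewrite normrM ger0_norm ?invr_ge0 ?ler0n// ler_pdivrMl//.
apply: le_trans (h n) _; rewrite -ler_pdivrMr//.
by near: n; exact: nbhs_infty_ger.
Unshelve. all: by end_near. Qed.

Theorem theorem3p3 (R : realType) (A B : finType) (k : nat)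
    (Q : k.-tuple A -> k.-tuple B -> A -> B -> R)
    (d : measure_display) (Omega : measurableType d) (P : probability Omega R)
    (X : nat -> Omega -> A) (Y : nat -> Omega -> B)
    (d' : measure_display) (Omega' : measurableType d')
    (P' : probability Omega' R)
    (Xbar : int -> Omega' -> A) (Ybar : int -> Omega' -> B) :
  (1 <= k)%N ->
  transition_matrix Q ->
  (forall a b a' b', 0 < Q a b a' b') ->
  markov_chain P Q X Y ->
  stationary_version P' Q Xbar Ybar ->
  let Pbar := block_law P' (shifted Xbar (- k%:Z)) (shifted Ybar (- k%:Z))
                0 k.+1 in
  let I := directed_info Pbar in
  let Ihat := plugin_estimator R k X Y in
  (I != 0 ->
   exists sigma2 : R,
     ((n%:R^-1)%:E * 'V_P[log_likelihood_ratio X Y Pbar n])%E @[n --> \oo]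
       --> sigma2%:E /\
     cvg_in_distribution P
       (fun n w => Num.sqrt n%:R * (Ihat n w - I)) (normal_law sigma2)) /\
  (I = 0 ->
   cvg_in_distribution P
     (fun n w => 2 * n%:R * Ihat n w)
     (chi_squared R (#|B| ^ k * (#|A| ^ k.+1 - 1) * (#|B| - 1))%N)).
Proof.
move=> _ Qt Q0 XYm XYs Pbar I Ihat.
(* A probability space is nonempty, so both alphabets have a letter. *)
have [w0 _] : exists w : Omega, True.
  apply: contrapT => ne; have := @probability_setT _ _ _ P.
  have -> : [set: Omega] = set0 by apply/seteqP; split => w // _; apply: ne; exists w.
  by rewrite measure0 => -[] /eqP; rewrite eq_sym oner_eq0.
pose z0 := trajectory X Y w0 0%N.
have K0 := pair_kernel_ge0 Q0.
have K1 := sum_pair_kernel Qt.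
have p0 := stationary_triple_gt0 Qt Q0 XYs z0.
have p_law := stationary_triple_law XYs z0.
have pi0 := @invariant_pmf_ge0 _ _ _ P' A B k Xbar Ybar.
have pi1 := sum_invariant_pmf XYs z0.
have piI := invariant_pmf_inv XYs.
have q0 := kernel_min_gt0 Q0.
have qm := kernel_min_le Q.
have reach := @next_state_reach A B k.
(* A constant word and the letter [z0.2] serve as the distinguished elements v0 and u0. *)
pose x0 : k.+1.-tuple A := nseq_tuple k.+1 z0.1.
split=> [_|I0].
  have [sigma2 s0 [hv hd]] := plugin_clt K0 K1 pi0 pi1 piI q0 qm reach z0.2 x0 p0 p_law.
  exists sigma2; split; last first.
    have := cvg_in_distribution_along_path XYm z0 hd.
    by under eq_fun do under eq_fun do rewrite -plugin_along_path.
  pose l (s : k.-tuple A * k.-tuple B) (c : A * B) : R :=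
    ln (likelihood_ratio (directed_triple Pbar) c.2 (rcons_tuple s.1 c.1) s.2).
  have [b b0 hb] := expect_additive_mean_le K0 K1 pi0 pi1 piI q0 qm reach l.
  have lI : stat_mean (pair_kernel Q) (invariant_pmf P' Xbar Ybar (k:=k)) l = I.
    exact: (p_law (fun u v w => ln (likelihood_ratio (directed_triple Pbar) u v w))).
  have LE n : log_likelihood_ratio X Y Pbar n = fun w => path_sum (@next_state A B k) l
      (state_at k (trajectory X Y w) 0) (letters k (trajectory X Y w) 0 n).
    by apply/funext => w; exact: log_likelihood_along_path.
  (* The squared bias is at most b^2, so division by n removes it and the second moment around n I
     gives the limit. *)
  under eq_fun => n do rewrite LE (variance_along_path XYm z0 n
    (fun s cs => path_sum (@next_state A B k) l s cs) (n%:R * I) K0 K1) -EFinM mulrBr.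
  apply: cvg_EFin_of; rewrite -[sigma2]subr0; apply: cvgB.
    under eq_fun do rewrite mulr_sumr.
    under eq_fun do under eq_bigr do rewrite mulrCA.
    have -> : sigma2 = \sum_(s : k.-tuple A * k.-tuple B) initial_law P X Y s * sigma2.
      by rewrite -mulr_suml (sum_initial_law XYm z0) mul1r.
    by apply: cvg_weighted_sum => s; exact: hv.
  apply: (@cvg_div_bounded _ _ (b ^+ 2)) => n.
  rewrite normrX lerXn2r ?nnegrE ?normr_ge0//.
  apply: le_trans (ler_norm_sum _ _ _) _.
  have -> : b = \sum_(s : k.-tuple A * k.-tuple B) initial_law P X Y s * b.
    by rewrite -mulr_suml (sum_initial_law XYm z0) mul1r.
  apply: ler_sum => s _.
  rewrite normrM ger0_norm ?fine_ge0//; apply: ler_wpM2l; first exact: fine_ge0.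
  by have := hb n s; rewrite lI.
have := plugin_chi_squared K0 K1 pi0 pi1 piI q0 qm reach (u0 := z0.2) (v0 := x0) p0 p_law I0
  (fun F h => conditional_mean0 Qt Q0 XYs z0 h).
(* Here U = B, V = A^(k+1) and W = B^k, which yields the stated degrees of freedom. *)
rewrite card_score_index !card_tuple mulnAC => hd.
have := cvg_in_distribution_along_path XYm z0 hd.
by under eq_fun do under eq_fun do rewrite -plugin_along_path.
Qed.
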